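(* Let $(x_k,y_k)\in\mathbb{Z}^d\times\mathbb{Z}^d$ $(1\le k\le N-1)$ and $(\alpha,\beta)\in(\mathbb{R}^d\times\mathbb{R}^d)\setminus(\mathbb{Z}^d\times\mathbb{Z}^d)$, and assume that $0\ne f\in\mathcal{S}(\mathbb{R}^d)$ and $c_1,\dots,c_{N-1}\in\mathbb{C}$ satisfy $\sum_{k=1}^{N-1}c_kM_{y_k}T_{x_k}f=M_\beta T_\alpha f$. Let $\gamma=(-\alpha,\beta)$ and assume that $H=\overline{\{n\gamma\bmod\mathbb{Z}^{2d}:n\in\mathbb{Z}\}}\subset\mathbb{T}^{2d}$ is infinite and proper. Let $H_0$ be the identity component of $H$, $m=|H/H_0|$, $r=\dim H_0$, choose a Lie group isomorphism $\Phi:H_0\to\mathbb{T}^r$, and set $\omega:=\Phi(m\gamma)\in\mathbb{T}^r$. Then $\omega$ has dense orbit in $\mathbb{T}^r$ (i.e. $\{n\omega:n\in\mathbb{Z}\}$ is dense in $\mathbb{T}^r$). Fix $\lambda\in S$ and define, for $x\in\mathbb{T}^r$, $$u_\lambda(x):=\log F(\lambda+\Phi^{-1}(x)),\qquad b_\lambda(x):=\log Q_m(\lambda+\Phi^{-1}(x)).$$ Then: (i) $u_\lambda\in C^\infty(\mathbb{T}^r)$ and $b_\lambda$ is real-analytic on $\mathbb{T}^r$; (ii) $u_\lambda(x+\omega)-u_\lambda(x)=b_\lambda(x)$ for all $x\in\mathbb{T}^r$; (iii) $\widehat b_\lambda(0)=\int_{\mathbb{T}^r}b_\lambda(x)\,dx=0$;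 (iv) for every $k\in\mathbb{Z}^r\setminus\{0\}$, $$\widehat u_\lambda(k)=\frac{\widehat b_\lambda(k)}{e^{2\pi i\langle k,\omega\rangle}-1};$$ (v) there exists a constant $c(\lambda)\in\mathbb{R}$ such that $$u_\lambda(x)=c(\lambda)+\sum_{k\in\mathbb{Z}^r\setminus\{0\}}\frac{\widehat b_\lambda(k)}{e^{2\pi i\langle k,\omega\rangle}-1}e^{2\pi i\langle k,x\rangle},$$ with convergence in $C^\infty(\mathbb{T}^r)$.
   Context: Here $d\ge1$, $N\ge2$ are integers, $\langle\cdot,\cdot\rangle$ is the standard inner product, $\mathcal{S}(\mathbb{R}^d)$ is the Schwartz space, and $\mathbb{T}^n=\mathbb{R}^n/\mathbb{Z}^n$; periodic functions on $\mathbb{R}^n$ are identified with functions on $\mathbb{T}^n$, and vectors of $\mathbb{R}^{2d}$ act on $\mathbb{T}^{2d}$ by translation modulo $\mathbb{Z}^{2d}$. Time-frequency shifts: $T_xf(t)=f(t-x)$, $M_yf(t)=e^{-2\pi i\langle y,t\rangle}f(t)$. Zak transform: $Zf(t,\xi)=\sum_{\kappa\in\mathbb{Z}^d}e^{-2\pi i\langle\xi,\kappa\rangle}f(t+\kappa)$ on $\mathbb{R}^d\times\mathbb{R}^d$. Its modulus $F:=|Zf|$ is $\mathbb{Z}^{2d}$-periodic and is regarded as a continuous function on $\mathbb{T}^{2d}$. $S:=\{z\in\mathbb{T}^{2d}:F(z)\ne0\}$. $p(t,\xi):=\sum_{k=1}^{N-1}c_ke^{-2\pi i\langle y_k,t\rangle}e^{-2\pi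 i\langle\xi,x_k\rangle}$, regarded as a function on $\mathbb{T}^{2d}$, and $Q_m(z):=\prod_{j=0}^{m-1}|p(z+j\gamma)|$ for $z\in\mathbb{T}^{2d}$. $H$ is a closed subgroup of $\mathbb{T}^{2d}$, hence a compact abelian Lie group; ''proper'' means $H\ne\mathbb{T}^{2d}$. $H_0$ is a torus, $H/H_0$ is finite cyclic generated by the class of $\gamma$, and the class of $m\gamma$ lies in $H_0$. Fourier coefficients: $\widehat g(k)=\int_{\mathbb{T}^r}g(x)e^{-2\pi i\langle k,x\rangle}\,dx$, $k\in\mathbb{Z}^r$. *)

(* Defs.v *)
From HB Require Import structures.
From mathcomp Require Import all_boot all_order all_algebra finmap.
From mathcomp Require Import generic_quotient ring_quotient.
From mathcomp Require Import all_classical all_reals all_analysis.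
From mathcomp Require Import complex.
From mathcomp.analysis Require Import showcase.summability.
Import Order.TTheory GRing.Theory Num.Theory.
Import numFieldNormedType.Exports.

Set Implicit Arguments.
Unset Strict Implicit.
Unset Printing Implicit Defensive.

Local Open Scope classical_set_scope.
Local Open Scope ring_scope.
Local Open Scope complex_scope.
Local Open Scope quotient_scope.

(* R^n is 'rV[R]_n and T^n = R^n/Z^n carries the quotient group structure and
   the quotient topology. *)
Section Torus.
Variables (R : realType) (n : nat).

Definition int_lattice : zmodClosed 'rV[R]_n :=
  GRing.ZmodClosed.clone 'rV[R]_n (@mxOver_pred 1 n R (@Num.int_num_subdef R)) _.

Definition torus := quotient_topology (ring_quotient.Quotient.quot int_lattice).

HB.instance Definition _ := Topological.on torus.
HB.instance Definition _ := Quotient.on torus.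
HB.instance Definition _ := GRing.isZmodule.Build torus
  (@ring_quotient.Quotient.addqA _ int_lattice)
  (@ring_quotient.Quotient.addqC _ int_lattice)
  (@ring_quotient.Quotient.add0q _ int_lattice)
  (@ring_quotient.Quotient.addNq _ int_lattice).

Definition to_torus (v : 'rV[R]_n) : torus := \pi_torus v.

End Torus.

Section Euclidean.
Variable R : realType.

Definition dot n (v w : 'rV[R]_n) : R := \sum_i v 0 i * w 0 i.

Definition int_vec n (k : 'rV[int]_n) : 'rV[R]_n := map_mx intr k.

(* e^{2 pi i s} *)
Definition e2pi (s : R) : R[i] := cos (2 * pi * s) +i* sin (2 * pi * s).

Definition cmod (z : R[i]) : R := Normc.normc z.

End Euclidean.

Section Smoothness.
Variable R : realType.

Definition partial n (i : 'I_n) (g : 'rV[R]_n -> R) : 'rV[R]_n -> R :=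
  fun v => 'D_(delta_mx 0 i) g v.

Definition partials n (s : seq 'I_n) (g : 'rV[R]_n -> R) : 'rV[R]_n -> R :=
  foldr (@partial n) g s.

(* C^infinity on U; meant for open U *)
Definition smooth_on n (U : set 'rV[R]_n) (g : 'rV[R]_n -> R) :=
  forall (s : seq 'I_n) v, U v ->
    {for v, continuous (partials s g)} /\
    forall i, derivable (partials s g) v (delta_mx 0 i).

Definition monomial n (v : 'rV[R]_n) (a : 'I_n -> nat) : R :=
  \prod_i v 0 i ^+ a i.

(* local power series expansions, the sum over multi-indices being
   unconditional *)
Definition real_analytic n (g : 'rV[R]_n -> R) :=
  forall a : 'rV[R]_n, exists coef : {ffun 'I_n -> nat} -> R,
    \forall h \near (0 : 'rV[R]_n),
      partial_sum (fun nu : {ffun 'I_n -> nat} =>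
                     coef nu * monomial h nu) @ totally --> g (a + h).

Definition partialsC n (s : seq 'I_n) (g : 'rV[R]_n -> R[i]) :
    'rV[R]_n -> R[i] :=
  fun v => partials s (fun w => complex.Re (g w)) v
        +i* partials s (fun w => complex.Im (g w)) v.

Definition schwartz n (f : 'rV[R]_n -> R[i]) :=
  [/\ smooth_on setT (fun v => complex.Re (f v)),
      smooth_on setT (fun v => complex.Im (f v)) &
      forall (a : 'I_n -> nat) (s : seq 'I_n), exists C : R, forall v,
        `|monomial v a| * cmod (partialsC s f v) <= C].

Definition torus_smooth n (g : torus R n -> R) :=
  smooth_on setT (g \o @to_torus R n).

Definition torus_analytic n (g : torus R n -> R) :=
  real_analytic (g \o @to_torus R n).

(* convergence in C^infinity(T^n): uniform convergence of all partial
   derivatives *)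
Definition cvg_Cinfty n (I : Type) (g_ : I -> torus R n -> R[i])
    (F : set_system I) (g : torus R n -> R[i]) :=
  forall (s : seq 'I_n) (e : R), 0 < e -> \forall i \near F, forall v,
    cmod (partialsC s (g_ i \o @to_torus R n) v
          - partialsC s (g \o @to_torus R n) v) < e.

End Smoothness.

Section LieSubgroups.
Variable R : realType.

(* Smoothness, near every point of A, of a map P : A -> T^k defined on a subset
   A of T^n (values of P outside A are irrelevant): P is locally the
   restriction to A of a smooth map, read through the coverings R^n -> T^n
   and R^k -> T^k. *)
Definition torus_smooth_map n k (A : set (torus R n))
    (P : torus R n -> torus R k) :=
  forall v, A (to_torus v) ->
    exists U (g : 'rV[R]_n -> 'rV[R]_k),
      [/\ open U, U v, forall j, smooth_on U (fun w => g w 0 j) &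
          forall w, U w -> A (to_torus w) -> P (to_torus w) = to_torus (g w)].

(* Phi : A -> T^k is an isomorphism of Lie groups with inverse Psi, where the
   closed subgroup A has its structure of embedded submanifold of T^n *)
Definition lie_group_iso n k (A : set (torus R n))
    (Phi : torus R n -> torus R k) (Psi : torus R k -> torus R n) :=
  [/\ forall a b, A a -> A b -> Phi (a + b) = Phi a + Phi b,
      forall a, A a -> Psi (Phi a) = a,
      forall x, A (Psi x) /\ Phi (Psi x) = x,
      torus_smooth_map A Phi &
      torus_smooth_map setT Psi].

Definition lie_algebra n (A : set (torus R n)) : set 'rV[R]_n :=
  [set v | forall t : R, A (to_torus (t *: v))].

(* For a closed subgroup A: the Lie algebra of A, here a subspace of R^n, has
   dimension r. *)
Definition has_lie_dim n (A : set (torus R n)) (r : nat) :=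
  exists B : 'M[R]_(r, n),
    row_free B /\ forall v, lie_algebra A v <-> (v <= B)%MS.

(* the quotient group G / K, as the set of cosets of K *)
Definition cosets n (G K : set (torus R n)) : set (set (torus R n)) :=
  [set [set g + k | k in K] | g in G].

End LieSubgroups.

Section Integration.
Variable R : realType.

Definition tuple_cons n (p : measurableTypeR R * n.-tuple (measurableTypeR R)) :
  n.+1.-tuple (measurableTypeR R) := [tuple of p.1 :: p.2].

Lemma measurable_tuple_cons n : measurable_fun setT (@tuple_cons n).
Proof. exact: measurable_cons. Qed.

HB.instance Definition _ n :=
  isMeasurableFun.Build _ _ _ _ (@tuple_cons n) (@measurable_tuple_cons n).

(* Lebesgue measure on the unit cube [0, 1]^n *)
Fixpoint cube_measure n : probability (n.-tuple (measurableTypeR R)) R :=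
  match n with
  | 0 => \d_([tuple] : 0.-tuple (measurableTypeR R))
  | n'.+1 => distribution
      (uniform_prob (@ltr01 R) \x cube_measure n')%E (@tuple_cons n')
  end.

(* normalized Haar measure of T^n, through the fundamental domain *)
Definition torus_integral n (g : torus R n -> R) : R :=
  \int[cube_measure n]_t g (to_torus (\row_i tnth t i)).

(* z |-> e^{2 pi i <k, z>} *)
Definition torus_char n (k : 'rV[int]_n) (z : torus R n) : R[i] :=
  e2pi (dot (int_vec R k) (repr z)).

(* torus_char (- k) z is e^{- 2 pi i <k, z>}. *)
Definition fourier_coef n (g : torus R n -> R[i]) (k : 'rV[int]_n) : R[i] :=
  torus_integral (fun z => complex.Re (g z * torus_char (- k) z))
  +i* torus_integral (fun z => complex.Im (g z * torus_char (- k) z)).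

End Integration.

Section TimeFrequency.
Variables (R : realType) (d : nat).
Implicit Types (f : 'rV[R]_d -> R[i]) (x y t xi : 'rV[R]_d).

Definition translation x f : 'rV[R]_d -> R[i] := fun t => f (t - x).

(* sign convention: M_y f (t) = e^{- 2 pi i <y, t>} f (t) *)
Definition modulation y f : 'rV[R]_d -> R[i] := fun t => e2pi (- dot y t) * f t.

(* the (absolutely convergent, when f is Schwartz) series over Z^d *)
Definition zak f t xi : R[i] :=
  summability.sum (fun kappa : 'rV[int]_d =>
    (e2pi (- dot xi (int_vec R kappa)) * f (t + int_vec R kappa) : R[i]^o)).

(* F = |Zf| on T^{2d}; |Zf| is Z^{2d}-periodic, so that the choice of the
   representative repr z does not matter. *)
Definition zak_modulus f (z : torus R (d + d)) : R :=
  cmod (zak f (lsubmx (repr z)) (rsubmx (repr z))).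

(* The function p on T^{2d}: its value does not depend on the representative
   because x_k and y_k are integer vectors. *)
Definition trig_poly K (c : 'I_K -> R[i]) (x y : 'I_K -> 'rV[int]_d)
    (z : torus R (d + d)) : R[i] :=
  \sum_k c k * e2pi (- dot (int_vec R (y k)) (lsubmx (repr z)))
             * e2pi (- dot (rsubmx (repr z)) (int_vec R (x k))).

(* Q_m *)
Definition trig_cocycle K (c : 'I_K -> R[i]) (x y : 'I_K -> 'rV[int]_d)
    (gamma : torus R (d + d)) (m : nat) (z : torus R (d + d)) : R :=
  \prod_(j < m) cmod (trig_poly c x y (z + gamma *+ j)).

End TimeFrequency.

(* Main.v *)
Require Import Defs.
From mathcomp Require Import all_boot all_order all_algebra finmap.
From mathcomp Require Import all_classical all_reals all_analysis.
From mathcomp Require Import complex.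
From mathcomp.analysis Require Import showcase.summability.
From mathcomp Require Import measurable_realfun.
From mathcomp Require Import ring lra zify.
Import Order.TTheory GRing.Theory Num.Theory.
Import numFieldNormedType.Exports.
Set Implicit Arguments.
Unset Strict Implicit.
Unset Printing Implicit Defensive.
Local Open Scope classical_set_scope.
Local Open Scope ring_scope.
Local Open Scope complex_scope.

(** Summing the dependence relation over the integer lattice, against a character, turns it
    into [p(z) Zf(z) = (unimodular) Zf(z + gamma)]: lattice translations and integer
    modulations act on the Zak transform as multiplications by characters, and the last
    time-frequency shift acts as a translation by [gamma]. Hence [F(z + gamma) = |p(z)| F(z)]
    ([zak_modulus_step]) and, after [m] steps, [F(z + m gamma) = Q_m(z) F(z)].

    The zero set of [F] is closed and forward invariant under [gamma]. As some positive
    multiple of [gamma] comes back arbitrarily near 0, it is also backward invariant, so that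
    it is invariant under the orbit closure [H] ([nonzero_orbit_closure]). Therefore [F], and
    with it every factor of [Q_m], is positive on [lambda + H], and the logarithm of the
    relation is the cohomological equation [u(x + omega) - u(x) = b(x)].

    The rotation by [omega] is minimal: the identity component has finite index in [H], hence
    it is open in [H], and the multiples of [gamma] that fall in it are the multiples of
    [m gamma] ([cyclic_quotient]); the isomorphism [Phi] transports their density.

    For the regularity of [u] and [b], a smooth homomorphism between tori is covered by a linear
    map ([linear_lift]). Read through this map, [u] is half the logarithm of a sum of squares of
    smooth functions, since the Zak series and all its derivatives converge uniformly on bounded
    sets ([zak_terms_dominated]), while [b] is half a sum of logarithms of positive real
    trigonometric sums, which have convergent power series ([ln_trig_sum_analytic]). Power series
    are handled as unconditional sums over multi-indices, and composed by expanding over finite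
    words of indices ([has_sum_substitution]).

    The Fourier statements follow by integration. Translation invariance gives [b] mean zero and
    multiplies the Fourier coefficients of [u] by the character values at [omega]
    ([coboundary_coef]), which differ from 1 away from frequency 0 because the orbit of [omega]
    is dense ([torus_char_neq1]). So the series in the theorem is the Fourier series of [u].
    Integration by parts makes the coefficients of a smooth function summable with any power
    weight, and a continuous function is determined by its coefficients ([fourier_uniqueness]);
    together these make the Fourier series of [u] and of all its derivatives converge uniformly
    ([fourier_cvg_Cinfty]). *)

(** * Unconditional sums of real families *)

Section UnconditionalSums.
Variable R : realType.

(** Finite subsets are duplicate-free sequences, so that the index type only needs a
    decidable equality: words and multi-indices are then allowed as they are. *)
Definition has_sum (I : eqType) (f : I -> R) (s : R) :=
  forall e, 0 < e -> exists A : seq I, forall B, uniq B -> {subset A <= B} ->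
    `|\sum_(i <- B) f i - s| < e.

Definition abs_sum_le (I : eqType) (f : I -> R) (M : R) :=
  forall B, uniq B -> \sum_(i <- B) `|f i| <= M.

Lemma sum_mem_seq (I : eqType) (f : I -> R) (A B : seq I) :
  uniq A -> uniq B -> {subset A <= B} ->
  \sum_(i <- B | i \in A) f i = \sum_(i <- A) f i.
Proof.
move=> uA uB sAB; rewrite -big_filter; apply: perm_big.
apply: uniq_perm => //; first exact: filter_uniq.
move=> i; rewrite mem_filter; case iA: (i \in A) => //=.
exact: sAB.
Qed.

Lemma sum_split_seq (I : eqType) (f : I -> R) (A B : seq I) :
  uniq A -> uniq B -> {subset A <= B} ->
  \sum_(i <- B) f i = \sum_(i <- A) f i + \sum_(i <- B | i \notin A) f i.
Proof.
by move=> uA uB sAB; rewrite (bigID (mem A)) /= sum_mem_seq.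
Qed.

Lemma has_sum_eq (I : eqType) (f g : I -> R) s :
  f =1 g -> has_sum f s -> has_sum g s.
Proof. by move=> /funext ->. Qed.

Lemma has_sum0 (I : eqType) : has_sum (fun _ : I => 0 : R) 0.
Proof. by move=> e e0; exists [::] => B _ _; rewrite big1// subrr normr0. Qed.

Lemma has_sumD (I : eqType) (f g : I -> R) s t :
  has_sum f s -> has_sum g t -> has_sum (fun i => f i + g i) (s + t).
Proof.
move=> hf hg e e0.
have [A hA] := hf (e / 2) ltac:(lra).
have [B hB] := hg (e / 2) ltac:(lra).
exists (A ++ B) => C uC sC; rewrite big_split /=.
have hAC : {subset A <= C} by move=> i iA; apply: sC; rewrite mem_cat iA.
have hBC : {subset B <= C} by move=> i iB; apply: sC; rewrite mem_cat iB orbT.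
have := hA C uC hAC; have := hB C uC hBC.
rewrite !ltr_norml => /andP[? ?] /andP[? ?]; apply/andP; split; lra.
Qed.

Lemma has_sumZ (I : eqType) (f : I -> R) s a :
  has_sum f s -> has_sum (fun i => a * f i) (a * s).
Proof.
move=> hf e e0.
have [A hA] := hf (e / (`|a| + 1)) ltac:(apply: divr_gt0 => //; exact: ltr_wpDl).
exists A => B uB sB; rewrite -mulr_sumr -mulrBr normrM.
have := hA B uB sB; rewrite ltr_pdivlMr ?ltr_wpDl// => h.
apply: le_lt_trans h; rewrite mulrC ler_wpM2l// lerDl//.
Qed.

Lemma has_sumN (I : eqType) (f : I -> R) s :
  has_sum f s -> has_sum (fun i => - f i) (- s).
Proof.
move=> /(has_sumZ (-1)); rewrite mulN1r; apply: has_sum_eq => i.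
by rewrite mulN1r.
Qed.

Lemma has_sumB (I : eqType) (f g : I -> R) s t :
  has_sum f s -> has_sum g t -> has_sum (fun i => f i - g i) (s - t).
Proof. by move=> hf hg; apply: has_sumD => //; exact: has_sumN. Qed.

Lemma has_sum_bigsum (I J : eqType) (r : seq J) (f : J -> I -> R) (s : J -> R) :
  (forall j, j \in r -> has_sum (f j) (s j)) ->
  has_sum (fun i => \sum_(j <- r) f j i) (\sum_(j <- r) s j).
Proof.
elim: r => [_|j r IH h].
  rewrite big_nil; apply: has_sum_eq (@has_sum0 I) => i.
  by rewrite big_nil.
rewrite big_cons; apply: has_sum_eq (has_sumD (h j _) (IH _)) => [i||].
- by rewrite big_cons.
- exact: mem_head.
- by move=> k kr; apply: h; rewrite in_cons kr orbT.
Qed.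

Lemma has_sum_norm_le (I : eqType) (f : I -> R) s M :
  has_sum f s -> (forall B, uniq B -> `|\sum_(i <- B) f i| <= M) -> `|s| <= M.
Proof.
move=> hf hM; apply/ler_addgt0Pr => e e0.
have [A hA] := hf e e0.
have := hA (undup A) (undup_uniq A) (fun i iA => etrans (mem_undup A i) iA).
have := hM (undup A) (undup_uniq A).
rewrite !ltr_norml !ler_norml => /andP[? ?] /andP[? ?]; apply/andP; split; lra.
Qed.

Lemma has_sum_unique (I : eqType) (f : I -> R) s t :
  has_sum f s -> has_sum f t -> s = t.
Proof.
move=> hs ht; apply/eqP; rewrite -subr_eq0 -normr_le0.
apply: (has_sum_norm_le (has_sumB hs ht)) => B _.
by rewrite big1 ?normr0// => i _; rewrite subrr.
Qed.

Lemma abs_sum_le_trans (I : eqType) (f g : I -> R) M :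
  (forall i, `|f i| <= `|g i|) -> abs_sum_le g M -> abs_sum_le f M.
Proof.
by move=> fg hg B uB; apply: le_trans (hg B uB); apply: ler_sum => i _.
Qed.

Lemma abs_sum_le_ge0 (I : eqType) (f : I -> R) M : abs_sum_le f M -> 0 <= M.
Proof. by move=> /(_ [::] isT); rewrite big_nil. Qed.

Lemma abs_sum_leZ (I : eqType) (f : I -> R) M a :
  abs_sum_le f M -> abs_sum_le (fun i => a * f i) (`|a| * M).
Proof.
move=> hf B uB; under eq_bigr do rewrite normrM.
by rewrite -mulr_sumr ler_wpM2l// hf.
Qed.

Lemma abs_sum_leD (I : eqType) (f g : I -> R) M N :
  abs_sum_le f M -> abs_sum_le g N -> abs_sum_le (fun i => f i + g i) (M + N).
Proof.
move=> hf hg B uB; apply: (@le_trans _ _ (\sum_(i <- B) (`|f i| + `|g i|))).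
  by apply: ler_sum => i _; exact: ler_normD.
by rewrite big_split lerD// ?hf ?hg.
Qed.

Lemma has_sum_abs_le (I : eqType) (f : I -> R) s M :
  has_sum f s -> abs_sum_le f M -> `|s| <= M.
Proof.
move=> hf hM; apply: has_sum_norm_le hf _ => B uB.
exact: le_trans (ler_norm_sum _ _ _) (hM B uB).
Qed.

(** The supremum of the finite sums of [|f|] is almost attained by one of them;
    what is left outside is small. *)
Lemma abs_sum_tail (I : eqType) (f : I -> R) M : abs_sum_le f M ->
  forall e, 0 < e -> exists2 A : seq I, uniq A &
    forall B, uniq B -> {in B, forall i, i \notin A} ->
      \sum_(i <- B) `|f i| <= e.
Proof.
move=> hM e e0.
pose S := [set x | exists2 B : seq I, uniq B & x = \sum_(i <- B) `|f i|].
have hS : has_sup S.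
  split; first by exists (\sum_(i <- [::]) `|f i|); exists [::].
  by exists M => _ [B uB ->]; exact: hM.
have [_ [A uA ->] hA] := sup_adherent e0 hS.
exists A => // B uB dB.
have : \sum_(i <- A ++ B) `|f i| <= sup S.
  apply: ub_le_sup; first by case: hS.
  exists (A ++ B) => //; rewrite cat_uniq uA uB andbT.
  by apply/hasPn => i /dB.
rewrite big_cat /=; lra.
Qed.

(** The sum is the difference of two suprema, those of [|f|] and of [|f| - f >= 0]. *)
Lemma abs_sum_has_sum (I : eqType) (f : I -> R) M :
  abs_sum_le f M -> exists s, has_sum f s.
Proof.
have nneg (g : I -> R) N : (forall i, 0 <= g i) -> abs_sum_le g N ->
    exists s, has_sum g s.
  move=> g0 hN.
  pose S := [set x | exists2 B : seq I, uniq B & x = \sum_(i <- B) g i].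
  have hS : has_sup S.
    split; first by exists (\sum_(i <- [::]) g i); exists [::].
    exists N => _ [B uB ->]; apply: le_trans (hN B uB).
    by apply: ler_sum => i _; exact: ler_norm.
  exists (sup S) => e e0.
  have [_ [A uA ->] hA] := sup_adherent e0 hS.
  exists A => B uB sAB.
  have h1 : \sum_(i <- B) g i <= sup S.
    by apply: ub_le_sup; [case: hS|exists B].
  have h2 : \sum_(i <- A) g i <= \sum_(i <- B) g i.
    by rewrite (sum_split_seq _ uA uB sAB) lerDl sumr_ge0.
  by rewrite ler0_norm; lra.
move=> hM.
have [s hs] := nneg (fun i => `|f i|) M (fun i => normr_ge0 _)
  ltac:(by move=> B uB; under eq_bigr do rewrite normr_id; exact: hM).
have [t ht] := nneg (fun i => `|f i| - f i) (M + M)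
  ltac:(by move=> i; rewrite subr_ge0 ler_norm)
  ltac:(move=> B uB; apply: le_trans (lerD (hM B uB) (hM B uB));
        rewrite -big_split; apply: ler_sum => i _;
        apply: le_trans (ler_normB _ _) _; rewrite normr_id//).
exists (s - t); apply: has_sum_eq (has_sumB hs ht) => i; lra.
Qed.

Definition usum (I : eqType) (f : I -> R) : R := xget 0 [set s | has_sum f s].

Lemma usumP (I : eqType) (f : I -> R) M :
  abs_sum_le f M -> has_sum f (usum f).
Proof. by move=> /abs_sum_has_sum[s hs]; exact: (xgetI 0 hs). Qed.

(** What the sum misses outside a finite set is bounded by the tail of the
    absolute values. *)
Lemma has_sum_tail (I : eqType) (f : I -> R) s (A : seq I) e :
  uniq A -> has_sum f s ->
  (forall B, uniq B -> {in B, forall i, i \notin A} -> \sum_(i <- B) `|f i| <= e) ->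
  forall C, uniq C -> {subset A <= C} -> `|s - \sum_(i <- C) f i| <= e.
Proof.
move=> uA hf hA C uC sAC; apply/ler_addgt0Pr => e1 e10.
have [D hD] := hf e1 e10.
pose E := undup (D ++ C).
have uE : uniq E by exact: undup_uniq.
have sDE : {subset D <= E} by move=> i iD; rewrite mem_undup mem_cat iD.
have sCE : {subset C <= E} by move=> i iC; rewrite mem_undup mem_cat iC orbT.
have := hD E uE sDE; rewrite (sum_split_seq f uC uE sCE).
have : `|\sum_(i <- E | i \notin C) f i| <= e.
  apply: le_trans (ler_norm_sum _ _ _) _; rewrite -big_filter; apply: hA.
    exact: filter_uniq.
  by move=> i; rewrite mem_filter => /andP[iC _]; apply: contra iC => /sAC.
rewrite !ltr_norml !ler_norml => /andP[? ?] /andP[? ?]; apply/andP; split; lra.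
Qed.

(** Regrouping along the fibres of [phi]: the part of the sum lying over a finite
    set of indices [j] is a finite sum of fibre sums, the rest is a tail. *)
Lemma has_sum_fibers (I J : eqType) (phi : I -> J) (f : I -> R) s M :
  abs_sum_le f M -> has_sum f s ->
  exists g : J -> R, [/\ has_sum g s, abs_sum_le g M &
    forall j, has_sum (fun i => if phi i == j then f i else 0) (g j)].
Proof.
move=> hM hf.
have hfib j : abs_sum_le (fun i => if phi i == j then f i else 0) M.
  by apply: abs_sum_le_trans hM => i; case: ifP => //; rewrite normr0.
pose g j := usum (fun i => if phi i == j then f i else 0).
have hg j : has_sum (fun i => if phi i == j then f i else 0) (g j) := usumP (hfib j).
have collapse (a : J -> R) (B : seq J) i : uniq B ->
    \sum_(j <- B) a j * (if phi i == j then f i else 0) =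
    if phi i \in B then a (phi i) * f i else 0.
  move=> uB; case: ifPn => iB.
    rewrite (bigD1_seq (phi i))//= eqxx big1 ?addr0// => j ji.
    by rewrite eq_sym (negbTE ji) mulr0.
  rewrite big_seq_cond big1// => j /andP[jB _].
  by case: eqP => [ij|_]; rewrite ?mulr0//; move: iB; rewrite ij jB.
exists g; split=> //.
- move=> e e0; have [A uA hA] := abs_sum_tail hM (ltac:(lra) : 0 < e / 2).
  exists (map phi A) => B uB sB.
  have hB := has_sumB hf (has_sum_bigsum (r := B) (fun j _ => has_sumZ 1 (hg j))).
  rewrite distrC; apply: (@le_lt_trans _ _ (e / 2)); last lra.
  under eq_bigr do rewrite -[g _]mul1r.
  apply: has_sum_norm_le hB _ => C uC.
  have -> : \sum_(i <- C) (f i - \sum_(j <- B) 1 * (if phi i == j then f i else 0))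
     = \sum_(i <- C | phi i \notin B) f i.
    rewrite [RHS]big_mkcond; apply: eq_bigr => i _; rewrite collapse//.
    by case: ifP => _; rewrite ?mul1r ?subrr ?subr0.
  apply: le_trans (ler_norm_sum _ _ _) _; rewrite -big_filter; apply: hA.
    exact: filter_uniq.
  move=> i; rewrite mem_filter => /andP[iB _]; apply: contra iB => iA.
  by apply: sB; exact: map_f.
- move=> B uB; under eq_bigr do rewrite normrEsg.
  have hB := has_sum_bigsum (r := B) (fun j _ => has_sumZ (Num.sg (g j)) (hg j)).
  apply: le_trans (ler_norm _) (has_sum_abs_le hB _).
  apply: abs_sum_le_trans hM => i; rewrite collapse//.
  by case: ifP; rewrite ?normr0// normrM normr_sg => _; rewrite ler_piMl// lern1 leq_b1.
Qed.

Lemma has_sum_inj (I J : eqType) (phi : J -> I) (f : I -> R) s :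
  bijective phi -> has_sum f s -> has_sum (fun j => f (phi j)) s.
Proof.
move=> [psi phiK psiK] hf e e0; have [A hA] := hf e e0.
exists (map psi A) => B uB sB.
rewrite -(big_map phi xpredT f); apply: hA.
  by rewrite map_inj_uniq//; exact: can_inj phiK.
by move=> i iA; rewrite -(psiK i); apply/map_f/sB/map_f.
Qed.

Lemma has_sum_totally (I : choiceType) (f : I -> R) s :
  has_sum f s -> partial_sum f @ totally --> s.
Proof.
have FF := @totally_filter I.
move=> hf; apply/cvgrPdist_lt => e e0; have [A hA] := hf e e0.
exists [fset i in A]%fset => //= B /= sB.
rewrite distrC /partial_sum -(big_seq_fsetE _ _ xpredT f) /=; apply: hA => //.
by move=> i iA; apply: (fsubsetP sB); rewrite in_fset_/=.
Qed.

End UnconditionalSums.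

(** * The scalar product *)

Section DotProduct.
Variable R : realType.

Lemma dotDr n (a v w : 'rV[R]_n) : dot a (v + w) = dot a v + dot a w.
Proof. by rewrite /dot -big_split; apply: eq_bigr => i _; rewrite mxE mulrDr. Qed.

Lemma dotDl n (a b v : 'rV[R]_n) : dot (a + b) v = dot a v + dot b v.
Proof. by rewrite /dot -big_split; apply: eq_bigr => i _; rewrite mxE mulrDl. Qed.

Lemma dotNl n (a v : 'rV[R]_n) : dot (- a) v = - dot a v.
Proof. by rewrite /dot -sumrN; apply: eq_bigr => i _; rewrite mxE mulNr. Qed.

Lemma dotNr n (a v : 'rV[R]_n) : dot a (- v) = - dot a v.
Proof. by rewrite /dot -sumrN; apply: eq_bigr => i _; rewrite mxE mulrN. Qed.

Lemma dotZl n c (a v : 'rV[R]_n) : dot (c *: a) v = c * dot a v.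
Proof. by rewrite /dot mulr_sumr; apply: eq_bigr => i _; rewrite mxE mulrA. Qed.

Lemma dotZr n c (a v : 'rV[R]_n) : dot a (c *: v) = c * dot a v.
Proof. by rewrite /dot mulr_sumr; apply: eq_bigr => i _; rewrite mxE mulrCA. Qed.

Lemma dotC n (a v : 'rV[R]_n) : dot a v = dot v a.
Proof. by apply: eq_bigr => i _; rewrite mulrC. Qed.

Lemma dot_delta n (a : 'rV[R]_n) i : dot a (delta_mx 0 i) = a 0 i.
Proof.
rewrite /dot (bigD1 i)//= big1 => [|j ji]; rewrite mxE eqxx /=.
  by rewrite eqxx mulr1 addr0.
by rewrite (negbTE ji) mulr0.
Qed.

End DotProduct.

(** * Smooth functions on a Euclidean space *)

Section Smooth.
Variable R : realType.

Lemma coord_le_norm n (v : 'rV[R]_n) i : `|v 0 i| <= `|v|.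
Proof. by rewrite [leRHS]mx_normrE (le_bigmax _ (fun ij => `|v ij.1 ij.2|) (0, i)). Qed.

Lemma norm_leP n (v : 'rV[R]_n) e : 0 <= e ->
  reflect (forall i, `|v 0 i| <= e) (`|v| <= e).
Proof.
move=> e0; apply: (iffP idP) => [h i|h]; first exact: le_trans (coord_le_norm _ _) h.
rewrite [leLHS]mx_normrE; apply: bigmax_le => // -[i j] _ /=.
by rewrite ord1.
Qed.

Lemma norm_ltP n (v : 'rV[R]_n) e : 0 < e ->
  reflect (forall i, `|v 0 i| < e) (`|v| < e).
Proof.
move=> e0; apply: (iffP idP) => [h i|h].
  exact: le_lt_trans (coord_le_norm _ _) h.
rewrite [ltLHS]mx_normrE; apply: bigmax_lt => // -[i j] _ /=.
by rewrite ord1.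
Qed.

Lemma norm_mulmx_le n p (A : 'M[R]_(n, p)) (v : 'rV[R]_n) :
  `|v *m A| <= (\sum_i \sum_j `|A i j|) * `|v|.
Proof.
apply/norm_leP => [|j]; first by rewrite mulr_ge0// sumr_ge0// => i _; exact: sumr_ge0.
rewrite mxE mulr_suml; apply: le_trans (ler_norm_sum _ _ _) _.
apply: ler_sum => i _; rewrite normrM mulrC.
apply: ler_pM => //; last exact: coord_le_norm.
by rewrite (bigD1 j) //= lerDl sumr_ge0.
Qed.

Section Directional.
Variables (n : nat).
Implicit Types (v u : 'rV[R]_n) (G : 'rV[R]_n -> R).

(** Directional derivatives are derivatives in one real variable along a line; this gives
    access to the mean value theorem. *)
Lemma is_derive_line v u G l (t : R) :
  is_derive (v + t *: u) u G l <-> is_derive t 1 (fun s => G (v + s *: u)) l.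
Proof.
have E (h : R) : G (h *: u + (v + t *: u)) = G (v + (h *: (1 : R) + t) *: u).
  by rewrite [h *: 1]mulr1 scalerDl addrCA.
have {}E : (fun h : R => h^-1 *: ((G \o shift (v + t *: u)) (h *: u) - G (v + t *: u)))
  = (fun h : R => h^-1 *: (((fun s => G (v + s *: u)) \o shift t) (h *: (1:R))
        - G (v + t *: u))).
  by apply/funext => h; congr (_ *: (_ - _)); exact: E.
by split=> -[d1 d2]; split; move: d1 d2; rewrite /derivable /derive E.
Qed.

Lemma is_derive_epsP v u G l :
  is_derive v u G l <->
  (forall e, 0 < e -> exists2 d, 0 < d &
     forall t, `|t| < d -> `|G (v + t *: u) - G v - t * l| <= e * `|t|).
Proof.
split.
  move=> [d1 d2] e e0.
  have : (fun h : R => h^-1 *: ((G \o shift v) (h *: u) - G v)) @ 0^' --> l.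
    by rewrite -d2; exact: d1.
  move=> /cvgrPdist_lt/(_ e e0); rewrite near_withinE.
  move=> /nbhs_ballP[d /= d0 hd]; exists d => // t td.
  have [->|t0] := eqVneq t 0.
    by rewrite scale0r addr0 subrr mul0r subrr normr0 mulr0.
  have := hd t; rewrite /ball /= sub0r normrN => /(_ td t0).
  rewrite (addrC (t *: u)) => /ltW; set D := G _ - G v => hh.
  have -> : D - t * l = - ((l - t^-1 * D) * t).
    by rewrite mulrBl mulrAC mulVf// mul1r opprB mulrC.
  by rewrite normrN normrM ler_wpM2r.
move=> h.
have C : (fun h : R => h^-1 *: ((G \o shift v) (h *: u) - G v)) @ 0^' --> l.
  apply/cvgrPdist_le => e e0; have [d d0 hd] := h e e0.
  rewrite near_withinE; apply/nbhs_ballP; exists d => //= t.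
  rewrite /ball /= sub0r normrN => td t0.
  have := hd t td; rewrite -ler_pdivrMr ?normr_gt0// -normfV -normrM.
  rewrite /= (addrC (t *: u)); set D := G _ - G v => hh.
  suff -> : l - t^-1 *: D = - ((D - t * l) / t) by rewrite normrN.
  by rewrite mulrBl mulrAC divff// mul1r opprB [_ *: _]mulrC.
by split; [apply/cvg_ex; exists l | apply: cvg_lim].
Qed.

Lemma cont_epsP (V : normedModType R) v (G : 'rV[R]_n -> V) :
  {for v, continuous G} <->
  (forall e, 0 < e -> exists2 d, 0 < d & forall w, `|w - v| < d -> `|G w - G v| < e).
Proof.
split.
  move=> h e e0; have {}h : G w @[w --> v] --> G v := h.
  move/cvgrPdist_lt in h; have /nbhs_ballP[d /= d0 hd] := h e e0.
  exists d => // w wv; rewrite distrC; apply: hd.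
  by rewrite mx_norm_ball /ball_ /= distrC.
move=> h; suff : G w @[w --> v] --> G v by [].
apply/(@cvgrPdist_lt _ _ _ (nbhs v) (nbhs_filter v)) => e e0; have [d d0 hd] := h e e0.
apply/nbhs_ballP; exists d => //= w; rewrite mx_norm_ball /ball_ /= distrC => wv.
by rewrite distrC; exact: hd.
Qed.

(** Both orders of the two end points at once. *)
Lemma mvt_sym (g D : R -> R) (t : R) :
  (forall s : R, `|s| <= `|t| -> is_derive s 1 g (D s)) ->
  exists2 c, `|c| <= `|t| & g t - g 0 = t * D c.
Proof.
move=> h.
have hc a b : - `|t| <= a -> b <= `|t| -> {within `[a, b], continuous g}.
  move=> ha hb; apply: derivable_within_continuous => s; rewrite in_itv/= => /andP[sa sb].
  apply: (@ex_derive _ _ _ _ _ _ _ (h s _)); rewrite ler_norml.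
  by rewrite (le_trans ha sa) (le_trans sb hb).
have hin (a b s : R) : - `|t| <= a -> b <= `|t| -> s \in `]a, b[ -> is_derive s 1 g (D s).
  move=> ha hb; rewrite in_itv/= => /andP[/ltW sa /ltW sb]; apply: h; rewrite ler_norml.
  by rewrite (le_trans ha sa) (le_trans sb hb).
have tn := ler_norm t; have tn' : - `|t| <= t by rewrite lerNl -normrN ler_norm.
have t0' : 0 <= `|t| by []; have t0'' : - `|t| <= 0 by rewrite oppr_le0.
case: (leP 0 t) => t0.
  have [c] := MVT_segment t0 (fun s => hin 0 t s t0'' tn) (hc 0 t t0'' tn).
  rewrite subr0 mulrC in_itv/= => /andP[c0 ct] ->.
  by exists c => //; rewrite !ger0_norm.
have [c] := MVT_segment (ltW t0) (fun s => hin t 0 s tn' t0') (hc t 0 tn' t0').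
rewrite sub0r in_itv/= => /andP[c0 ct] E.
exists c; first by rewrite !ler0_norm ?lerN2// ltW.
by rewrite -opprB E mulrN opprK mulrC.
Qed.

Lemma mvt_line v u G (D : R -> R) (t : R) :
  (forall s, is_derive (v + s *: u) u G (D s)) ->
  exists2 c, `|c| <= `|t| & G (v + t *: u) - G v = t * D c.
Proof.
move=> h; have [c ct E] := @mvt_sym (fun s => G (v + s *: u)) D t
  (fun s _ => (is_derive_line _ _ _ _ _).1 (h s)).
by exists c => //; rewrite -E scale0r addr0.
Qed.

Lemma cont_coord p v (h : 'rV[R]_n -> 'rV[R]_p) :
  (forall j, {for v, continuous (fun w => h w 0 j)}) -> {for v, continuous h}.
Proof.
move=> hc; apply/cont_epsP => e e0.
have hj j : exists d, 0 < d /\ forall w, `|w - v| < d -> `|h w 0 j - h v 0 j| < e.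
  by have [d d0 hd] := (cont_epsP _ (fun w => h w 0 j)).1 (hc j) e e0; exists d.
have [d hd] := choice hj.
exists (\big[Num.min/1]_j d j); first by apply: lt_bigmin => // j _; have [] := hd j.
move=> w hw; apply/norm_ltP => // j; rewrite !mxE.
by have [_ hdj] := hd j; apply: hdj; apply: lt_le_trans hw _; exact: bigmin_le.
Qed.

End Directional.

Section SmoothClass.
Variables (n : nat).
Implicit Types (v u : 'rV[R]_n) (G : 'rV[R]_n -> R).

Local Notation e_ i := (delta_mx 0 i : 'rV[R]_n).

Definition smooth G := smooth_on setT G.

(** Smoothness is a greatest fixed point: it suffices to exhibit a class of differentiable
    functions stable under partial derivatives. *)
Lemma smooth_coind (D : ('rV[R]_n -> R) -> Prop) :
  (forall G, D G -> [/\ forall v, {for v, continuous G},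
     forall i v, derivable G v (e_ i) & forall i, D (partial i G)]) ->
  forall G, D G -> smooth G.
Proof.
move=> hD G DG s v _.
have : D (partials s G) by elim: s => //= i s /hD[].
by case/hD.
Qed.

Lemma smooth_partials G s : smooth G -> smooth (partials s G).
Proof.
move=> hG t v _; have := hG (t ++ s) v Logic.I.
by rewrite /partials foldr_cat.
Qed.

Lemma smooth_partial G i : smooth G -> smooth (partial i G).
Proof. exact: (@smooth_partials G [:: i]). Qed.

Lemma smooth_cont G v : smooth G -> {for v, continuous G}.
Proof. by move=> /(_ [::] v Logic.I)[]. Qed.

Lemma smooth_continuous G : smooth G -> continuous G.
Proof. by move=> h v; exact: smooth_cont. Qed.

Lemma smooth_derive G v i : smooth G -> is_derive v (e_ i) G (partial i G v).
Proof. by move=> /(_ [::] v Logic.I)[_ /(_ i)] /derivableP. Qed.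

Lemma partial_eq G v i l : is_derive v (e_ i) G l -> partial i G v = l.
Proof. by move=> h; rewrite /partial; exact: derive_val. Qed.

(** A function with continuous partial derivatives is differentiable in every
    direction: the coordinates of the direction are added one at a time, each
    step being a mean value argument. *)
Lemma smooth_derive_dir G v u : smooth G ->
  is_derive v u G (\sum_i u 0 i * partial i G v).
Proof.
move=> sG.
have -> : u = \sum_i u 0 i *: e_ i.
  by rewrite [LHS]row_sum_delta.
have -> : \sum_i (\sum_j u 0 j *: e_ j) 0 i * partial i G v
        = \sum_i u 0 i * partial i G v.
  by rewrite -row_sum_delta.
elim: (index_enum _) => [|i s IH].
  by rewrite !big_nil; exact: is_derive0.
rewrite !big_cons addrC [X in is_derive _ _ _ X]addrC.
set w := \sum_(_ <- s) _ in IH *; set l := \sum_(_ <- s) _ in IH *.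
move: (u 0 i) => c.
apply/is_derive_epsP => e e0.
have /is_derive_epsP/(_ (e/2) ltac:(lra))[d1 d10 h1] := IH.
have c1 : 0 < `|c| + 1 by rewrite ltr_wpDl.
have : {for v, continuous (partial i G)}.
  by apply: smooth_cont; exact: smooth_partial.
have ec0 : 0 < e / 2 / (`|c| + 1) by rewrite divr_gt0// divr_gt0.
move=> /cont_epsP/(_ _ ec0)[d2 d20 h2].
have w1 : 0 < `|w| + `|c| * `|e_ i| + 1 by rewrite ltr_wpDl// addr_ge0// mulr_ge0.
exists (Num.min d1 (d2 / (`|w| + `|c| * `|e_ i| + 1))).
  by rewrite lt_min d10 divr_gt0.
move=> t; rewrite lt_min => /andP[t1 t2].
have [a ha E] := mvt_line (v := v + t *: w) (u := e_ i) (t * c)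
  (fun s => @smooth_derive _ _ i sG).
have -> : v + t *: (w + c *: e_ i) = v + t *: w + (t * c) *: e_ i.
  by rewrite scalerDr scalerA addrA.
rewrite mulrDr.
have {}h1 := h1 t t1.
have hb : `|v + t *: w + a *: e_ i - v| < d2.
  rewrite addrAC (addrC v) addrK.
  rewrite ltr_pdivlMr// in t2; apply: le_lt_trans t2.
  apply: le_trans (ler_normD _ _) _; rewrite !normrZ.
  apply: (@le_trans _ _ (`|t| * `|w| + `|t| * `|c| * `|e_ i|)).
    by rewrite lerD2l ler_wpM2r// -normrM.
  by rewrite -mulrA -mulrDr ler_wpM2l// lerDl.
have {}h2 := h2 _ hb.
have -> : G (v + t *: w + (t * c) *: e_ i) - G v - (t * l + t * (c * partial i G v))
  = (G (v + t *: w) - G v - t * l)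
    + (t * c) * (partial i G (v + t *: w + a *: e_ i) - partial i G v).
  by rewrite mulrBr -E; ring.
apply: le_trans (ler_normD _ _) _.
rewrite [leRHS](_ : _ = e / 2 * `|t| + e / 2 * `|t|); last by field.
apply: lerD => //; rewrite !normrM.
apply: (@le_trans _ _ (`|t| * `|c| * (e / 2 / (`|c| + 1)))).
  by rewrite ler_wpM2l ?mulr_ge0// ltW.
rewrite -mulrA mulrC; apply: ler_wpM2r => //.
rewrite mulrCA -[leRHS]mulr1 ler_wpM2l//; first lra.
by rewrite ler_pdivrMr// mul1r lerDl.
Qed.


Lemma is_derive_chain v u (phi : R -> R) G a l :
  is_derive (G v) 1 phi a -> is_derive v u G l ->
  is_derive v u (fun w => phi (G w)) (a * l).
Proof.
move=> hphi hG.
have h0 : is_derive (v + (0:R) *: u) u G l by rewrite scale0r addr0.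
have h1 := (is_derive_line _ _ _ _ _).1 h0.
have -> : v = v + (0 : R) *: u by rewrite scale0r addr0.
apply/(is_derive_line v u (fun w => phi (G w)) (a * l) 0).
apply: (@is_derive1_comp _ phi (fun s => G (v + s *: u)) 0 a l _ h1).
by rewrite scale0r addr0.
Qed.

End SmoothClass.

Section SmoothAlgebra.
Variable n : nat.
Implicit Types (v u : 'rV[R]_n) (G : 'rV[R]_n -> R).
Local Notation e_ i := (delta_mx 0 i : 'rV[R]_n).

(** The functions obtained from smooth ones by these operations form a class
    stable under partial derivatives, as the rules of calculus show; hence all
    of them are smooth. *)
Inductive smooth_generated : ('rV[R]_n -> R) -> Prop :=
| SG_affine p (G : 'rV[R]_p -> R) (a : 'rV[R]_p) (A : 'M[R]_(n, p)) :
    smooth G -> smooth_generated (fun v => G (a + v *m A))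
| SG_cst c : smooth_generated (fun=> c)
| SG_add G1 G2 : smooth_generated G1 -> smooth_generated G2 ->
    smooth_generated (fun v => G1 v + G2 v)
| SG_mul G1 G2 : smooth_generated G1 -> smooth_generated G2 ->
    smooth_generated (fun v => G1 v * G2 v)
| SG_inv G : smooth_generated G -> (forall v, G v != 0) ->
    smooth_generated (fun v => (G v)^-1)
| SG_ln G : smooth_generated G -> (forall v, 0 < G v) ->
    smooth_generated (fun v => ln (G v)).

Lemma continuous_mulmx p (a : 'rV[R]_p) (A : 'M[R]_(n, p)) :
  continuous (fun v : 'rV[R]_n => a + v *m A).
Proof.
move=> v; apply/cont_epsP => e e0.
have S0 : 0 < \sum_i \sum_j `|A i j| + 1.
  by rewrite ltr_wpDl// sumr_ge0// => i _; exact: sumr_ge0.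
exists (e / (\sum_i \sum_j `|A i j| + 1)); first exact: divr_gt0.
move=> w; rewrite ltr_pdivlMr// => wv.
rewrite opprD addrACA subrr add0r -mulmxBl.
apply: le_lt_trans (norm_mulmx_le _ _) _; apply: le_lt_trans wv.
by rewrite mulrC ler_wpM2l// lerDl.
Qed.

Lemma smooth_generated_smooth G : smooth_generated G -> smooth G.
Proof.
apply: smooth_coind => {}G; elim=> {G}
  [p G a A sG|c|G1 G2 g1 [c1 d1 p1] g2 [c2 d2 p2]|G1 G2 g1 [c1 d1 p1] g2 [c2 d2 p2]
  |G g [c d p] G0|G g [c d p] G0].
- have dG v i : is_derive v (e_ i) (fun v => G (a + v *m A))
       (\sum_j A i j * partial j G (a + v *m A)).
    have h0 := smooth_derive_dir (a + v *m A) (row i A) sG.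
    apply/is_derive_epsP => e e0.
    have [d d0 hd] := (is_derive_epsP _ _ _ _).1 h0 e e0.
    exists d => // t td; have := hd t td.
    rewrite mulmxDl -scalemxAl -rowE addrA.
    by under eq_bigr do rewrite mxE.
  split=> [v|i v|i].
  + apply: (@continuous_comp _ _ _ (fun v : 'rV[R]_n => a + v *m A) G).
      exact: continuous_mulmx.
    exact: smooth_cont.
  + exact: (@ex_derive _ _ _ _ _ _ _ (dG v i)).
  + have -> : partial i (fun v => G (a + v *m A)) =
       (fun v => \sum_j A i j * partial j G (a + v *m A)).
      by apply/funext => v; apply: partial_eq.
    elim: (index_enum _) => [|j s IH].
      have -> : (fun v : 'rV[R]_n => \sum_(j <- [::]) A i j * partial j G (a + v *m A))
        = fun=> 0 by apply/funext => v; rewrite big_nil.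
      exact: SG_cst.
    have -> : (fun v : 'rV[R]_n =>
        \sum_(j <- j :: s) A i j * partial j G (a + v *m A)) =
      fun v => A i j * partial j G (a + v *m A)
        + \sum_(j <- s) A i j * partial j G (a + v *m A).
      by apply/funext => v; rewrite big_cons.
    apply: SG_add IH; apply: SG_mul; first exact: SG_cst.
    exact/SG_affine/smooth_partial.
- split=> [v|i v|i]; first exact: cst_continuous.
    exact: derivable_cst.
  have -> : partial i (fun=> c : R) = (fun=> 0) :> ('rV[R]_n -> R).
    by apply/funext => v; rewrite /partial derive_cst.
  exact: SG_cst.
- split=> [v|i v|i].
  + exact: (@cvgD _ _ _ (nbhs v) _ G1 G2 _ _ (c1 v) (c2 v)).
  + exact: derivableD.
  + have -> : partial i (fun v => G1 v + G2 v) =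
        (fun v => partial i G1 v + partial i G2 v).
      by apply/funext => v; rewrite /partial deriveD.
    exact: SG_add.
- split=> [v|i v|i].
  + exact: (@cvgM _ _ (nbhs v) _ G1 G2 _ _ (c1 v) (c2 v)).
  + exact: derivableM.
  + have -> : partial i (fun v => G1 v * G2 v) =
        (fun v => G1 v * partial i G2 v + G2 v * partial i G1 v).
      by apply/funext => v; rewrite /partial deriveM.
    by apply: SG_add; apply: SG_mul.
- have dG v i : is_derive v (e_ i) (fun v => (G v)^-1)
      (- (G v)^-1 * (G v)^-1 * partial i G v).
    apply: (is_derive_chain (phi := fun x => x^-1)).
      have := @is_deriveV R id (G v) 1 1 (G0 v) (@is_derive_id _ _ _ _).
      by rewrite [_ *: 1]mulr1 -exprVn expr2 mulNr.
    exact/derivableP.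
  split=> [v|i v|i].
  + exact: (@cvgV _ _ (nbhs v) _ G _ (G0 v) (c v)).
  + exact: (@ex_derive _ _ _ _ _ _ _ (dG v i)).
  + have -> : partial i (fun v => (G v)^-1) =
        (fun v => -1 * (G v)^-1 * (G v)^-1 * partial i G v).
      by apply/funext => v; rewrite mulN1r; apply: partial_eq.
    apply: SG_mul => //; apply: SG_mul; last exact: SG_inv.
    by apply: SG_mul; [exact: SG_cst|exact: SG_inv].
- have dG v i : is_derive v (e_ i) (fun v => ln (G v)) ((G v)^-1 * partial i G v).
    apply: (is_derive_chain (phi := @ln R)); first exact: is_derive1_ln.
    exact/derivableP.
  split=> [v|i v|i].
  + apply: (@continuous_comp _ _ _ G (@ln R)); first exact: c.
    exact: continuous_ln.
  + exact: (@ex_derive _ _ _ _ _ _ _ (dG v i)).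
  + have -> : partial i (fun v => ln (G v)) = (fun v => (G v)^-1 * partial i G v).
      by apply/funext => v; apply: partial_eq.
    apply: SG_mul => //; apply: SG_inv => // v.
    by rewrite gt_eqF.
Qed.

Lemma smooth_generated_id G : smooth G -> smooth_generated G.
Proof.
move=> sG; have -> : G = fun v => G (0 + v *m 1%:M).
  by apply/funext => v; rewrite mulmx1 add0r.
exact: SG_affine.
Qed.

Lemma smooth_cst c : smooth (fun _ : 'rV[R]_n => c).
Proof. exact/smooth_generated_smooth/SG_cst. Qed.

Lemma smoothD G1 G2 : smooth G1 -> smooth G2 -> smooth (fun v => G1 v + G2 v).
Proof.
by move=> s1 s2; apply/smooth_generated_smooth/SG_add; exact: smooth_generated_id.
Qed.

Lemma smooth_sum (J : Type) (s : seq J) (g : J -> 'rV[R]_n -> R) :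
  (forall j, smooth (g j)) -> smooth (fun v => \sum_(j <- s) g j v).
Proof.
move=> sg; elim: s => [|j s IH].
  by under eq_fun do rewrite big_nil; exact: smooth_cst.
have -> : (fun v => \sum_(i <- j :: s) g i v) = fun v => g j v + \sum_(i <- s) g i v.
  by apply/funext => v; rewrite big_cons.
exact: (smoothD (sg j) IH).
Qed.

Lemma is_derive_bigsum (J : Type) (s : seq J) (g : J -> 'rV[R]_n -> R) (l : J -> R) v u :
  (forall j, is_derive v u (g j) (l j)) ->
  is_derive v u (fun w => \sum_(j <- s) g j w) (\sum_(j <- s) l j).
Proof.
move=> hg; elim: s => [|j s IH].
  have -> : (fun w => \sum_(j <- [::]) g j w) = fun=> 0.
    by apply/funext => w; rewrite big_nil.
  by rewrite big_nil; exact: is_derive_cst.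
have -> : (fun w => \sum_(i <- j :: s) g i w) = g j + fun w => \sum_(i <- s) g i w.
  by apply/funext => w; rewrite big_cons.
by rewrite big_cons; apply: is_deriveD.
Qed.

Lemma smoothM G1 G2 : smooth G1 -> smooth G2 -> smooth (fun v => G1 v * G2 v).
Proof.
by move=> s1 s2; apply/smooth_generated_smooth/SG_mul; exact: smooth_generated_id.
Qed.

Lemma smooth_ln G : smooth G -> (forall v, 0 < G v) -> smooth (fun v => ln (G v)).
Proof.
by move=> s G0; apply/smooth_generated_smooth/SG_ln => //; exact: smooth_generated_id.
Qed.

Lemma smooth_affine p (G : 'rV[R]_p -> R) (a : 'rV[R]_p) (A : 'M[R]_(n, p)) :
  smooth G -> smooth (fun v => G (a + v *m A)).
Proof. by move=> sG; apply/smooth_generated_smooth/SG_affine. Qed.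

(** Differentiation term by term under locally uniform domination of all
    derivatives. *)
Section WeierstrassTest.
Variables (I : eqType) (g : I -> 'rV[R]_n -> R).
Hypothesis g_smooth : forall k, smooth (g k).
Hypothesis g_dom : forall (s : seq 'I_n) (T : R), exists M : I -> R,
  (exists S, abs_sum_le M S) /\
  forall k v, `|v| <= T -> `|partials s (g k) v| <= M k.

Let G s v := usum (fun k => partials s (g k) v).

Lemma series_partials_bounded s v :
  exists S, abs_sum_le (fun k => partials s (g k) v) S.
Proof.
have [M [[S hS] hM]] := g_dom s `|v|; exists S.
apply: abs_sum_le_trans hS => k; apply: le_trans (hM k v (lexx _)) _.
exact: ler_norm.
Qed.

Lemma series_partialsP s v : has_sum (fun k => partials s (g k) v) (G s v).
Proof. by have [S hS] := series_partials_bounded s v; exact: usumP hS. Qed.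

Let G_tail s T : forall e, 0 < e -> exists2 A : seq I, uniq A &
  forall v, `|v| <= T -> `|G s v - \sum_(k <- A) partials s (g k) v| <= e.
Proof.
move=> e e0; have [M [[S hS] hM]] := g_dom s T.
have [A uA hA] := abs_sum_tail hS e0; exists A => // v vT.
apply: (has_sum_tail uA (series_partialsP s v)) => // B uB dB.
apply: le_trans (hA B uB dB); apply: ler_sum => k _.
exact: le_trans (hM k v vT) (ler_norm _).
Qed.

Let G_cont s v : {for v, continuous (G s)}.
Proof.
apply/cont_epsP => e e0.
have [A uA hA] := G_tail s (`|v| + 1) (ltac:(lra) : 0 < e / 4).
have : {for v, continuous (fun v => \sum_(k <- A) partials s (g k) v)}.
  by apply: smooth_cont; apply: smooth_sum => k; exact: smooth_partials.
move=> /cont_epsP/(_ (e / 4) ltac:(lra))[d d0 hd].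
exists (Num.min d 1); first by rewrite lt_min d0 ltr01.
move=> w; rewrite lt_min => /andP[wd w1].
have hw : `|w| <= `|v| + 1.
  rewrite -[w in leLHS](subrK v) addrC; apply: le_trans (ler_normD _ _) _.
  by rewrite lerD2l ltW.
have := hA w hw; have := hA v ltac:(by rewrite lerDl); have := hd w wd.
rewrite !ltr_norml !ler_norml => /andP[? ?] /andP[? ?] /andP[? ?].
apply/andP; split; lra.
Qed.

(** The remainder of the difference quotients is controlled, term by term, by the mean value
    theorem and the majorant of the next derivative. *)
Let G_derive s v i : is_derive v (e_ i) (G s) (G (i :: s) v).
Proof.
apply/is_derive_epsP => e e0.
pose T := `|v| + `|e_ i|.
have [M [[S hS] hM]] := g_dom (i :: s) T.
have [A uA hA] := abs_sum_tail hS (ltac:(lra) : 0 < e / 4).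
pose P v := \sum_(k <- A) partials s (g k) v.
pose P' := \sum_(k <- A) partials (i :: s) (g k) v.
have dP : is_derive v (e_ i) P P'.
  by apply: is_derive_bigsum => k; apply: smooth_derive; exact: smooth_partials.
have /is_derive_epsP/(_ (e / 2) ltac:(lra))[d d0 hd] := dP.
exists (Num.min d 1); first by rewrite lt_min d0 ltr01.
move=> t; rewrite lt_min => /andP[td t1].
have {}hd := hd t td.
have hlim : has_sum (fun k => partials s (g k) (v + t *: e_ i)
    - partials s (g k) v - t * partials (i :: s) (g k) v)
    (G s (v + t *: e_ i) - G s v - t * G (i :: s) v).
  apply: has_sumB; last by apply: has_sumZ; exact: series_partialsP.
  by apply: has_sumB; exact: series_partialsP.
have : `|(G s (v + t *: e_ i) - G s v - t * G (i :: s) v)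
   - \sum_(k <- A) (partials s (g k) (v + t *: e_ i)
    - partials s (g k) v - t * partials (i :: s) (g k) v)| <= e / 2 * `|t|.
  apply: (has_sum_tail uA hlim) => // B uB dB.
  have hk k : `|partials s (g k) (v + t *: e_ i)
    - partials s (g k) v - t * partials (i :: s) (g k) v| <= 2 * `|t| * `|M k|.
    have [c ct ->] := mvt_line t (fun r =>
      @smooth_derive _ _ (v + r *: e_ i) i (smooth_partials s (g_smooth k))).
    rewrite -mulrBr normrM mulrAC mulrC; apply: ler_wpM2r => //.
    apply: le_trans (ler_normB _ _) _.
    have b1 := hM k (v + c *: e_ i); have b2 := hM k v.
    have {}b1 : `|partials (i :: s) (g k) (v + c *: e_ i)| <= M k.
      apply: b1; apply: le_trans (ler_normD _ _) _; rewrite /T lerD2l normrZ.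
      by rewrite ler_piMl// (le_trans ct)// ltW.
    have {}b2 : `|partials (i :: s) (g k) v| <= M k.
      by apply: b2; rewrite /T lerDl.
    have := ler_norm (M k); rewrite /= in b1 b2 *; lra.
  apply: (@le_trans _ _ (\sum_(k <- B) 2 * `|t| * `|M k|)).
    by apply: ler_sum => k _; exact: hk.
  rewrite -mulr_sumr.
  have := hA B uB dB => h; apply: le_trans (ler_wpM2l _ h) _.
    by rewrite mulr_ge0.
  rewrite mulrAC [leRHS]mulrC; lra.
rewrite !sumrB -mulr_sumr => h2.
rewrite /P /P' in hd.
have := le_trans (ler_normD _ _) (lerD hd h2).
rewrite [X in `|X| <= _](_ : _ = G s (v + t *: e_ i) - G s v - t * G (i :: s) v).
  by move=> h; apply: le_trans h _; rewrite -mulrDl ler_wpM2r//; lra.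
ring.
Qed.

Lemma smooth_series : smooth (fun v => usum (fun k => g k v)).
Proof.
apply: (@smooth_coind n (fun h => exists s, h = G s)); last by exists [::].
move=> _ [s ->]; split=> [|i v|i]; first exact: G_cont.
  exact: (@ex_derive _ _ _ _ _ _ _ (G_derive s v i)).
by exists (i :: s); apply/funext => v; apply: partial_eq.
Qed.

End WeierstrassTest.
End SmoothAlgebra.
End Smooth.

(** * Substitution into a power series *)

Section PowerSeries.
Variable R : realType.

Lemma abs_sum_le_nat (f : nat -> R) M :
  (forall N, \sum_(i < N) `|f i| <= M) -> abs_sum_le f M.
Proof.
move=> h B uB; pose N := (\max_(i <- B) i).+1.
have sB : {subset B <= iota 0 N}.
  by move=> i iB; rewrite mem_iota add0n leq0n /= ltnS (leq_bigmax_seq (F := id)).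
apply: le_trans (h N).
rewrite -(big_mkord xpredT (fun i => `|f i|)) /index_iota subn0.
by rewrite (sum_split_seq _ uB (iota_uniq 0 N) sB) lerDl sumr_ge0.
Qed.

Lemma has_sum_nat (f : nat -> R) M s :
  abs_sum_le f M -> series f @ \oo --> s -> has_sum f s.
Proof.
move=> hM hs; have [s' hs'] := abs_sum_has_sum hM.
suff -> : s = s' by [].
apply: (@cvg_unique _ (@Rhausdorff R) (series f @ \oo)) => //.
apply/cvgrPdist_lt => e e0; have [A hA] := hs' e e0.
near=> n; rewrite distrC /series /=.
apply: hA; first exact: iota_uniq.
move=> i iA; rewrite mem_iota add0n leq0n /= subn0.
apply: (@leq_trans (\max_(i <- A) i).+1).
  by rewrite ltnS (leq_bigmax_seq (F := id)).
near: n; exact: nbhs_infty_ge.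
Unshelve. all: by end_near. Qed.

Definition mindex r := {ffun 'I_r -> nat}.

Section Substitution.
Variables (I : eqType) (x : I -> R) (X t : R).
Hypothesis x_le : abs_sum_le x t.
Hypothesis x_sum : has_sum x X.
Variables (a : nat -> R) (M Y : R).
Hypothesis a_le : abs_sum_le (fun n => a n * t ^+ n) M.
Hypothesis a_sum : has_sum (fun n => a n * X ^+ n) Y.

Fixpoint words (A : seq I) n : seq (seq I) :=
  if n is n'.+1 then [seq i :: s | i <- A, s <- words A n'] else [:: [::]].

Fixpoint words_below (A : seq I) n : seq (seq I) :=
  if n is n'.+1 then words A n' ++ words_below A n' else [::].

Lemma mem_words A n s : (s \in words A n) = (size s == n) && all (mem A) s.
Proof.
elim: n s => [|n IH] [|i s] //=.
- by apply/negbTE/allpairsP => -[[j t'] [_ _]].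
- apply/allpairsP/idP => [[[j s'] /= [jA]]|/andP[sn /andP[iA sA]]].
    by rewrite IH => /andP[/eqP <- h] [-> ->]; rewrite eqxx /= jA.
  by exists (i, s); split=> //=; rewrite IH sA andbT.
Qed.

Lemma mem_words_below A n s :
  (s \in words_below A n) = (size s < n)%N && all (mem A) s.
Proof.
elim: n => //= n IH; rewrite mem_cat mem_words IH ltnS [in RHS]leq_eqVlt.
by rewrite andb_orl.
Qed.

Lemma words_uniq A n : uniq A -> uniq (words A n).
Proof.
move=> uA; elim: n => //= n IH; apply: allpairs_uniq => //.
by move=> [i s] [j s'] _ _ /= [-> ->].
Qed.

Lemma words_below_uniq A n : uniq A -> uniq (words_below A n).
Proof.
move=> uA; elim: n => //= n IH; rewrite cat_uniq words_uniq// IH andbT.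
apply/hasPn => s; rewrite mem_words_below => /andP[sn _] /=.
by rewrite mem_words negb_and neq_ltn sn.
Qed.

Lemma sum_words (y : I -> R) A n :
  \sum_(s <- words A n) \prod_(i <- s) y i = (\sum_(i <- A) y i) ^+ n.
Proof.
elim: n => [|n IH]; first by rewrite big_seq1 big_nil.
rewrite /= big_allpairs_dep /= exprS -IH mulr_suml; apply: eq_bigr => i _.
by rewrite mulr_sumr; apply: eq_bigr => s _; rewrite big_cons.
Qed.

Lemma sum_words_below (c : nat -> R) (y : I -> R) A n :
  \sum_(s <- words_below A n) c (size s) * \prod_(i <- s) y i =
  \sum_(k < n) c k * (\sum_(i <- A) y i) ^+ k.
Proof.
elim: n => [|n IH]; first by rewrite big_nil big_ord0.
rewrite big_ord_recr /= big_cat /= IH addrC; congr (_ + _).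
rewrite -sum_words mulr_sumr [LHS]big_seq_cond [RHS]big_seq_cond.
apply: eq_bigr => s; rewrite andbT mem_words => /andP[/eqP -> _] //.
Qed.

Let t_ge0 : 0 <= t. Proof. exact: abs_sum_le_ge0 x_le. Qed.

(** A word [s] stands for the product of the [x i] over its letters: expanding
    [a n * X ^+ n] for [X = \sum_i x i] yields one term for each word of length [n]. *)
Lemma substitution_abs_sum_le :
  abs_sum_le (fun s : seq I => a (size s) * \prod_(i <- s) x i) M.
Proof.
move=> B uB.
pose A := undup (flatten B); pose N := (\max_(s <- B) size s).+1.
have uA : uniq A by exact: undup_uniq.
have sB : {subset B <= words_below A N}.
  move=> s sB; rewrite mem_words_below ltnS (leq_bigmax_seq (F := size))//=.
  by apply/allP => i si /=; rewrite mem_undup; apply/flattenP; exists s.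
pose F (s : seq I) := `|a (size s)| * \prod_(i <- s) `|x i|.
have E s : `|a (size s) * \prod_(i <- s) x i| = F s.
  by rewrite normrM normr_prod.
under eq_bigr do rewrite E.
apply: (@le_trans _ _ (\sum_(s <- words_below A N) F s)).
  rewrite (sum_split_seq F uB (words_below_uniq N uA) sB) lerDl.
  by apply: sumr_ge0 => s _; rewrite -E.
rewrite (sum_words_below (fun n => `|a n|) (fun i => `|x i|)).
apply: (@le_trans _ _ (\sum_(n < N) `|a n * t ^+ n|)).
  apply: ler_sum => n _; rewrite normrM ler_wpM2l// [leRHS]ger0_norm ?exprn_ge0//.
  by apply: lerXn2r; rewrite ?nnegrE ?sumr_ge0//; exact: x_le.
rewrite -(big_mkord xpredT (fun n => `|a n * t ^+ n|)).
exact: a_le (iota_uniq _ _).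
Qed.

(** The finite sums over all words of length less than [n] with letters in a
    finite set [A] are the polynomials [\sum_(k < n) a k * (\sum_A x) ^+ k]; these
    index sets exhaust all words. *)
Lemma has_sum_substitution :
  has_sum (fun s : seq I => a (size s) * \prod_(i <- s) x i) Y.
Proof.
have [Y' hY'] := abs_sum_has_sum substitution_abs_sum_le.
suff -> : Y = Y' by [].
apply/eqP; rewrite -subr_eq0 -normr_le0; apply/ler_addgt0Pr => e e0; rewrite add0r.
have [B hB] := hY' (e / 3) ltac:(lra).
have [C hC] := a_sum (ltac:(lra) : 0 < e / 3).
pose N := maxn (\max_(s <- B) size s).+1 (\max_(n <- C) n).+1.
have : (fun z : R => \sum_(k < N) a k * z ^+ k) @ X --> \sum_(k < N) a k * X ^+ k.
  have E : (fun z : R => \sum_(k < N) a k * z ^+ k) = horner (\poly_(k < N) a k).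
    by apply/funext => z; rewrite horner_poly.
  by rewrite E -horner_poly; exact: continuous_horner.
move=> /cvgrPdist_lt/(_ (e / 3) ltac:(lra))/nbhs_ballP[d /= d0 hd].
have [D hD] := x_sum d0.
pose A := undup (D ++ flatten B).
have uA : uniq A by exact: undup_uniq.
have hA : `|\sum_(i <- A) x i - X| < d.
  by apply: hD => // i iD; rewrite mem_undup mem_cat iD.
have h1 := hB (words_below A N) (words_below_uniq N uA).
have {}h1 := h1 ltac:(
  move=> s sB; rewrite mem_words_below; apply/andP; split;
  [apply: (@leq_trans (\max_(s <- B) size s).+1);
     [by rewrite ltnS (leq_bigmax_seq (F := size))| exact: leq_maxl]
  |apply/allP => i si /=; rewrite mem_undup mem_cat; apply/orP; right;
   by apply/flattenP; exists s]).
rewrite sum_words_below in h1.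
have h2 := hd (\sum_(i <- A) x i).
rewrite /ball /= distrC in h2; have {}h2 := h2 hA.
have h3 := hC (iota 0 N) (iota_uniq _ _).
have {}h3 := h3 ltac:(
  move=> n nC; rewrite mem_iota add0n leq0n /=;
  apply: (@leq_trans (\max_(n <- C) n).+1);
     [by rewrite ltnS (leq_bigmax_seq (F := id))| exact: leq_maxr]).
have E : \sum_(i <- iota 0 N) a i * X ^+ i = \sum_(k < N) a k * X ^+ k.
  by rewrite -(big_mkord xpredT (fun k => a k * X ^+ k)) /index_iota subn0.
rewrite E in h3.
rewrite !ltr_norml in h1 h2 h3; rewrite ler_norml.
case/andP: h1 => ? ?; case/andP: h2 => ? ?; case/andP: h3 => ? ?.
apply/andP; split; lra.
Qed.

End Substitution.

End PowerSeries.

(** * The series of sine, cosine and logarithm *)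

Section UnivariateSeries.
Variable R : realType.

Lemma sum_half_pow N : \sum_(n < N) (2^-1 : R) ^+ n <= 2.
Proof.
suff -> : \sum_(n < N) (2^-1 : R) ^+ n = 2 - 2 * 2^-1 ^+ N.
  by rewrite gerBl mulr_ge0// exprn_ge0// invr_ge0.
elim: N => [|N IH]; first by rewrite big_ord0 expr0; lra.
by rewrite big_ord_recr /= IH exprS; lra.
Qed.

Lemma invr_fact_le n : (n.+1`!%:R : R)^-1 <= 2^-1 ^+ n.
Proof.
rewrite exprVn lef_pV2 ?posrE ?exprn_gt0// ?ltr0n ?fact_gt0//.
rewrite -natrX ler_nat; elim: n => // n IH.
by rewrite expnS factS leq_mul.
Qed.

(** A series without constant term and with coefficients bounded by [1 / n!] is
    absolutely small on small discs. *)
Lemma abs_sum_le_expo (a : nat -> R) t : 0 <= t -> t <= 1 ->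
  a 0%N = 0 -> (forall n, `|a n| <= (n`!%:R)^-1) ->
  abs_sum_le (fun n => a n * t ^+ n) (2 * t).
Proof.
move=> t0 t1 a0 ha; apply: abs_sum_le_nat => -[|N].
  by rewrite big_ord0 mulr_ge0.
rewrite big_ord_recl /= a0 mul0r normr0 add0r.
apply: (@le_trans _ _ (\sum_(i < N) 2^-1 ^+ i * t)).
  apply: ler_sum => i _; rewrite normrM /bump /= add1n.
  apply: ler_pM => //; first exact: le_trans (ha _) (invr_fact_le _).
  by rewrite ger0_norm ?exprn_ge0// exprS ler_piMr// exprn_ile1.
by rewrite -mulr_suml ler_wpM2r// sum_half_pow.
Qed.

Definition sin_a n : R := (odd n)%:R * (-1) ^+ n.-1./2 / n`!%:R.
Definition cosB1_a n : R := if n is 0%N then 0 else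
  (~~ odd n)%:R * (-1) ^+ n./2 / n`!%:R.

Lemma sin_a_le n : `|sin_a n| <= (n`!%:R)^-1.
Proof.
rewrite /sin_a normrM normfV normr_nat ler_piMl ?invr_ge0//.
by rewrite normrM normrX normrN1 expr1n mulr1 normr_nat; case: odd.
Qed.

Lemma cosB1_a_le n : `|cosB1_a n| <= (n`!%:R)^-1.
Proof.
case: n => [|n]; first by rewrite normr0 invr_ge0.
rewrite /cosB1_a normrM normfV normr_nat ler_piMl ?invr_ge0//.
by rewrite normrM normrX normrN1 expr1n mulr1 normr_nat; case: odd.
Qed.

Lemma abs_sum_le_pow (a : nat -> R) t s M : `|s| <= t ->
  abs_sum_le (fun n => a n * t ^+ n) M -> abs_sum_le (fun n => a n * s ^+ n) M.
Proof.
move=> st; apply: abs_sum_le_trans => n; rewrite !normrM ler_wpM2l// !normrX.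
by apply: lerXn2r; rewrite ?nnegrE// (le_trans st)// ler_norm.
Qed.

Lemma has_sum_sin t s : `|s| <= t -> t <= 1 ->
  has_sum (fun n => sin_a n * s ^+ n) (sin s).
Proof.
move=> st t1; apply: (has_sum_nat (M := 2 * t)).
  apply: (abs_sum_le_pow st); apply: abs_sum_le_expo => //; last exact: sin_a_le.
    exact: le_trans st.
  by rewrite /sin_a /= !mul0r.
have := @is_cvg_series_sin_coeff R s; rewrite unlock.
suff -> : sin_coeff s = (fun n => sin_a n * s ^+ n) by [].
by apply/funext => n; rewrite /sin_coeff /sin_a /= mulrAC.
Qed.

Lemma has_sum_cosB1 t s : `|s| <= t -> t <= 1 ->
  has_sum (fun n => cosB1_a n * s ^+ n) (cos s - 1).
Proof.
move=> st t1; apply: (has_sum_nat (M := 2 * t)).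
  apply: (abs_sum_le_pow st); apply: abs_sum_le_expo => //; last exact: cosB1_a_le.
  exact: le_trans st.
have h : series (cos_coeff s) @ \oo --> cos s.
  by have := @is_cvg_series_cos_coeff R s; rewrite unlock.
rewrite -(cvg_shiftS _).
have -> : (fun n => series (fun n => cosB1_a n * s ^+ n) n.+1)
   = (fun n => series (cos_coeff s) n.+1 - 1).
  apply/funext => n; rewrite /series /= !big_nat_recl//= mul0r add0r.
  rewrite /cos_coeff /= expr0 fact0 divr1 !mulr1 addrAC subrr add0r.
  by apply: eq_bigr => i _; rewrite mulrAC.
apply: cvgB; last exact: cvg_cst.
by rewrite (cvg_shiftS _).
Qed.

Definition ln1_a n : R := if n is 0%N then 0 else - (-1) ^+ n / n%:R.

Lemma abs_sum_le_ln1 : abs_sum_le (fun n => ln1_a n * 2^-1 ^+ n) 2.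
Proof.
apply: abs_sum_le_nat => N; apply: le_trans (sum_half_pow N).
apply: ler_sum => -[[|n] nN] _ /=; first by rewrite mul0r normr0.
rewrite normrM normrM normrN normrX normrN1 expr1n mul1r normfV normr_nat.
rewrite [X in _ * X]ger0_norm ?exprn_ge0 ?invr_ge0// ler_piMl// ?exprn_ge0 ?invr_ge0//.
by rewrite invf_le1 ?ltr0n// ler1n.
Qed.

(** The remainder of the Mercator series vanishes at [0] and has derivative
    [(-s)^N / (1 + s)]. *)
Lemma ln1_remainder N s : `|s| <= 2^-1 ->
  `|ln (1 + s) - \sum_(n < N.+1) ln1_a n * s ^+ n| <= 2^-1 ^+ N.
Proof.
move=> hs.
pose r z := ln (1 + z) - \sum_(n < N.+1) ln1_a n * z ^+ n.
pose P : {poly R} := \poly_(n < N.+1) ln1_a n.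
have rE z : r z = ln (1 + z) - P.[z] by rewrite /r horner_poly.
have r0 : r 0 = 0.
  rewrite rE addr0 ln1 horner_poly big_ord_recl /= mul0r add0r big1 ?addr0 ?oppr0// => i _.
  by rewrite expr0n /= mulr0.
have dr (z : R) : `|z| <= 2^-1 -> is_derive z 1 r ((1 + z)^-1 - P^`().[z]).
  move=> hz; have z1 : 0 < 1 + z by move: hz; rewrite ler_norml; lra.
  have -> : r = (fun z => ln (1 + z)) - (horner P).
    by apply/funext => w; rewrite rE.
  have h1 : is_derive z 1 (fun w : R => 1 + w) 1.
    have := @is_deriveD _ _ _ (cst (1:R)) id z 1 0 1 (is_derive_cst _ _ _) (is_derive_id _ _).
    by rewrite add0r.
  have h2 : is_derive z 1 (fun w : R => ln (1 + w)) (1 + z)^-1.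
    rewrite -[X in is_derive _ _ _ X]mulr1.
    exact: (@is_derive1_comp _ (@ln R) (fun w => 1 + w) z _ _ (is_derive1_ln z1) h1).
  exact: (@is_deriveB _ _ _ _ _ _ _ _ _ h2 (is_derive_poly P z)).
have dP (z : R) : `|z| <= 2^-1 -> (1 + z)^-1 - P^`().[z] = (- z) ^+ N / (1 + z).
  move=> hz; have z1 : 1 + z != 0 by move: hz; rewrite ler_norml => ?; rewrite gt_eqF//; lra.
  have -> : P^`().[z] = \sum_(n < N) (- z) ^+ n.
    have -> : P^`() = \poly_(n < N) (-1) ^+ n.
      apply/polyP => k; rewrite coef_deriv !coef_poly ltnS.
      case: ifP => kN; last by rewrite mul0rn.
      by rewrite /= -[_ *+ k.+1]mulr_natr divfK ?pnatr_eq0// exprS mulN1r opprK.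
    by rewrite horner_poly; apply: eq_bigr => i _; rewrite [in RHS]exprNn.
  apply: (mulIf z1); rewrite mulrBl mulVf// divfK//.
  have -> : (\sum_(n < N) (- z) ^+ n) * (1 + z) = 1 - (- z) ^+ N.
    elim: N {r P rE r0 dr} => [|N IH]; first by rewrite big_ord0 mul0r expr0 subrr.
    by rewrite big_ord_recr /= mulrDl IH exprS; ring.
  by rewrite opprB addrC subrK.
have bound (z : R) : `|z| <= 2^-1 -> `|(- z) ^+ N / (1 + z)| <= 2 * 2^-1 ^+ N.
  move=> hz; have z1 : 2^-1 <= 1 + z by move: hz; rewrite ler_norml; lra.
  rewrite normrM normfV mulrC; apply: ler_pM => //.
    rewrite ger0_norm; last by lra.
    by rewrite invf_ple ?posrE//; lra.
  by rewrite normrX normrN; apply: lerXn2r; rewrite ?nnegrE ?invr_ge0.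
have [c hc] := mvt_sym (fun z hz => dr z (le_trans hz hs)).
rewrite r0 subr0 => E.
have hc2 : `|c| <= 2^-1 := le_trans hc hs.
rewrite -/(r s) E dP// normrM.
apply: le_trans (ler_pM _ _ hs (bound _ hc2)) _ => //.
by rewrite mulrA mulVf ?mul1r.
Qed.

Lemma has_sum_ln1 s : `|s| <= 2^-1 -> has_sum (fun n => ln1_a n * s ^+ n) (ln (1 + s)).
Proof.
move=> hs; apply: (has_sum_nat (M := 2)).
  exact: abs_sum_le_pow hs abs_sum_le_ln1.
rewrite -(cvg_shiftS _); apply/cvgrPdist_le => e e0.
have /cvgrPdist_le/(_ e e0) : (2^-1 : R) ^+ n @[n --> \oo] --> 0.
  by apply: cvg_expr; rewrite ger0_norm ?invr_ge0//; lra.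
apply: filterS => n; rewrite sub0r normrN ger0_norm ?exprn_ge0 ?invr_ge0// => hn.
rewrite /series /= (big_mkord xpredT (fun n => ln1_a n * s ^+ n)).
exact: le_trans (ln1_remainder _ hs) hn.
Qed.

End UnivariateSeries.

(** * Real analytic functions of several variables *)

Section Expansions.
Variables (R : realType) (r : nat).
Local Notation mindex := (mindex r).
Implicit Types (g : 'rV[R]_r -> R) (h : 'rV[R]_r) (mu nu : mindex).

Definition mdeg (nu : mindex) : nat := \sum_i nu i.
Definition madd (mu nu : mindex) : mindex := [ffun i => (mu i + nu i)%N].

Definition in_polydisc rho h := forall i, `|h 0 i| <= rho.

(** [g] is on the polydisc of radius [rho] the sum of a power series whose absolute
    values on that polydisc add up to at most [t]. *)
Definition expands rho t g := exists C : mindex -> R,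
  abs_sum_le (fun nu => C nu * rho ^+ mdeg nu) t /\
  forall h, in_polydisc rho h -> has_sum (fun nu => C nu * monomial h nu) (g h).

Lemma monomial_madd h mu nu :
  monomial h (madd mu nu) = monomial h mu * monomial h nu.
Proof.
by rewrite /monomial -big_split; apply: eq_bigr => i _; rewrite ffunE exprD.
Qed.

Lemma mdeg_madd mu nu : mdeg (madd mu nu) = (mdeg mu + mdeg nu)%N.
Proof. by rewrite /mdeg -big_split; apply: eq_bigr => i _; rewrite ffunE. Qed.

Lemma monomial_le rho h nu : in_polydisc rho h -> `|monomial h nu| <= rho ^+ mdeg nu.
Proof.
move=> hh; rewrite normr_prod /mdeg -prodrXr; apply: ler_prod => i _.
rewrite normr_ge0 normrX; apply: lerXn2r => //; rewrite nnegrE //.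
exact: le_trans (hh i).
Qed.

Lemma expands_abs rho t g h : 0 <= rho -> expands rho t g -> in_polydisc rho h ->
  `|g h| <= t.
Proof.
move=> r0 [C [hC hg]] hh; apply: has_sum_abs_le (hg h hh) _.
apply: abs_sum_le_trans hC => nu; rewrite !normrM ler_wpM2l//.
by rewrite [leRHS]ger0_norm ?exprn_ge0//; exact: monomial_le.
Qed.

(** A sum of monomials with possibly repeated exponents becomes a power series when the
    terms with the same exponent are added up. *)
Lemma expands_regroup (I : eqType) (C : I -> R) (nu : I -> mindex) rho t g : 0 < rho ->
  abs_sum_le (fun i => C i * rho ^+ mdeg (nu i)) t ->
  (forall h, in_polydisc rho h -> has_sum (fun i => C i * monomial h (nu i)) (g h)) ->
  expands rho t g.
Proof.
move=> r0 hC hg; have [S hS] := abs_sum_has_sum hC.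
have [D [_ hD fibD]] := has_sum_fibers nu hC hS.
have rho_neq0 mu : rho ^+ mdeg mu != 0 by rewrite expf_neq0// gt_eqF.
exists (fun mu => D mu / rho ^+ mdeg mu); split=> [|h hh].
  by apply: abs_sum_le_trans hD => mu; rewrite divfK.
have hx : abs_sum_le (fun i => C i * monomial h (nu i)) t.
  apply: abs_sum_le_trans hC => i; rewrite !normrM ler_wpM2l//.
  by rewrite [leRHS]ger0_norm ?(exprn_ge0 _ (ltW r0))//; exact: monomial_le.
have [k [hk _ fibk]] := has_sum_fibers nu hx (hg h hh).
apply: has_sum_eq hk => mu; apply: has_sum_unique (fibk mu) _.
rewrite mulrAC -mulrA mulrC; apply: has_sum_eq (has_sumZ _ (fibD mu)) => i.
case: ifP => [/eqP <-|_]; last by rewrite mulr0.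
by rewrite mulrCA divfK// mulrC.
Qed.

Lemma expands_eq rho t g1 g2 : g1 =1 g2 -> expands rho t g1 -> expands rho t g2.
Proof. by move=> /funext ->. Qed.

Lemma expandsZ rho t g c : expands rho t g -> expands rho (`|c| * t) (fun h => c * g h).
Proof.
move=> [C [hC hg]]; exists (fun nu => c * C nu); split=> [|h hh].
  by apply: abs_sum_le_trans (abs_sum_leZ c hC) => nu; rewrite mulrA.
by apply: has_sum_eq (has_sumZ c (hg h hh)) => nu; rewrite mulrA.
Qed.

Lemma expandsD rho t1 t2 g1 g2 : expands rho t1 g1 -> expands rho t2 g2 ->
  expands rho (t1 + t2) (fun h => g1 h + g2 h).
Proof.
move=> [C [hC hg]] [D [hD hk]]; exists (fun nu => C nu + D nu); split=> [|h hh].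
  by apply: abs_sum_le_trans (abs_sum_leD hC hD) => nu; rewrite mulrDl.
by apply: has_sum_eq (has_sumD (hg h hh) (hk h hh)) => nu; rewrite mulrDl.
Qed.

Lemma expands_monomial rho nu : 0 <= rho -> expands rho (rho ^+ mdeg nu) (fun h => monomial h nu).
Proof.
move=> r0; have E (F : mindex -> R) (B : seq mindex) : uniq B ->
    \sum_(mu <- B) (mu == nu)%:R * F mu = if nu \in B then F nu else 0.
  move=> uB; case: ifPn => nB.
    rewrite (bigD1_seq nu)//= eqxx mul1r big1 ?addr0// => mu /negbTE ->.
    by rewrite mul0r.
  rewrite big_seq_cond big1// => mu /andP[mB _].
  by case: eqP => [E|_]; rewrite ?mul0r//; move: nB; rewrite -E mB.
exists (fun mu => (mu == nu)%:R); split=> [B uB|h _ e e0].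
  under eq_bigr do rewrite normrM normr_nat.
  by rewrite E//; case: ifP => _; rewrite ?exprn_ge0// ger0_norm// exprn_ge0.
exists [:: nu] => B uB sB; rewrite E// sB ?mem_head//.
by rewrite subrr normr0.
Qed.

Lemma expands_cst rho c : 0 <= rho -> expands rho `|c| (fun=> c).
Proof.
move=> r0; have := expandsZ c (expands_monomial [ffun=> 0%N] r0).
have -> : mdeg [ffun=> 0%N] = 0%N by rewrite /mdeg big1// => i _; rewrite ffunE.
rewrite expr0 mulr1; apply: expands_eq => h.
by rewrite /monomial big1 ?mulr1// => i _; rewrite ffunE expr0.
Qed.

Lemma expands_sum (J : Type) (s : seq J) rho (t : J -> R) (g : J -> 'rV[R]_r -> R) :
  0 <= rho -> (forall j, expands rho (t j) (g j)) ->
  expands rho (\sum_(j <- s) t j) (fun h => \sum_(j <- s) g j h).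
Proof.
move=> r0 hg; elim: s => [|j s IH].
  rewrite big_nil; have := expands_cst 0 r0; rewrite normr0.
  by apply: expands_eq => h; rewrite big_nil.
rewrite big_cons; apply: expands_eq (expandsD (hg j) IH) => h.
by rewrite big_cons.
Qed.

Lemma expands_coord rho i : 0 <= rho -> expands rho rho (fun h => h 0 i).
Proof.
move=> r0; pose nu : mindex := [ffun j => (j == i : nat)].
have := expands_monomial nu r0; have -> : mdeg nu = 1%N.
  rewrite /mdeg (bigD1 i)//= big1 => [|j ji]; first by rewrite ffunE eqxx.
  by rewrite ffunE (negbTE ji).
rewrite expr1; apply: expands_eq => h.
rewrite /monomial (bigD1 i)//= big1 ?mulr1 => [|j ji]; first by rewrite ffunE eqxx.
by rewrite ffunE (negbTE ji).
Qed.

Lemma expands_dot rho (theta : 'rV[R]_r) : 0 <= rho ->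
  expands rho ((\sum_i `|theta 0 i|) * rho) (fun h => dot theta h).
Proof.
move=> r0; rewrite mulr_suml.
by apply: expands_sum => // i; apply: expandsZ; exact: expands_coord.
Qed.

Lemma expands_le rho t t' g : t <= t' -> expands rho t g -> expands rho t' g.
Proof.
move=> tt' [C [hC hg]]; exists C; split=> // B uB.
exact: le_trans (hC B uB) tt'.
Qed.

(** Substitution into a power series in one variable: the monomials of the composite
    are the products along all words in the indices of the inner expansion. *)
Lemma expands_comp rho t g (a : nat -> R) (Phi : R -> R) M : 0 < rho ->
  abs_sum_le (fun n => a n * t ^+ n) M ->
  (forall s, `|s| <= t -> has_sum (fun n => a n * s ^+ n) (Phi s)) ->
  expands rho t g -> expands rho M (fun h => Phi (g h)).
Proof.
move=> r0 hM hPhi hg; have [C [hC hs]] := hg.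
have E1 (s : seq mindex) :
   rho ^+ mdeg (\big[madd/[ffun=> 0%N]]_(i <- s) i) = \prod_(i <- s) rho ^+ mdeg i.
  elim: s => [|i s IH]; last by rewrite !big_cons mdeg_madd exprD IH.
  by rewrite !big_nil /mdeg big1 ?expr0// => i _; rewrite ffunE.
have E2 h (s : seq mindex) :
   monomial h (\big[madd/[ffun=> 0%N]]_(i <- s) i) = \prod_(i <- s) monomial h i.
  elim: s => [|i s IH]; last by rewrite !big_cons monomial_madd IH.
  by rewrite !big_nil /monomial big1 => // i _; rewrite ffunE expr0.
apply: (@expands_regroup (seq mindex) (fun s => a (size s) * \prod_(i <- s) C i)
  (fun s => \big[madd/[ffun=> 0%N]]_(i <- s) i)) => // [|h hh].
  apply: abs_sum_le_trans (substitution_abs_sum_le hC hM) => s.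
  by rewrite E1 -mulrA -big_split.
have hx : abs_sum_le (fun nu => C nu * monomial h nu) t.
  apply: abs_sum_le_trans hC => nu; rewrite !normrM ler_wpM2l//.
  by rewrite [leRHS]ger0_norm ?(exprn_ge0 _ (ltW r0))//; exact: monomial_le.
have gt := expands_abs (ltW r0) hg hh.
apply: has_sum_eq (has_sum_substitution hx (hs h hh) hM (hPhi _ gt)) => s.
by rewrite E2 -mulrA -big_split.
Qed.

Definition analytic_at0 g := exists2 rho, 0 < rho & exists t, expands rho t g.

Lemma expands_shrink rho rho' t g : 0 <= rho' -> rho' <= rho ->
  expands rho t g -> expands rho' t g.
Proof.
move=> r0 rr [C [hC hg]]; exists C; split=> [|h hh].
  apply: abs_sum_le_trans hC => nu; rewrite !normrM ler_wpM2l// !ger0_norm ?exprn_ge0//.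
    by apply: lerXn2r; rewrite ?nnegrE// (le_trans r0).
  exact: le_trans r0 rr.
by apply: hg => i; exact: le_trans (hh i) rr.
Qed.

Lemma analytic_at0D g1 g2 : analytic_at0 g1 -> analytic_at0 g2 ->
  analytic_at0 (fun h => g1 h + g2 h).
Proof.
move=> [r1 r10 [t1 h1]] [r2 r20 [t2 h2]].
have m0 : 0 < Num.min r1 r2 by rewrite lt_min r10.
exists (Num.min r1 r2) => //; exists (t1 + t2).
apply: expandsD; [apply: expands_shrink h1 => //|apply: expands_shrink h2 => //].
- exact: ltW.
- by rewrite ge_min lexx.
- exact: ltW.
- by rewrite ge_min lexx orbT.
Qed.

Lemma analytic_at0Z g c : analytic_at0 g -> analytic_at0 (fun h => c * g h).
Proof. by move=> [r1 r10 [t h1]]; exists r1 => //; exists (`|c| * t); exact: expandsZ. Qed.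

Lemma analytic_at0_cst c : analytic_at0 (fun=> c).
Proof. by exists 1 => //; exists `|c|; exact: expands_cst. Qed.

Lemma analytic_at0_sum (J : Type) (s : seq J) (g : J -> 'rV[R]_r -> R) :
  (forall j, analytic_at0 (g j)) -> analytic_at0 (fun h => \sum_(j <- s) g j h).
Proof.
move=> hg; elim: s => [|j s IH].
  by under eq_fun do rewrite big_nil; exact: analytic_at0_cst.
by under eq_fun do rewrite big_cons; exact: analytic_at0D.
Qed.

Lemma real_analytic_at0 (g : 'rV[R]_r -> R) :
  (forall a, analytic_at0 (fun h => g (a + h))) -> real_analytic g.
Proof.
move=> hg a; have [rho r0 [t [coef [_ hc]]]] := hg a; exists coef.
apply/nbhs_ballP; exists rho => //= h; rewrite mx_norm_ball /ball_ /= sub0r normrN => hr.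
apply: has_sum_totally; apply: hc => i.
exact: le_trans (coord_le_norm _ _) (ltW hr).
Qed.

(** Near a point where it is positive, such a sum is a positive constant times
    [1 + w] with [w] of small norm, so that the Mercator series applies. *)
Lemma ln_trig_sum_analytic (J : finType) (A B : J -> R) (theta : J -> 'rV[R]_r)
    (P := fun v => \sum_j (A j * cos (dot (theta j) v) + B j * sin (dot (theta j) v))) :
  (forall v, 0 < P v) -> forall a, analytic_at0 (fun h => ln (P (a + h))).
Proof.
move=> P0 a.
pose ca j := cos (dot (theta j) a); pose sa j := sin (dot (theta j) a).
pose A' j := (A j * ca j + B j * sa j) / P a.
pose B' j := (B j * ca j - A j * sa j) / P a.
pose w h := \sum_j (A' j * (cos (dot (theta j) h) - 1) + B' j * sin (dot (theta j) h)).
have wE h : P (a + h) = P a * (1 + w h).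
  have Pa0 : P a != 0 by rewrite gt_eqF.
  rewrite mulrDr mulr1 /w mulr_sumr {1}/P {1}/P -big_split; apply: eq_bigr => j _ /=.
  rewrite dotDr cosD sinD /A' /B' /ca /sa.
  move: (P a) Pa0 => p p0; field; exact: p0.
pose S := \sum_j (`|A' j| + `|B' j|).
have S0 : 0 <= S by apply: sumr_ge0 => j _; rewrite addr_ge0.
(* On the polydisc of radius [rho] all [dot (theta j) h] are at most [t] in absolute value, so
   that [|cos - 1|] and [|sin|] of them are at most [2 * t], and [|w|] at most [1 / 2]. *)
pose t := (4 * (S + 1))^-1.
have t0 : 0 < t by rewrite invr_gt0; lra.
have t1 : t <= 1 by rewrite invf_le1; lra.
have tS : S * (2 * t) <= 2^-1.
  rewrite /t invfM; have -> : S * (2 * (4^-1 * (S + 1)^-1)) = S / (S + 1) * 2^-1.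
    by field; lra.
  by rewrite ler_piMl// ler_pdivrMr; lra.
pose L := \sum_j \sum_i `|theta j 0 i|.
have L0 : 0 <= L by apply: sumr_ge0 => j _; exact: sumr_ge0.
pose rho := t / (L + 1).
have r0 : 0 < rho by apply: divr_gt0 => //; lra.
have hw : expands rho (S * (2 * t)) w.
  rewrite /S mulr_suml /w.
  apply: expands_sum => [|j]; first exact: ltW.
  have hj : \sum_i `|theta j 0 i| <= L.
    by rewrite /L (bigD1 j)//= lerDl; apply: sumr_ge0 => k _; exact: sumr_ge0.
  have hl : expands rho t (dot (theta j)).
    apply: expands_le (expands_dot (theta j) (ltW r0)).
    rewrite /rho mulrA ler_pdivrMr ?mulrDr; last by lra.
    rewrite mulrC mulr1; apply: (@le_trans _ _ (t * L)); first by rewrite ler_wpM2l// ltW.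
    by rewrite lerDl ltW.
  rewrite mulrDl; apply: expandsD; apply: expandsZ.
    apply: (expands_comp (Phi := fun x => cos x - 1) (a := @cosB1_a R) (t := t)) => //.
    - by apply: abs_sum_le_expo => //; [exact: ltW|exact: cosB1_a_le].
    - by move=> x hx; apply: (has_sum_cosB1 hx).
  apply: (expands_comp (Phi := @sin R) (a := @sin_a R) (t := t)) => //.
  - apply: abs_sum_le_expo => //; [exact: ltW| |exact: sin_a_le].
    by rewrite /sin_a /= !mul0r.
  - by move=> x hx; apply: (has_sum_sin hx).
have hln : expands rho 2 (fun h => ln (1 + w h)).
  apply: (expands_comp (Phi := fun x => ln (1 + x)) (a := @ln1_a R) (t := 2^-1)).
  - exact: r0.
  - exact: abs_sum_le_ln1.
  - exact: has_sum_ln1.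
  - exact: expands_le hw.
have -> : (fun h => ln (P (a + h))) = (fun h => ln (P a) + ln (1 + w h)).
  apply/funext => h; rewrite wE lnM ?posrE//.
  by have := P0 (a + h); rewrite wE pmulr_rgt0.
apply: analytic_at0D; first exact: analytic_at0_cst.
by exists rho => //; exists 2.
Qed.

End Expansions.

(** * Continuous periodic functions *)

Section PeriodicFunctions.
Variables (R : realType).

Definition cperiodic n (G : 'rV[R]_n -> R) :=
  continuous G /\ forall v (k : 'rV[int]_n), G (v + int_vec R k) = G v.

Lemma reduce_mod1 n (v : 'rV[R]_n) :
  exists k : 'rV[int]_n, forall i, 0 <= (v + int_vec R k) 0 i < 1.
Proof.
exists (\row_i - Num.floor (v 0 i)) => i; rewrite !mxE mulrNz.
have := floor_itv (v 0 i); rewrite intrD1 => /andP[h1 h2].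
by rewrite subr_ge0 h1 ltrBlDl.
Qed.

(** [w] lies in one of [N] half-open cells of length [1 / N]. *)
Lemma truncn_cell (N : nat) (w : R) : (0 < N)%N -> 0 <= w < 1 ->
  (Num.truncn (N%:R * w) < N)%N /\
  (Num.truncn (N%:R * w))%:R / N%:R <= w < (Num.truncn (N%:R * w))%:R / N%:R + N%:R^-1.
Proof.
move=> N0 /andP[w0 w1]; have N0R : 0 < N%:R :> R by rewrite ltr0n.
have Nw0 : 0 <= N%:R * w by rewrite mulr_ge0.
split; first by rewrite truncn_lt_nat// gtr_pMr.
have /andP[t1 t2] := truncn_itv Nw0; rewrite -[(Num.truncn _).+1%:R]natr1 in t2.
by rewrite -[X in _ + X]mul1r -mulrDl ler_pdivrMr// ltr_pdivlMr// ![w * _]mulrC t1.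
Qed.

Definition unit_box n : set 'rV[R]_n := [set v | forall i, `[0, 1]%classic (v ord0 i)].

Lemma unit_box_compact n : compact (@unit_box n).
Proof. by apply: (@rV_compact R n (fun=> `[0, 1]%classic)) => i; exact: segment_compact. Qed.

Lemma periodic_unit_box n (G : 'rV[R]_n -> R) v : cperiodic G ->
  exists2 w, unit_box w & exists2 k : 'rV[int]_n, w = v + int_vec R k & G v = G w.
Proof.
move=> [_ pG]; have [k hk] := reduce_mod1 v.
exists (v + int_vec R k) => [i /=|]; last by exists k.
by rewrite in_itv/=; have /andP[-> /ltW ->] := hk i.
Qed.

(** A periodic function takes all its values on the compact unit box. *)
Lemma periodic_bounded n (G : 'rV[R]_n -> R) : cperiodic G ->
  exists2 M, 0 < M & forall v, `|G v| <= M.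
Proof.
move=> pG; have cA : {within @unit_box n, continuous (fun v => `|G v|)}.
  apply: continuous_subspaceT => v; apply/cont_epsP => e e0.
  have [d d0 hd] := (cont_epsP v G).1 (pG.1 v) e e0; exists d => // w wv.
  exact: le_lt_trans (ler_dist_dist _ _) (hd w wv).
have [|c _ hc] := EVT_max_rV _ (@unit_box_compact n) cA.
  by exists 0 => i /=; rewrite mxE in_itv/= lexx ler01.
exists (`|G c| + 1); first by rewrite ltr_wpDl.
move=> v; have [w wb [k _ ->]] := periodic_unit_box v pG.
by apply: le_trans (hc w (mem_set wb)) _; rewrite lerDl.
Qed.

Lemma periodic_unif_continuous n (G : 'rV[R]_n -> R) : cperiodic G ->
  forall e, 0 < e -> exists2 d, 0 < d & forall v w, `|w - v| < d -> `|G w - G v| < e.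
Proof.
move=> pG e e0.
have nc := (compact_near_coveringP (@unit_box n)).1 (@unit_box_compact n).
have : \forall d \near (0 : R)^'+, unit_box (n:=n) `<=`
    (fun v => forall w, `|w - v| < d -> `|G w - G v| < e).
  apply: (nc R (0^'+) (fun d v => forall w, `|w - v| < d -> `|G w - G v| < e) _).
  move=> v vb.
  have [d d0 hd] := (cont_epsP v G).1 (pG.1 v) (e / 2) ltac:(lra).
  exists ([set w | `|w - v| < d / 2], [set x : R | x < d / 2]).
    split; first by apply/nbhs_ballP; exists (d / 2) => //=;
      [lra|move=> w; rewrite mx_norm_ball /ball_ /= distrC].
    by apply: nbhs_right_lt; lra.
  move=> [w x] /= [wv xd] u uw.
  have h1 := hd w ltac:(lra).
  have h2 : `|u - v| < d.
    have -> : u - v = (u - w) + (w - v) by rewrite addrA subrK.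
    by apply: le_lt_trans (ler_normD _ _) _; lra.
  have {}h2 := hd u h2; move: h1 h2; rewrite !ltr_norml => /andP[? ?] /andP[? ?].
  apply/andP; split; lra.
move=> H; have /nbhs_ballP[d /= d0 hd] : nbhs (0 : R) [set x | 0 < x ->
   unit_box (n:=n) `<=` (fun v => forall w, `|w - v| < x -> `|G w - G v| < e)] by exact: H.
have hd2 := hd (d / 2).
exists (d / 2); first lra.
move=> v w wv; have [v' vb [k E ->]] := periodic_unit_box v pG.
rewrite -(pG.2 w k); apply: (hd2 _ _ v' vb); rewrite ?E.
- rewrite /ball /= sub0r normrN ger0_norm; lra.
- lra.
- by rewrite opprD addrACA subrr addr0.
Qed.

End PeriodicFunctions.

(** * Integration over the circle and the torus *)

Section CircleIntegral.
Variable R : realType.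
Local Notation mu := (@lebesgue_measure R).

Definition circle_integral (psi : R -> R) : R := \int[uniform_prob (@ltr01 R)]_s psi s.

Lemma circle_integralE (psi : R -> R) : continuous psi -> (forall s, 0 <= psi s) ->
  circle_integral psi = \int[mu]_(s in `[0, 1]) psi s.
Proof.
move=> cpsi psi0; rewrite /circle_integral /Rintegral integral_uniform.
- by rewrite subr0 invr1 mul1e.
- by apply/measurable_EFinP; exact: continuous_measurable_fun.
- by move=> s; rewrite lee_fin.
Qed.

(** The integral of a 1-periodic function over [[a, a + 1]] has derivative
    [psi (a + 1) - psi a = 0] in [a]. *)
Lemma Rintegral_shift (psi : R -> R) a : 0 <= a -> continuous psi ->
  (forall s, psi (s + 1) = psi s) ->
  \int[mu]_(s in `[0, 1]) psi (s + a) = \int[mu]_(s in `[0, 1]) psi s.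
Proof.
move=> a0 cpsi ppsi.
pose Psi (x : R) : R := \int[mu]_(t in `[-1, x]) psi t.
have iN1 (x : R) : mu.-integrable `[-1, x] (EFin \o psi).
  apply: continuous_compact_integrable; first exact: segment_compact.
  exact: continuous_subspaceT.
have dPsi (x : R) : -1 < x -> is_derive x 1 Psi (psi x).
  move=> x1; have xx1 : x < x + 1 by rewrite ltrDl.
  have [d1 d2] := continuous_FTC1_closed xx1 (iN1 _) x1 (cpsi x).
  by split; [exact: d1|rewrite -d2 derive1E].
have dPsic (x c : R) : -1 < x + c -> is_derive x 1 (fun y => Psi (y + c)) (psi (x + c)).
  move=> xc; have h := dPsi _ xc.
  rewrite -[psi _]mulr1; apply: (@is_derive1_comp _ Psi (fun y => y + c)) => //.
  have := @is_deriveD _ _ _ id (cst c) x 1 1 0 (is_derive_id _ _) (is_derive_cst _ _ _).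
  by rewrite addr0.
have cont (x c : R) : -1 < x + c -> {for x, continuous (fun y => Psi (y + c))}.
  move=> xc; apply: differentiable_continuous; apply/derivable1_diffP.
  by apply: (@ex_derive _ _ _ _ _ _ _ (dPsic x c xc)).
have ftc (c : R) : 0 <= c -> \int[mu]_(s in `[0, 1]) psi (s + c) = Psi (1 + c) - Psi (0 + c).
  move=> c0; rewrite /Rintegral.
  rewrite (@continuous_FTC2 _ (fun s => psi (s + c)) (fun y => Psi (y + c)) 0 1)//.
  - apply: continuous_subspaceT => x; apply: continuous_comp; last exact: cpsi.
    exact: (@cvgD _ _ _ (nbhs x) _ id (cst c) _ _ cvg_id (cvg_cst _)).
  - split.
    + move=> x; rewrite in_itv/= => /andP[x0 x1].
      by apply: (@ex_derive _ _ _ _ _ _ _ (dPsic x c _)); lra.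
    + by apply: cvg_at_right_filter; apply: cont; lra.
    + by apply: cvg_at_left_filter; apply: cont; lra.
  - move=> x; rewrite in_itv/= => /andP[x0 x1].
    have hx : -1 < x + c by lra.
    by rewrite derive1E; exact: (@derive_val _ _ _ _ _ _ _ (dPsic x c hx)).
have -> : \int[mu]_(s in `[0, 1]) psi s = \int[mu]_(s in `[0, 1]) psi (s + 0).
  by apply: eq_Rintegral => s _; rewrite addr0.
rewrite !ftc// !add0r addr0.
pose F (x : R) : R := Psi (x + 1) - Psi (x + 0).
have dF (x : R) : -1 < x -> is_derive x 1 F 0.
  move=> x1; have -> : 0 = psi (x + 1) - psi (x + 0) by rewrite ppsi addr0 subrr.
  by apply: is_deriveB; apply: dPsic; lra.
have hF (x : R) : x \in `]0, a[ -> is_derive x 1 F 0.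
  by rewrite in_itv/= => /andP[? _]; apply: dF; lra.
have cF : {within `[0, a], continuous F}.
  apply: derivable_within_continuous => x; rewrite in_itv/= => /andP[x0 _].
  by apply: (@ex_derive _ _ _ _ _ _ _ (dF x _)); lra.
have [c _] := MVT_segment (df := fun=> 0) a0 hF cF.
rewrite mul0r => /eqP; rewrite subr_eq0 /F !addr0 add0r => /eqP.
by rewrite (addrC 1 a) => ->.
Qed.

Lemma bounded_prob_integrable d (T : measurableType d) (P : probability T R) (f : T -> R) M :
  measurable_fun setT f -> (forall x, `|f x| <= M) -> P.-integrable setT (EFin \o f).
Proof.
move=> mf fM; apply: measurable_bounded_integrable => //.
  by rewrite [X in (X < _)%E](probability_setT P) ltry.
exists M; split; first exact: num_real.
by move=> y My x _; exact: le_trans (fM x) (ltW My).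
Qed.

Lemma Rintegral_prob_cst d (T : measurableType d) (P : probability T R) (c : R) :
  \int[P]_x c = c.
Proof.
by rewrite Rintegral_cst// [fine _](_ : _ = 1) ?mulr1// [X in fine X](probability_setT P).
Qed.

(** Adding the constant [M] makes the integrand nonnegative, and a shift by a negative number
    is undone by a shift by a positive one. *)
Lemma circle_integral_shift (psi : R -> R) a M : continuous psi ->
  (forall s, psi (s + 1) = psi s) -> (forall s, `|psi s| <= M) ->
  circle_integral (fun s => psi (s + a)) = circle_integral psi.
Proof.
move=> cpsi ppsi psiM.
have cs b : continuous (fun s => psi (s + b)).
  move=> x; apply: continuous_comp; last exact: cpsi.
  exact: (@cvgD _ _ _ (nbhs x) _ id (cst b) _ _ cvg_id (cvg_cst _)).
have E c : circle_integral (fun s => psi (s + c) + M)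
    = circle_integral (fun s => psi (s + c)) + M.
  rewrite /circle_integral RintegralD//.
  + by rewrite Rintegral_prob_cst.
  + apply: (@bounded_prob_integrable _ _ _ _ M) => //.
    exact: continuous_measurable_fun.
  + exact: (@bounded_prob_integrable _ _ _ _ `|M|).
have cM c : continuous (fun s => psi (s + c) + M).
  by move=> x; apply: (@cvgD _ _ _ (nbhs x) _ _ (cst M) _ _ (cs c x) (cvg_cst _)).
have M0 c s : 0 <= psi (s + c) + M by have := psiM (s + c); rewrite ler_norml; lra.
have ge0 b c : 0 <= b -> circle_integral (fun s => psi (s + (b + c)))
   = circle_integral (fun s => psi (s + c)).
  move=> b0; apply: (@addIr _ M); rewrite -!E !circle_integralE//.
  rewrite -[RHS](Rintegral_shift b0)//; last by move=> s; rewrite addrAC ppsi.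
  by apply: eq_Rintegral => s _; rewrite addrA.
case: (leP 0 a) => a0.
  rewrite -[a]addr0 ge0//; congr circle_integral.
  by apply/funext => s; rewrite addr0.
have <- := @ge0 (- a) a; last by rewrite oppr_ge0 ltW.
by rewrite addNr; congr circle_integral; apply/funext => s; rewrite addr0.
Qed.

End CircleIntegral.

Section CubeIntegral.
Variable R : realType.

Definition cube_row n (t : n.-tuple (measurableTypeR R)) : 'rV[R]_n := \row_i tnth t i.

(** The integral over the torus of a function given by its lift. *)
Definition cube_integral n (G : 'rV[R]_n -> R) : R :=
  \int[cube_measure R n]_t G (cube_row t).

(** Functions of the integer parts of the coordinates take countably many values, on boxes. *)
Lemma measurable_floor_row n (k : R) (h : 'rV[int]_n -> R) :
  measurable_fun setT (fun t : n.-tuple (measurableTypeR R) =>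
    h (\row_i Num.floor (k * tnth t i))).
Proof.
move=> _ Y mY; rewrite setTI.
have -> : (fun t : n.-tuple (measurableTypeR R) =>
    h (\row_i Num.floor (k * tnth t i))) @^-1` Y = \bigcup_z
  ([set _ | Y (h z)] `&` \bigcap_(i in setT)
     [set t : n.-tuple (measurableTypeR R) | (z 0 i)%:~R <= k * tnth t i < (z 0 i + 1)%:~R]).
  apply/seteqP; split=> [t Yt|t [z _] [Yz hz] /=].
    exists (\row_i Num.floor (k * tnth t i)) => //.
    by split=> // i _ /=; rewrite mxE; exact: floor_itv.
  suff -> : \row_i Num.floor (k * tnth t i) = z by [].
  by apply/rowP => i; rewrite mxE; apply: floor_def; exact: hz.
apply: countable_bigcupT_measurable => [|z]; first exact: countableP.
apply: measurableI.
  have [Yz|nYz] := pselect (Y (h z)).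
    rewrite [X in measurable X](_ : _ = setT)//.
    by apply/seteqP; split.
  rewrite [X in measurable X](_ : _ = set0)//.
  by apply/seteqP; split.
apply: fin_bigcap_measurable => // i _.
have mk : measurable_fun setT (fun t : n.-tuple (measurableTypeR R) => k * tnth t i).
  by apply: measurable_funM => //; exact: measurable_tnth.
have h2 := mk measurableT _ (measurable_itv `[(z 0 i)%:~R : R, (z 0 i + 1)%:~R[).
rewrite setTI in h2.
rewrite [X in measurable X](_ : _ = (fun t : n.-tuple (measurableTypeR R) => k * tnth t i)
  @^-1` `[(z 0 i)%:~R, (z 0 i + 1)%:~R[) //.
Qed.

(** A continuous function is the limit of its values on finer and finer grids. *)
Lemma continuous_measurable_cube n (G : 'rV[R]_n -> R) : continuous G ->
  measurable_fun setT (fun t : n.-tuple (measurableTypeR R) => G (cube_row t)).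
Proof.
move=> cG.
pose h (k : nat) (z : 'rV[int]_n) := G (\row_i ((z 0 i)%:~R / k.+1%:R)).
apply: (@measurable_fun_cvg _ (n.-tuple (measurableTypeR R)) R setT
  (fun k (t : n.-tuple (measurableTypeR R)) => h k (\row_i Num.floor (k.+1%:R * tnth t i)))
  (fun t => G (cube_row t))) => [k|t _].
  exact: measurable_floor_row.
apply/cvgrPdist_lt => e e0.
have [d d0 hd] := (cont_epsP _ G).1 (cG (cube_row t)) e e0.
near=> k; rewrite distrC; apply: hd; apply/norm_ltP => // i; rewrite !mxE.
have k0 : 0 < k.+1%:R :> R by rewrite ltr0n.
have := floor_itv (k.+1%:R * tnth t i); rewrite intrD1.
set z := (Num.floor _)%:~R => /andP[z1 z2].
have -> : z / k.+1%:R - tnth t i = (z - k.+1%:R * tnth t i) / k.+1%:R.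
  by rewrite mulrBl mulrAC divff ?mul1r// gt_eqF.
rewrite normrM normfV (ger0_norm (ltW k0)) ltr_pdivrMr// ler0_norm; last by lra.
apply: (@le_lt_trans _ _ 1); first lra.
rewrite mulrC -ltr_pdivrMr//.
apply: (@lt_trans _ _ k%:R); last by rewrite ltr_nat.
by near: k; exact: nbhs_infty_gtr.
Unshelve. all: by end_near. Qed.

Lemma cube_integrable n (G : 'rV[R]_n -> R) : cperiodic G ->
  (cube_measure R n).-integrable setT (EFin \o (fun t => G (cube_row t))).
Proof.
move=> pG; have [M M0 hM] := periodic_bounded pG.
apply: (@bounded_prob_integrable _ _ _ _ _ M) => //.
exact: continuous_measurable_cube pG.1.
Qed.

Lemma cube_integral_cst n (c : R) : cube_integral (fun _ : 'rV[R]_n => c) = c.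
Proof. exact: Rintegral_prob_cst. Qed.

Lemma cube_integralD n (G1 G2 : 'rV[R]_n -> R) : cperiodic G1 -> cperiodic G2 ->
  cube_integral (fun v => G1 v + G2 v) = cube_integral G1 + cube_integral G2.
Proof. by move=> p1 p2; rewrite /cube_integral RintegralD//; exact: cube_integrable. Qed.

Lemma cube_integralZ n c (G : 'rV[R]_n -> R) : cperiodic G ->
  cube_integral (fun v => c * G v) = c * cube_integral G.
Proof. by move=> p; rewrite /cube_integral RintegralZl//; exact: cube_integrable. Qed.

Lemma cube_integral_le n (G1 G2 : 'rV[R]_n -> R) : cperiodic G1 -> cperiodic G2 ->
  (forall v, G1 v <= G2 v) -> cube_integral G1 <= cube_integral G2.
Proof. by move=> p1 p2 h; apply: le_Rintegral => //; exact: cube_integrable. Qed.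

Definition row_cons n (s : R) (w : 'rV[R]_n) : 'rV[R]_n.+1 :=
  \row_i if unlift ord0 i is Some j then w 0 j else s.

Lemma row_consP n (u v : 'rV[R]_n.+1) : u 0 ord0 = v 0 ord0 ->
  (forall j, u 0 (lift ord0 j) = v 0 (lift ord0 j)) -> u = v.
Proof.
move=> h0 hS; apply/rowP => i; have [j ->|->] := unliftP ord0 i => //.
Qed.

Lemma norm_row_consB n s s' (w w' : 'rV[R]_n) e : 0 < e ->
  `|s - s'| < e -> `|w - w'| < e -> `|row_cons s w - row_cons s' w'| < e.
Proof.
move=> e0 hs /norm_ltP hw; apply/norm_ltP => // i.
have [j ->|->] := unliftP ord0 i.
  by have := hw e0 j; rewrite !mxE !liftK.
by rewrite !mxE !unlift_none.
Qed.

Lemma row_consD n s s' (w w' : 'rV[R]_n) :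
  row_cons (s + s') (w + w') = row_cons s w + row_cons s' w'.
Proof.
by apply: row_consP => [|j]; rewrite !mxE ?unlift_none ?liftK// !mxE.
Qed.

Lemma row_cons_int n (m : int) (k : 'rV[int]_n) :
  row_cons m%:~R (int_vec R k) = int_vec R (\row_i if unlift ord0 i is Some j then k 0 j else m).
Proof.
by apply: row_consP => [|j]; rewrite !mxE ?unlift_none ?liftK// !mxE.
Qed.

Lemma periodic_row_cons n (G : 'rV[R]_n.+1 -> R) s : cperiodic G ->
  cperiodic (fun w : 'rV[R]_n => G (row_cons s w)).
Proof.
move=> pG; split=> [w|w k].
  apply/cont_epsP => e e0.
  have [d d0 hd] := (cont_epsP _ G).1 (pG.1 (row_cons s w)) e e0.
  exists d => // w' hw; apply: hd; apply: norm_row_consB => //.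
  by rewrite subrr normr0.
rewrite -{1}[s]addr0 row_consD -(mulr0z 1) row_cons_int.
exact: pG.2.
Qed.

Lemma cube_integral_norm_le n (G : 'rV[R]_n -> R) M : cperiodic G ->
  (forall v, `|G v| <= M) -> `|cube_integral G| <= M.
Proof.
move=> pG hM; rewrite ler_norml; apply/andP; split.
  rewrite -(cube_integral_cst n (- M)); apply: cube_integral_le => //.
    by split=> // v; exact: cst_continuous.
  by move=> v; have := hM v; rewrite ler_norml => /andP[].
rewrite -[leRHS](cube_integral_cst n M); apply: cube_integral_le => //.
  by split=> // v; exact: cst_continuous.
by move=> v; have := hM v; rewrite ler_norml => /andP[].
Qed.

(** Fubini, for the first coordinate. *)
Lemma cube_integralS n (G : 'rV[R]_n.+1 -> R) : cperiodic G ->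
  cube_integral G = circle_integral (fun s => cube_integral (fun w => G (row_cons s w))).
Proof.
move=> pG; have [M M0 hM] := periodic_bounded pG.
have mG := continuous_measurable_cube pG.1.
have rowE (p : measurableTypeR R * n.-tuple (measurableTypeR R)) :
    cube_row (tuple_cons p) = row_cons p.1 (cube_row p.2).
  apply: row_consP => [|j]; rewrite !mxE ?unlift_none ?liftK ?mxE.
    by rewrite (tnth_nth p.1).
  by rewrite tnthS.
have mGc : measurable_fun setT
    (fun p : measurableTypeR R * n.-tuple (measurableTypeR R) =>
       G (cube_row (tuple_cons p))).
  exact: (measurableT_comp mG (@measurable_tuple_cons R n)).
have iGc : (uniform_prob (@ltr01 R) \x cube_measure R n)%E.-integrable setT
   (EFin \o (fun p => G (cube_row (tuple_cons p)))).
  by apply: (@bounded_prob_integrable _ _ _ _ _ M).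
rewrite /cube_integral /circle_integral /Rintegral.
rewrite [in LHS]/cube_measure -/cube_measure.
rewrite integral_distribution//; last exact/measurable_EFinP.
rewrite -integral12_prod_meas1//; congr fine.
apply: eq_integral => s _; rewrite /fubini_F fineK.
  by apply: eq_integral => t _ /=; rewrite rowE.
apply: integrable_fin_num => //.
exact: cube_integrable (periodic_row_cons s pG).
Qed.

Lemma periodic_shift n (G : 'rV[R]_n -> R) a : cperiodic G -> cperiodic (fun v => G (v + a)).
Proof.
move=> pG; split=> [v|v k]; last by rewrite addrAC pG.2.
apply/cont_epsP => e e0; have [d d0 hd] := (cont_epsP _ G).1 (pG.1 (v + a)) e e0.
by exists d => // w hw; apply: hd; rewrite opprD addrACA subrr addr0.
Qed.

Lemma cube_integralB n (G1 G2 : 'rV[R]_n -> R) : cperiodic G1 -> cperiodic G2 ->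
  cube_integral (fun v => G1 v - G2 v) = cube_integral G1 - cube_integral G2.
Proof. by move=> p1 p2; rewrite /cube_integral RintegralB//; exact: cube_integrable. Qed.

Lemma periodicB n (G1 G2 : 'rV[R]_n -> R) : cperiodic G1 -> cperiodic G2 ->
  cperiodic (fun v => G1 v - G2 v).
Proof.
move=> p1 p2; split=> [v|v k]; last by rewrite p1.2 p2.2.
exact: (@cvgB _ _ _ (nbhs v) _ _ _ _ _ (p1.1 v) (p2.1 v)).
Qed.

(** Translation invariance, one coordinate at a time by Fubini. *)
Lemma cube_integral_shift n (G : 'rV[R]_n -> R) a : cperiodic G ->
  cube_integral (fun v => G (v + a)) = cube_integral G.
Proof.
elim: n G a => [|n IH] G a pG.
  congr cube_integral; apply/funext => v; congr G; apply/rowP => -[].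
  by case.
rewrite cube_integralS; last exact: periodic_shift.
rewrite (cube_integralS pG).
have [M M0 hM] := periodic_bounded pG.
pose a0 := a 0 ord0; pose a' : 'rV[R]_n := \row_j a 0 (lift ord0 j).
have aE : a = row_cons a0 a' by apply: row_consP => [|j]; rewrite !mxE ?unlift_none ?liftK ?mxE.
pose psi s := cube_integral (fun w => G (row_cons s w)).
rewrite -/(circle_integral psi).
rewrite -(@circle_integral_shift R psi a0 M).
- congr circle_integral; apply/funext => s; rewrite /psi.
  rewrite -[RHS](IH _ a'); last exact: periodic_row_cons.
  congr cube_integral; apply/funext => w.
  by rewrite aE row_consD.
- move=> s; suff : forall e, 0 < e -> exists2 d, 0 < d & forall s', `|s' - s| < d ->
      `|psi s' - psi s| <= e.
    move=> h; suff : psi s' @[s' --> s] --> psi s by [].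
    apply/cvgrPdist_le => e e0; have [d d0 hd] := h e e0.
    apply/nbhs_ballP; exists d => //= s'; rewrite /ball /= distrC => /hd.
    by rewrite distrC.
  move=> e e0; have [d d0 hd] := periodic_unif_continuous pG e0.
  exists d => // s' hs; rewrite /psi -cube_integralB; [|exact: periodic_row_cons..].
  apply: cube_integral_norm_le.
    by apply: periodicB; exact: periodic_row_cons.
  move=> w; apply/ltW/hd; apply: norm_row_consB => //.
  by rewrite subrr normr0.
- move=> s; congr cube_integral; apply/funext => w.
  have -> : row_cons (s + 1) w = row_cons s w + int_vec R (\row_i if unlift ord0 i is Some j then (0 : 'rV[int]_n) 0 j else 1).
    rewrite -row_cons_int -row_consD; congr row_cons.
    by apply/rowP => j; rewrite !mxE addr0.
  exact: pG.2.
- by move=> s; apply: cube_integral_norm_le => //; exact: periodic_row_cons.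
Qed.

End CubeIntegral.

(** * The trigonometric system *)

Section TrigonometricSystem.
Variable R : realType.

Lemma cos_int (m : int) : cos (2 * pi * m%:~R) = 1 :> R.
Proof.
have hn (n : nat) : cos (2 * pi * n%:R) = 1 :> R.
  elim: n => [|n IH]; first by rewrite mulr0 cos0.
  by rewrite -[n.+1%:R]natr1 mulrDr mulr1 [X in _ + X]mulr_natl cosD2pi.
case: m => n; first exact: hn.
by rewrite NegzE mulrNz mulrN cosN hn.
Qed.

Lemma sin_int (m : int) : sin (2 * pi * m%:~R) = 0 :> R.
Proof.
have hn (n : nat) : sin (2 * pi * n%:R) = 0 :> R.
  elim: n => [|n IH]; first by rewrite mulr0 sin0.
  by rewrite -[n.+1%:R]natr1 mulrDr mulr1 [X in _ + X]mulr_natl sinD2pi.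
case: m => n; first exact: hn.
by rewrite NegzE mulrNz mulrN sinN hn oppr0.
Qed.

Lemma dot_int n (k l : 'rV[int]_n) :
  dot (int_vec R k) (int_vec R l) = (\sum_i k 0 i * l 0 i)%:~R.
Proof.
rewrite /dot rmorph_sum; apply: eq_bigr => i _.
by rewrite !mxE rmorphM.
Qed.

(** The real part of [(A - i B) e^{i <theta, v>}]. *)
Definition wave n (theta : 'rV[R]_n) (A B : R) (v : 'rV[R]_n) : R :=
  A * cos (dot theta v) + B * sin (dot theta v).

Lemma is_derive_dot n (theta v u : 'rV[R]_n) : is_derive v u (dot theta) (dot theta u).
Proof.
apply/is_derive_epsP => e e0; exists 1 => // t _.
rewrite dotDr dotZr (_ : _ - _ = 0); last by ring.
by rewrite normr0 mulr_ge0// ltW.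
Qed.

Lemma is_derive_wave n (theta : 'rV[R]_n) A B v i :
  is_derive v (delta_mx 0 i) (wave theta A B)
   (wave theta (theta 0 i * B) (- (theta 0 i * A)) v).
Proof.
have h : is_derive v (delta_mx 0 i) (dot theta) (theta 0 i).
  by have := is_derive_dot theta v (delta_mx 0 i); rewrite dot_delta.
have hc := is_derive_chain (phi := @cos R) (is_derive_cos _) h.
have hs := is_derive_chain (phi := @sin R) (is_derive_sin _) h.
have -> : wave theta A B = A \*: (fun w => cos (dot theta w)) + B \*: (fun w => sin (dot theta w)).
  by apply/funext.
have -> : wave theta (theta 0 i * B) (- (theta 0 i * A)) v =
    A *: (- sin (dot theta v) * theta 0 i) + B *: (cos (dot theta v) * theta 0 i).
  by rewrite /wave /GRing.scale /=; ring.
exact: (is_deriveD (@is_deriveZ _ _ _ _ A _ _ _ hc) (@is_deriveZ _ _ _ _ B _ _ _ hs)).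
Qed.

Lemma partial_wave n (theta : 'rV[R]_n) A B i :
  partial i (wave theta A B) = wave theta (theta 0 i * B) (- (theta 0 i * A)).
Proof. by apply/funext => v; apply: partial_eq; exact: is_derive_wave. Qed.

Lemma smooth_wave n (theta : 'rV[R]_n) A B : smooth (wave theta A B).
Proof.
apply: (@smooth_coind _ _ (fun G => exists A B, G = wave theta A B)); last by exists A, B.
move=> _ [{}A [{}B ->]]; split=> [v|i v|i].
- have cdot : {for v, continuous (dot theta)}.
    have -> : dot theta = fun w => (0 + w *m theta^T) ord0 ord0.
      by apply/funext => w; rewrite add0r dotC mxE; apply: eq_bigr => j _; rewrite mxE.
    have h1 : {for v, continuous (fun w : 'rV[R]_n => 0 + w *m theta^T : 'rV[R]_1)}.
      exact: continuous_mulmx.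
    exact: (continuous_comp h1 (@coord_continuous R 1 1 ord0 ord0 _)).
  have cc : {for v, continuous (fun w => cos (dot theta w))}.
    by apply: (@continuous_comp _ _ _ (dot theta) (@cos R)) => //; exact: continuous_cos.
  have cs : {for v, continuous (fun w => sin (dot theta w))}.
    by apply: (@continuous_comp _ _ _ (dot theta) (@sin R)) => //; exact: continuous_sin.
  apply: (@cvgD _ _ _ (nbhs v) _ (fun w => A * cos (dot theta w))
    (fun w => B * sin (dot theta w))).
    exact: (@cvgM _ _ (nbhs v) _ (cst A) _ _ _ (cvg_cst _) cc).
  exact: (@cvgM _ _ (nbhs v) _ (cst B) _ _ _ (cvg_cst _) cs).
- exact: (@ex_derive _ _ _ _ _ _ _ (is_derive_wave theta A B v i)).
- by rewrite partial_wave; do 2 eexists.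
Qed.

Definition freq n (k : 'rV[int]_n) : 'rV[R]_n := (2 * pi) *: int_vec R k.

Lemma int_vecD n (k l : 'rV[int]_n) : int_vec R (k + l) = int_vec R k + int_vec R l.
Proof. by apply/rowP => i; rewrite !mxE rmorphD. Qed.

Lemma int_vecN n (k : 'rV[int]_n) : int_vec R (- k) = - int_vec R k.
Proof. by apply/rowP => i; rewrite !mxE rmorphN. Qed.

Lemma int_vec0 n : int_vec R (0 : 'rV[int]_n) = 0.
Proof. by apply/rowP => i; rewrite !mxE. Qed.

Lemma freqD n (k l : 'rV[int]_n) : freq (k + l) = freq k + freq l.
Proof. by rewrite /freq int_vecD scalerDr. Qed.

Lemma freqN n (k : 'rV[int]_n) : freq (- k) = - freq k.
Proof. by rewrite /freq int_vecN scalerN. Qed.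

Lemma freq0 n : freq (0 : 'rV[int]_n) = 0.
Proof. by rewrite /freq int_vec0 scaler0. Qed.

Lemma freq_coord n (k : 'rV[int]_n) i : freq k 0 i = 2 * pi * (k 0 i)%:~R.
Proof. by rewrite !mxE. Qed.

Lemma dot_freq_int n (k l : 'rV[int]_n) :
  dot (freq k) (int_vec R l) = 2 * pi * (\sum_i k 0 i * l 0 i)%:~R.
Proof. by rewrite dotZl dot_int. Qed.

Lemma cperiodic_wave n (k : 'rV[int]_n) A B : cperiodic (wave (freq k) A B).
Proof.
split=> [|v l]; first by apply: smooth_continuous; exact: smooth_wave.
rewrite /wave dotDr dot_freq_int cosD sinD cos_int sin_int.
by rewrite !mulr1 !mulr0 subr0 addr0.
Qed.

Lemma wave0 n A B (v : 'rV[R]_n) : wave (freq 0) A B v = A.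
Proof. by rewrite /wave freq0 /dot big1 ?cos0 ?sin0 ?mulr1 ?mulr0 ?addr0// => i _; rewrite mxE mul0r. Qed.

Lemma wave_comb n (k : 'rV[R]_n) A B v : wave k A B v = A * wave k 1 0 v + B * wave k 0 1 v.
Proof. by rewrite /wave !mul1r !mul0r addr0 add0r. Qed.

(** The product formula keeps trigonometric sums stable under multiplication. *)
Lemma waveM n (k l : 'rV[R]_n) A B C D v :
  wave k A B v * wave l C D v =
    wave (k + l) ((A * C - B * D) / 2) ((A * D + B * C) / 2) v
  + wave (k - l) ((A * C + B * D) / 2) ((B * C - A * D) / 2) v.
Proof.
by rewrite /wave !dotDl dotNl !cosD !sinD cosN sinN; field.
Qed.

Lemma cperiodicD n (G1 G2 : 'rV[R]_n -> R) : cperiodic G1 -> cperiodic G2 ->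
  cperiodic (fun v => G1 v + G2 v).
Proof.
move=> p1 p2; split=> [v|v k]; last by rewrite p1.2 p2.2.
exact: (@cvgD _ _ _ (nbhs v) _ _ _ _ _ (p1.1 v) (p2.1 v)).
Qed.

Lemma cperiodicM n (G1 G2 : 'rV[R]_n -> R) : cperiodic G1 -> cperiodic G2 ->
  cperiodic (fun v => G1 v * G2 v).
Proof.
move=> p1 p2; split=> [v|v k]; last by rewrite p1.2 p2.2.
exact: (@cvgM _ _ (nbhs v) _ _ _ _ _ (p1.1 v) (p2.1 v)).
Qed.

Lemma cperiodic_cst n c : cperiodic (fun _ : 'rV[R]_n => c : R).
Proof. by split=> // v; exact: cst_continuous. Qed.

Lemma cperiodicZ n c (G : 'rV[R]_n -> R) : cperiodic G -> cperiodic (fun v => c * G v).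
Proof. by move=> pG; apply: cperiodicM => //; exact: cperiodic_cst. Qed.

Lemma cperiodic_sum n (J : Type) (s : seq J) (G : J -> 'rV[R]_n -> R) :
  (forall j, cperiodic (G j)) -> cperiodic (fun v => \sum_(j <- s) G j v).
Proof.
move=> pG; elim: s => [|j s IH].
  by under eq_fun do rewrite big_nil; exact: cperiodic_cst.
by under eq_fun do rewrite big_cons; exact: cperiodicD.
Qed.

Lemma cube_integral_sum n (J : Type) (s : seq J) (G : J -> 'rV[R]_n -> R) :
  (forall j, cperiodic (G j)) ->
  cube_integral (fun v => \sum_(j <- s) G j v) = \sum_(j <- s) cube_integral (G j).
Proof.
move=> pG; elim: s => [|j s IH].
  by under eq_fun do rewrite big_nil; rewrite cube_integral_cst big_nil.
under eq_fun do rewrite big_cons.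
by rewrite cube_integralD//; [rewrite big_cons IH|exact: cperiodic_sum].
Qed.

Definition smooth_periodic n (G : 'rV[R]_n -> R) :=
  smooth G /\ forall v (k : 'rV[int]_n), G (v + int_vec R k) = G v.

Lemma smooth_periodic_cperiodic n (G : 'rV[R]_n -> R) : smooth_periodic G -> cperiodic G.
Proof. by move=> [sG pG]; split=> //; exact: smooth_continuous. Qed.

Lemma smooth_periodic_partial n (G : 'rV[R]_n -> R) i :
  smooth_periodic G -> smooth_periodic (partial i G).
Proof.
move=> [sG pG]; split=> [|v k]; first exact: smooth_partial.
apply: partial_eq; apply/is_derive_epsP => e e0.
have [d d0 hd] := (is_derive_epsP _ _ _ _).1 (smooth_derive v i sG) e e0.
by exists d => // t td; rewrite (addrAC v) !pG; exact: hd.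
Qed.

Lemma smooth_periodicM n (G1 G2 : 'rV[R]_n -> R) :
  smooth_periodic G1 -> smooth_periodic G2 -> smooth_periodic (fun v => G1 v * G2 v).
Proof.
by move=> [s1 p1] [s2 p2]; split=> [|v k]; [exact: smoothM|rewrite p1 p2].
Qed.

Lemma smooth_periodicD n (G1 G2 : 'rV[R]_n -> R) :
  smooth_periodic G1 -> smooth_periodic G2 -> smooth_periodic (fun v => G1 v + G2 v).
Proof.
by move=> [s1 p1] [s2 p2]; split=> [|v k]; [exact: smoothD|rewrite p1 p2].
Qed.

Lemma smooth_periodic_cst n c : smooth_periodic (fun _ : 'rV[R]_n => c).
Proof. by split=> //; exact: smooth_cst. Qed.

Lemma smooth_periodic_wave n (k : 'rV[int]_n) A B : smooth_periodic (wave (freq k) A B).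
Proof. by split=> [|v l]; [exact: smooth_wave|rewrite (cperiodic_wave k A B).2]. Qed.

(** The difference quotients of [G] have mean zero by translation invariance, and
    they converge uniformly to the derivative. *)
Lemma cube_integral_partial n (G : 'rV[R]_n -> R) i :
  smooth_periodic G -> cube_integral (partial i G) = 0.
Proof.
move=> sG; have pG := smooth_periodic_cperiodic sG.
have pD := smooth_periodic_cperiodic (smooth_periodic_partial i sG).
apply/eqP; rewrite -normr_le0; apply/ler_addgt0Pr => e e0; rewrite add0r.
have [d d0 hd] := periodic_unif_continuous pD e0.
pose u : 'rV[R]_n := delta_mx 0 i.
pose t := d / (2 * (`|u| + 1)).
have u1 : 0 < `|u| + 1 by rewrite ltr_wpDl.
have t0 : 0 < t by rewrite divr_gt0// mulr_gt0.
have tu c : `|c| <= t -> `|c *: u| < d.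
  move=> ct; rewrite normrZ; apply: (@le_lt_trans _ _ (t * (`|u| + 1))).
    by apply: ler_pM => //; rewrite lerDl.
  rewrite /t invfM mulrA mulfVK ?gt_eqF//; lra.
have -> : cube_integral (partial i G) =
    cube_integral (fun v => partial i G v - t^-1 * (G (v + t *: u) - G v)).
  have pS := periodic_shift (t *: u) pG.
  rewrite cube_integralB//; last by apply: cperiodicZ; exact: periodicB.
  rewrite cube_integralZ; last exact: periodicB.
  by rewrite cube_integralB// cube_integral_shift// subrr mulr0 subr0.
apply: cube_integral_norm_le.
  by apply: periodicB => //; apply: cperiodicZ; apply: periodicB => //; exact: periodic_shift.
move=> v.
have [c ct ->] := mvt_line (v := v) (u := u) t (fun s => @smooth_derive _ _ _ _ i sG.1).
rewrite mulrA mulVf ?gt_eqF// mul1r distrC; apply/ltW/hd.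
rewrite addrAC subrr add0r; apply: tu; rewrite (le_trans ct)// ger0_norm// ltW//.
Qed.

Lemma cube_integral_wave n (k : 'rV[int]_n) A B :
  cube_integral (wave (freq k) A B) = (k == 0)%:R * A.
Proof.
have [->|k0] := eqVneq k 0.
  rewrite mul1r -[RHS](cube_integral_cst n A); congr cube_integral.
  by apply/funext => v; exact: wave0.
have [i ki] := rV0Pn _ k0.
rewrite mul0r.
have f0 : freq k 0 i != 0.
  by rewrite freq_coord !mulf_neq0 ?intr_eq0// gt_eqF// pi_gt0.
have := cube_integral_partial i (smooth_periodic_wave k (- (B / freq k 0 i)) (A / freq k 0 i)).
by rewrite partial_wave mulrN opprK !(mulrC (freq k 0 i)) !divfK.
Qed.

Definition cos_coef n (G : 'rV[R]_n -> R) (k : 'rV[int]_n) : R :=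
  cube_integral (fun v => G v * wave (freq k) 1 0 v).
Definition sin_coef n (G : 'rV[R]_n -> R) (k : 'rV[int]_n) : R :=
  cube_integral (fun v => G v * wave (freq k) 0 1 v).

Lemma coef_wave n (G : 'rV[R]_n -> R) (k : 'rV[int]_n) A B : cperiodic G ->
  cube_integral (fun v => G v * wave (freq k) A B v) =
  A * cos_coef G k + B * sin_coef G k.
Proof.
move=> pG; have p1 := cperiodicM pG (cperiodic_wave k 1 0).
have p2 := cperiodicM pG (cperiodic_wave k 0 1).
rewrite -!cube_integralZ// -cube_integralD; [|exact: cperiodicZ..].
congr cube_integral; apply/funext => v.
by rewrite wave_comb mulrDr !(mulrCA (G v)).
Qed.

(** Integration by parts. *)
Lemma coef_wave_partial n (G : 'rV[R]_n -> R) (k : 'rV[int]_n) A B i : smooth_periodic G ->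
  cube_integral (fun v => partial i G v * wave (freq k) A B v) =
  - cube_integral (fun v => G v * partial i (wave (freq k) A B) v).
Proof.
move=> sG; have sW := smooth_periodic_wave k A B.
have p1 := smooth_periodic_cperiodic (smooth_periodicM (smooth_periodic_partial i sG) sW).
have p2 := smooth_periodic_cperiodic (smooth_periodicM sG (smooth_periodic_partial i sW)).
apply/eqP; rewrite -addr_eq0 -cube_integralD//.
rewrite -(cube_integral_partial i (smooth_periodicM sG sW)); apply/eqP.
congr cube_integral; apply/funext => v; apply/esym; apply: partial_eq.
have d1 := smooth_derive v i sG.1; have d2 := smooth_derive v i sW.1.
have -> : partial i G v * wave (freq k) A B v + G v * partial i (wave (freq k) A B) v =
    G v *: partial i (wave (freq k) A B) v + wave (freq k) A B v *: partial i G v.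
  by rewrite /GRing.scale /=; ring.
exact: (is_deriveM d1 d2).
Qed.

Lemma cos_coef_partial n (G : 'rV[R]_n -> R) k i : smooth_periodic G ->
  cos_coef (partial i G) k = freq k 0 i * sin_coef G k.
Proof.
move=> sG; rewrite /cos_coef coef_wave_partial// partial_wave coef_wave.
  by rewrite mulr0 mul0r add0r mulr1 mulNr opprK.
exact: smooth_periodic_cperiodic.
Qed.

Lemma sin_coef_partial n (G : 'rV[R]_n -> R) k i : smooth_periodic G ->
  sin_coef (partial i G) k = - (freq k 0 i * cos_coef G k).
Proof.
move=> sG; rewrite /sin_coef coef_wave_partial// partial_wave coef_wave.
  by rewrite mulr0 oppr0 mul0r addr0 mulr1.
exact: smooth_periodic_cperiodic.
Qed.

End TrigonometricSystem.

(** * Uniqueness of Fourier coefficients *)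

Section Uniqueness.
Variable R : realType.

(** Finitely many translates of [phi] have a sum bounded below by a positive constant,
    and they all have the same integral. *)
Lemma cube_integral_gt0 n (phi : 'rV[R]_n -> R) a : cperiodic phi ->
  (forall v, 0 <= phi v) -> 0 < phi a -> 0 < cube_integral phi.
Proof.
move=> pphi phi0 phia.
have [d d0 hd] := (cont_epsP _ phi).1 (pphi.1 a) (phi a / 2) ltac:(lra).
(* The translates are taken along a grid of mesh smaller than [d]. *)
have [N hN] : exists N, d^-1 < N.+1%:R.
  exists (Num.truncn d^-1); exact: truncnS_gt.
have N0 : 0 < N.+1%:R :> R by rewrite ltr0n.
pose sh (f : {ffun 'I_n -> 'I_N.+1}) : 'rV[R]_n := \row_i ((f i)%:R / N.+1%:R).
have lower v : phi a / 2 <= \sum_f phi (v + sh f).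
  have [k hk] := reduce_mod1 (a - v).
  pose w : 'rV[R]_n := a - v + int_vec R k; rewrite -/w in hk.
  have cell i := truncn_cell (ltn0Sn N) (hk i).
  pose f : {ffun 'I_n -> 'I_N.+1} := [ffun i => Ordinal (cell i).1].
  rewrite (bigD1 f)//=.
  apply: (@le_trans _ _ (phi (v + sh f))); last by rewrite lerDl sumr_ge0.
  have : `|phi (v + sh f - int_vec R k) - phi a| < phi a / 2.
    apply: hd; apply/norm_ltP => // i.
    have -> : (v + sh f - int_vec R k - a) 0 i = sh f 0 i - w 0 i.
      by rewrite /w !mxE; ring.
    have [_ /andP[z1 z2]] := cell i; apply: (@lt_le_trans _ _ N.+1%:R^-1).
      rewrite mxE ffunE /=; move: (_^-1) (_%:R / _) z1 z2 => e' q z1 z2.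
      by rewrite ler0_norm; lra.
    by rewrite -[leRHS]invrK lef_pV2 ?posrE ?invr_gt0// ltW.
  rewrite -int_vecN pphi.2 ltr_norml => /andP[? _]; lra.
have pS := @cperiodic_sum R n _ (index_enum {ffun 'I_n -> 'I_N.+1})
  (fun f v => phi (v + sh f)) (fun f => periodic_shift (sh f) pphi).
have := cube_integral_le (cperiodic_cst n (phi a / 2)) pS lower.
rewrite cube_integral_cst cube_integral_sum; last by move=> f; exact: periodic_shift.
rewrite (eq_bigr (fun=> cube_integral phi)); last first.
  by move=> f _; exact: cube_integral_shift.
rewrite sumr_const => h.
have : 0 < cube_integral phi *+ #|{ffun 'I_n -> 'I_N.+1}| by apply: lt_le_trans h; lra.
case: (#|_|) => [|k]; first by rewrite mulr0n ltxx.
by rewrite pmulrn_lgt0.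
Qed.

(** Multipliers preserving the vanishing of all Fourier coefficients. *)
Definition annihilates n (G T : 'rV[R]_n -> R) := cperiodic T /\
  forall k A B, cube_integral (fun v => G v * T v * wave (freq R k) A B v) = 0.

Section Annihilator.
Variables (n : nat) (G : 'rV[R]_n -> R).
Hypothesis pG : cperiodic G.

Lemma annihilatesD T1 T2 : annihilates G T1 -> annihilates G T2 ->
  annihilates G (fun v => T1 v + T2 v).
Proof.
move=> [p1 h1] [p2 h2]; split=> [|k A B]; first exact: cperiodicD.
have pw := cperiodic_wave k A B.
have q1 := cperiodicM (cperiodicM pG p1) pw.
have := cube_integralD q1 (cperiodicM (cperiodicM pG p2) pw).
rewrite h1 h2 addr0 => <-; congr cube_integral; apply/funext => v; ring.
Qed.

Lemma annihilatesZ c T : annihilates G T -> annihilates G (fun v => c * T v).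
Proof.
move=> [p h]; split=> [|k A B]; first exact: cperiodicZ.
have := cube_integralZ c (cperiodicM (cperiodicM pG p) (cperiodic_wave k A B)).
rewrite h mulr0 => <-; congr cube_integral; apply/funext => v; ring.
Qed.

Lemma annihilates_wave (l : 'rV[int]_n) C D T : annihilates G T ->
  annihilates G (fun v => wave (freq R l) C D v * T v).
Proof.
move=> [p h]; split=> [|k A B]; first by apply: cperiodicM => //; exact: cperiodic_wave.
have E v : G v * (wave (freq R l) C D v * T v) * wave (freq R k) A B v =
    G v * T v * (wave (freq R l) C D v * wave (freq R k) A B v) by ring.
under eq_fun do rewrite E waveM -freqN -!freqD [_ * (_ + _)]mulrDr.
rewrite cube_integralD ?h ?addr0//.
- by apply: cperiodicM; [exact: cperiodicM|exact: cperiodic_wave].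
- by apply: cperiodicM; [exact: cperiodicM|exact: cperiodic_wave].
Qed.

Lemma annihilates_sum (J : Type) (s : seq J) (T : J -> 'rV[R]_n -> R) :
  (forall j, annihilates G (T j)) -> annihilates G (fun v => \sum_(j <- s) T j v).
Proof.
move=> hT; elim: s => [|j s IH]; last first.
  by under eq_fun do rewrite big_cons; exact: annihilatesD.
under eq_fun do rewrite big_nil.
split=> [|k A B]; first exact: cperiodic_cst.
by under eq_fun do rewrite mulr0 mul0r; rewrite cube_integral_cst.
Qed.

End Annihilator.

Lemma max0_dist (x y : R) : `|Num.max 0 x - Num.max 0 y| <= `|x - y|.
Proof.
case: (leP 0 x) => hx; case: (leP 0 y) => hy //.
- by rewrite subr0 ger0_norm//; apply: le_trans (ler_norm _); lra.
- by rewrite sub0r normrN ger0_norm// distrC; apply: le_trans (ler_norm _); lra.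
- by rewrite subrr normr0.
Qed.

Lemma two_pi_itv (r : R) : 0 <= r -> r <= 2^-1 -> 2 * pi * r \in `[0, pi].
Proof.
have pi0 := pi_gt0 R; move=> r0 r1.
rewrite in_itv/= !mulr_ge0 ?(ltW pi0)//= -mulrA mulrCA ler_piMr ?(ltW pi0)//; lra.
Qed.

Lemma cos_close_int (s eta : R) : 0 < eta -> eta <= 2^-1 ->
  cos (2 * pi * eta) < cos (2 * pi * s) -> exists m : int, `|s - m%:~R| < eta.
Proof.
move=> e0 e1 h; have pi0 := pi_gt0 R.
pose m := Num.floor (s + 2^-1); exists m.
have /andP[m1 m2] := floor_itv (s + 2^-1).
rewrite -/m in m1 m2; rewrite intrD1 in m2.
have hs : `|s - m%:~R| <= 2^-1 by rewrite ler_norml; apply/andP; split; lra.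
have r0 := normr_ge0 (s - m%:~R).
rewrite -(@ltr_pM2l _ (2 * pi)); last by rewrite mulr_gt0.
rewrite -(ltr_cos (two_pi_itv r0 hs) (two_pi_itv (ltW e0) e1)).
suff -> : cos (2 * pi * `|s - m%:~R|) = cos (2 * pi * s) by [].
have -> : cos (2 * pi * `|s - m%:~R|) = cos (2 * pi * (s - m%:~R)).
  by case: (ler0P (s - m%:~R)) => // _; rewrite mulrN cosN.
rewrite mulrBr cosB cos_int sin_int mulr1 mulr0 addr0//.
Qed.

(** If [G a > 0], a trigonometric polynomial [q] that exceeds 1 only near [a] modulo
    the integer lattice has powers concentrating there, which contradicts that [G] is
    orthogonal to all of them. *)
Lemma fourier_uniqueness_le0 n (G : 'rV[R]_n -> R) a : cperiodic G ->
  (forall k A B, cube_integral (fun v => G v * wave (freq R k) A B v) = 0) -> G a <= 0.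
Proof.
move=> pG hG; rewrite leNgt; apply/negP => Ga.
have [M M0 hM] := periodic_bounded pG.
have [d d0 hd] := (cont_epsP _ G).1 (pG.1 a) (G a / 2) ltac:(lra).
pose eta : R := Num.min (d / 2) 4^-1.
have eta0 : 0 < eta by rewrite lt_min; apply/andP; split; lra.
have eta1 : eta <= 4^-1 by rewrite ge_min lexx orbT.
have etad : eta <= d / 2 by rewrite ge_min lexx.
have pi0 := pi_gt0 R.
have cos1 : cos (2 * pi * eta) < 1.
  have half0 : 0 <= 2^-1 :> R by rewrite invr_ge0.
  have := ltr_cos (two_pi_itv (lexx 0) half0) (two_pi_itv (ltW eta0) ltac:(lra)).
  by rewrite mulr0 cos0 => ->; rewrite !mulr_gt0.
have cosm1 := cos_geN1 (2 * pi * eta).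
(* [m] exceeds the number of coordinates, which keeps [q] nonnegative; [eps] is so small that
   [q v >= 1] forces every [1 - cosi i v] below its value at distance [eta]. *)
pose m : R := n.+1%:R.
have m1 : 1 <= m by rewrite ler1n.
have m0 : 0 < m by rewrite ltr0n.
pose eps : R := (1 - cos (2 * pi * eta)) / (4 * m).
have eps0 : 0 < eps by rewrite divr_gt0 ?subr_gt0 ?mulr_gt0.
have eps1 : eps <= 1 by rewrite ler_pdivrMr ?mulr_gt0//; lra.
have epsE : 2 * m * eps = (1 - cos (2 * pi * eta)) / 2.
  by rewrite /eps; field; rewrite gt_eqF.
pose e_ i : 'rV[int]_n := delta_mx 0 i.
pose cosi i (v : 'rV[R]_n) : R := cos (2 * pi * (v 0 i - a 0 i)).
pose q (v : 'rV[R]_n) : R := 1 + eps - \sum_i (2 * m)^-1 * (1 - cosi i v).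
have cosiE i : cosi i = wave (freq R (e_ i)) (cos (2 * pi * a 0 i)) (sin (2 * pi * a 0 i)).
  apply/funext => v; rewrite /cosi /wave.
  have -> : dot (freq R (e_ i)) v = 2 * pi * v 0 i.
    rewrite dotZl; congr (_ * _); rewrite -[RHS]dot_delta dotC; congr dot.
    by apply/rowP => j; rewrite !mxE; case: (_ && _).
  by rewrite mulrBr cosB mulrC (mulrC (sin _)).
have pcosi i : cperiodic (cosi i) by rewrite cosiE; exact: cperiodic_wave.
have qE : q = (fun v => (1 + eps) * 1 + -1 * \sum_i ((2 * m)^-1 * 1 +
     (- (2 * m)^-1) * (cosi i v * 1))).
  apply/funext => v; rewrite /q mulr1 mulN1r; congr (_ - _).
  by apply: eq_bigr => i _; rewrite !mulr1 mulrBr mulr1 mulNr.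
have pq : cperiodic q.
  rewrite qE; apply: cperiodicD; first exact: cperiodic_cst.
  apply: cperiodicZ; apply: cperiodic_sum => i; apply: cperiodicD; first exact: cperiodic_cst.
  by apply: cperiodicZ; apply: cperiodicM => //; exact: cperiodic_cst.
have aq T : annihilates G T -> annihilates G (fun v => q v * T v).
  move=> aT; have -> : (fun v => q v * T v) = (fun v => (1 + eps) * T v +
     -1 * \sum_i ((2 * m)^-1 * T v + (- (2 * m)^-1) * (cosi i v * T v))).
    apply/funext => v; rewrite /q mulrDl mulN1r mulNr; congr (_ - _).
    rewrite mulr_suml; apply: eq_bigr => i _; ring.
  apply: annihilatesD => //; first exact: annihilatesZ.
  apply: annihilatesZ => //; apply: annihilates_sum => // i.
  apply: annihilatesD => //; apply: annihilatesZ => //.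
  by rewrite cosiE; exact: annihilates_wave.
have aqN N : annihilates G (fun v => q v ^+ N).
  elim: N => [|N IH].
    split=> [|k A B]; first exact: cperiodic_cst.
    by under eq_fun do rewrite expr0 mulr1; exact: hG.
  by under eq_fun do rewrite exprS; exact: aq.
have IqN N : cube_integral (fun v => G v * q v ^+ N) = 0.
  rewrite -((aqN N).2 0 1 0); congr cube_integral; apply/funext => v.
  by rewrite wave0 mulr1.
have cosile i v : 0 <= 1 - cosi i v <= 2.
  have := cos_le1 (2 * pi * (v 0 i - a 0 i)); have := cos_geN1 (2 * pi * (v 0 i - a 0 i)).
  by rewrite /cosi => ? ?; apply/andP; split; lra.
have q_ge0 v : 0 <= q v.
  rewrite /q subr_ge0; apply: (@le_trans _ _ (\sum_(i < n) m^-1)).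
    apply: ler_sum => i _; rewrite invfM mulrAC ler_piMl ?invr_ge0 ?(ltW m0)//.
    by have /andP[? ?] := cosile i v; lra.
  rewrite sumr_const card_ord -[_ *+ _]mulr_natl ler_pdivrMr//.
  by rewrite mulrDl mul1r /m -natr1 -addrA lerDl; rewrite addr_ge0// mulr_ge0// ltW.
have qa : q a = 1 + eps.
  rewrite /q big1 ?subr0// => i _.
  by rewrite /cosi subrr mulr0 cos0 subrr mulr0.
have q_le v : q v <= 1 + eps.
  rewrite /q gerBl; apply: sumr_ge0 => i _.
  by have /andP[? _] := cosile i v; rewrite mulr_ge0// invr_ge0 mulr_ge0// ltW.
have q_large v : 1 <= q v -> G a / 2 <= G v.
  move=> qv.
  have hi i : exists k : int, `|v 0 i - a 0 i - k%:~R| < eta.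
    apply: cos_close_int => //; first lra.
    rewrite -/(cosi i v).
    have : (2 * m)^-1 * (1 - cosi i v) <= eps.
      apply: (@le_trans _ _ (\sum_i (2 * m)^-1 * (1 - cosi i v))).
        rewrite (bigD1 i)//= lerDl; apply: sumr_ge0 => j _.
        by have /andP[? _] := cosile j v; rewrite mulr_ge0// invr_ge0 mulr_ge0// ltW.
      by move: qv; rewrite /q; lra.
    rewrite mulrC ler_pdivrMr ?mulr_gt0// mulrC epsE; lra.
  have [k hk] := choice hi.
  have : `|G (v - int_vec R (\row_i k i)) - G a| < G a / 2.
    apply: hd; apply/norm_ltP => // i; rewrite !mxE addrAC.
    by apply: lt_le_trans (hk i) _; lra.
  by rewrite -int_vecN pG.2 ltr_norml => /andP[? _]; lra.
pose phi (v : 'rV[R]_n) : R := Num.max 0 (q v - (1 + eps / 2)).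
have pphi : cperiodic phi.
  split=> [v|v k]; last by rewrite /phi pq.2.
  apply/cont_epsP => e e0; have [d' d'0 hd'] := (cont_epsP _ q).1 (pq.1 v) e e0.
  exists d' => // w /hd'; apply: le_lt_trans; rewrite /phi.
  have -> : q w - q v = (q w - (1 + eps / 2)) - (q v - (1 + eps / 2)) by ring.
  exact: max0_dist.
have phi0 v : 0 <= phi v by rewrite /phi le_max lexx.
have phia : 0 < phi a by rewrite /phi lt_max qa; apply/orP; right; lra.
have Iphi := cube_integral_gt0 pphi phi0 phia.
have phi1 v : phi v <= 1.
  by rewrite /phi ge_max ler01 /=; have := q_le v; lra.
(* The integral of [G * q ^+ N] vanishes, but where [q >= 1 + eps / 2] the integrand grows
   exponentially with [N], and elsewhere it is at least [- M]. *)
have key N : G a / 2 * (1 + eps / 2) ^+ N * cube_integral phi <= M.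
  rewrite -subr_le0 -(IqN N) -cube_integralZ// -{1}(cube_integral_cst n M).
  rewrite -cube_integralB//; [|exact: cperiodicZ|exact: cperiodic_cst].
  apply: cube_integral_le.
  - by apply: periodicB; [exact: cperiodicZ|exact: cperiodic_cst].
  - by apply: cperiodicM => //; exact: (aqN N).1.
  move=> v; have MG := hM v; rewrite ler_norml in MG; case/andP: MG => MG1 MG2.
  have qN0 : 0 <= q v ^+ N by rewrite exprn_ge0.
  have [q1|q1] := ltP (q v) 1.
    have -> : phi v = 0 by rewrite /phi max_l//; lra.
    rewrite mulr0 sub0r.
    have : q v ^+ N <= 1 by rewrite exprn_ile1// ltW.
    nra.
  have Gv := q_large v q1.
  have [q2|q2] := ltP (q v) (1 + eps / 2).
    have -> : phi v = 0 by rewrite /phi max_l//; lra.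
    rewrite mulr0 sub0r; apply: (@le_trans _ _ 0); first lra.
    by rewrite mulr_ge0//; lra.
  apply: (@le_trans _ _ (G a / 2 * (1 + eps / 2) ^+ N)).
    rewrite lerBlDr; apply: (@le_trans _ _ (G a / 2 * (1 + eps / 2) ^+ N)); last first.
      by rewrite lerDl ltW.
    rewrite ler_piMr//; apply: mulr_ge0; first by rewrite ltW// divr_gt0.
    by rewrite exprn_ge0// addr_ge0// ltW// divr_gt0.
  have e1 : 0 <= 1 + eps / 2 by rewrite addr_ge0// ltW// divr_gt0.
  have G2 : 0 <= G a / 2 by rewrite ltW// divr_gt0.
  apply: ler_pM => //; first exact: exprn_ge0.
  by apply: lerXn2r; rewrite ?nnegrE.
have bern N : 1 + N%:R * (eps / 2) <= (1 + eps / 2) ^+ N.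
  elim: N => [|N IH]; first by rewrite mul0r addr0 expr0.
  rewrite exprS -natr1; apply: (@le_trans _ _ ((1 + eps / 2) * (1 + N%:R * (eps / 2)))).
    have : 0 <= N%:R :> R by []. nra.
  by rewrite ler_pM2l//; lra.
pose c := G a / 2 * (eps / 2) * cube_integral phi.
have c0 : 0 < c by rewrite /c mulr_gt0// mulr_gt0// divr_gt0.
have := key (Num.truncn (M / c)).+1; apply/negP; rewrite -ltNge.
have := truncnS_gt (M / c); rewrite ltr_pdivrMr// => h; apply: lt_le_trans h _.
set N := (Num.truncn _).+1.
have hb := bern N.
have -> : N%:R * c = G a / 2 * cube_integral phi * (N%:R * (eps / 2)) by rewrite /c; ring.
rewrite [leRHS]mulrAC; apply: ler_wpM2l; first by rewrite ltW// mulr_gt0// divr_gt0.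
by apply: le_trans hb; rewrite lerDr.
Qed.

Lemma fourier_uniqueness n (G : 'rV[R]_n -> R) : cperiodic G ->
  (forall k A B, cube_integral (fun v => G v * wave (freq R k) A B v) = 0) ->
  forall v, G v = 0.
Proof.
move=> pG hG v; apply/eqP; rewrite eq_le fourier_uniqueness_le0//=.
rewrite -oppr_le0; apply: (@fourier_uniqueness_le0 n (fun v => - G v)).
  by have := cperiodicZ (-1) pG; under eq_fun do rewrite mulN1r.
move=> k A B; under eq_fun do rewrite mulNr -mulN1r.
rewrite cube_integralZ ?hG ?mulr0//.
by apply: cperiodicM => //; exact: cperiodic_wave.
Qed.

End Uniqueness.

(** * Summable weights on the integer lattice *)

Section LatticeSums.
Variable R : realType.

Definition weight n (v : 'rV[R]_n) : R := \prod_i (1 + v 0 i ^+ 2).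

Lemma weight_ge1 n (v : 'rV[R]_n) : 1 <= weight v.
Proof.
rewrite /weight; elim/big_ind: _ => // [x y x1 y1|i _].
  by rewrite -[1]mulr1 ler_pM.
by rewrite lerDl sqr_ge0.
Qed.

Lemma weight_gt0 n (v : 'rV[R]_n) : 0 < weight v.
Proof. exact: lt_le_trans (weight_ge1 v). Qed.

Lemma sum_inv_sqr N : \sum_(j < N) (1 + (j%:R : R) ^+ 2)^-1 <= 3.
Proof.
suff h : \sum_(j < N.+1) (1 + (j%:R : R) ^+ 2)^-1 <= 3 - 2 / N.+1%:R.
  apply: (@le_trans _ _ (\sum_(j < N.+1) (1 + (j%:R : R) ^+ 2)^-1)).
    by rewrite big_ord_recr /= lerDl invr_ge0 addr_ge0// sqr_ge0.
  by apply: le_trans h _; rewrite gerBl divr_ge0.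
elim: N => [|N IH].
  by rewrite big_ord_recr big_ord0 /= expr0n /= addr0 invr1 add0r; lra.
rewrite big_ord_recr /=; apply: le_trans (lerD IH (lexx _)) _.
rewrite -[N.+2%:R]natr1; set x : R := N.+1%:R.
have x1 : 1 <= x by rewrite /x ler1n.
rewrite -subr_ge0.
have -> : 3 - 2 / (x + 1) - (3 - 2 / x + (1 + x ^+ 2)^-1) =
   (2 * (1 + x ^+ 2) - x * (x + 1)) / (x * (x + 1) * (1 + x ^+ 2)).
  by field; rewrite !gt_eqF//; nra.
by rewrite divr_ge0//; [nra | rewrite !mulr_ge0//; nra].
Qed.

Lemma abs_sum_le_int : abs_sum_le (fun m : int => (1 + (m%:~R : R) ^+ 2)^-1) 6.
Proof.
move=> A uA; pose N := (\max_(m <- A) `|m|%N).+1.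
pose F (m : int) := `|(1 + (m%:~R : R) ^+ 2)^-1|.
have FE m : F m = (1 + (m%:~R : R) ^+ 2)^-1.
  by rewrite /F ger0_norm// invr_ge0 addr_ge0// sqr_ge0.
pose B := map Posz (iota 0 N) ++ map Negz (iota 0 N).
have uB : uniq B.
  have hP : injective Posz by move=> ? ? [].
  have hN : injective Negz by move=> ? ? [].
  rewrite cat_uniq (map_inj_uniq hP) (map_inj_uniq hN) !iota_uniq andbT andTb.
  by apply/hasPn => _ /mapP[m _ ->]; apply/mapP => -[].
have sAB : {subset A <= B}.
  move=> m mA; have mN : (`|m| < N)%N by rewrite ltnS (leq_bigmax_seq (F := absz)).
  rewrite mem_cat; case: m mA mN => m mA mN; apply/orP; [left|right].
    by apply/mapP; exists m => //; rewrite mem_iota add0n.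
  by apply/mapP; exists m => //; rewrite mem_iota add0n; exact: ltnW.
apply: (@le_trans _ _ (\sum_(m <- B) F m)).
  rewrite (sum_split_seq F uA uB sAB) lerDl.
  by apply: sumr_ge0 => m _; exact: normr_ge0.
rewrite big_cat !big_map /=.
have E (G : nat -> R) : \sum_(j <- iota 0 N) G j = \sum_(j < N) G j.
  by rewrite -(big_mkord xpredT G) /index_iota subn0.
rewrite !E; have -> : 6 = 3 + 3 :> R by ring.
apply: lerD; apply: le_trans (sum_inv_sqr N); apply: ler_sum => j _; rewrite FE //.
rewrite lef_pV2 ?posrE ?ltr_wpDr ?sqr_ge0// lerD2l NegzE mulrNz sqrrN.
by apply: lerXn2r; rewrite ?nnegrE// ler_nat.
Qed.

(** The weights factor over the coordinates, so that the sum over a box is a power of a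
    one-dimensional sum. *)
Lemma abs_sum_le_weight n :
  abs_sum_le (fun k : 'rV[int]_n => (weight (int_vec R k))^-1) (6 ^+ n).
Proof.
move=> K uK.
pose y (m : int) : R := (1 + (m%:~R : R) ^+ 2)^-1.
have y0 m : 0 <= y m by rewrite invr_ge0 addr_ge0// sqr_ge0.
pose w (k : 'rV[int]_n) := [seq k 0 i | i <- enum 'I_n].
have w_inj : injective w.
  move=> k l /eq_in_map h; apply/rowP => i.
  by apply: h; rewrite mem_enum.
pose A := undup (flatten (map w K)).
have uA : uniq A by exact: undup_uniq.
have sK : {subset map w K <= words A n}.
  move=> _ /mapP[k kK ->]; rewrite mem_words size_map size_enum_ord eqxx /=.
  apply/allP => m mk /=; rewrite mem_undup; apply/flattenP; exists (w k) => //.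
  exact: map_f.
have E k : `|(weight (int_vec R k))^-1| = \prod_(m <- w k) y m.
  rewrite ger0_norm; last by rewrite invr_ge0 ltW// weight_gt0.
  rewrite /weight big_map -prodfV big_enum /=; apply: eq_bigr => i _.
  by rewrite mxE.
rewrite (eq_bigr _ (fun k _ => E k)) -(big_map w xpredT (fun s => \prod_(m <- s) y m)).
apply: (@le_trans _ _ (\sum_(s <- words A n) \prod_(m <- s) y m)).
  have uwK : uniq (map w K) by rewrite map_inj_uniq.
  rewrite (sum_split_seq _ uwK (words_uniq n uA) sK) lerDl.
  by apply: sumr_ge0 => s _; apply: prodr_ge0.
rewrite sum_words; apply: lerXn2r; rewrite ?nnegrE ?sumr_ge0//.
apply: le_trans (abs_sum_le_int uA); apply: ler_sum => m _; exact: ler_norm.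
Qed.

End LatticeSums.

(** * Fourier series of smooth periodic functions *)

Section FourierSeries.
Variables (R : realType) (n : nat).
Implicit Types G : 'rV[R]_n -> R.
Local Notation freq := (freq R).

(** The operator that multiplies the coefficient at [k] by [1 + (freq k)_i ^ 2]. *)
Definition one_minus_dii i G : 'rV[R]_n -> R :=
  fun v => G v - partial i (partial i G) v.

Lemma smooth_periodic_one_minus_dii i G : smooth_periodic G ->
  smooth_periodic (one_minus_dii i G).
Proof.
move=> sG; have s2 := smooth_periodic_partial i (smooth_periodic_partial i sG).
have := smooth_periodicD sG (smooth_periodicM (smooth_periodic_cst n (-1)) s2).
by under eq_fun do rewrite mulN1r.
Qed.

Lemma coef_one_minus_dii i G (k : 'rV[int]_n) A B : smooth_periodic G ->
  cube_integral (fun v => one_minus_dii i G v * wave (freq k) A B v) =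
  (1 + freq k 0 i ^+ 2) * cube_integral (fun v => G v * wave (freq k) A B v).
Proof.
move=> sG; have s1 := smooth_periodic_partial i sG.
have s2 := smooth_periodic_partial i s1.
rewrite /one_minus_dii; under eq_fun do rewrite mulrBl.
have cp G' : smooth_periodic G' -> cperiodic (fun v => G' v * wave (freq k) A B v).
  by move=> /smooth_periodic_cperiodic pG'; apply: cperiodicM => //; exact: cperiodic_wave.
rewrite cube_integralB; [|exact: cp..].
rewrite [X in _ - X]coef_wave; last exact: smooth_periodic_cperiodic.
rewrite coef_wave; last exact: smooth_periodic_cperiodic.
rewrite !cos_coef_partial// !sin_coef_partial// !cos_coef_partial//.
by ring.
Qed.

Lemma wave_le (k : 'rV[R]_n) A B v : `|wave k A B v| <= `|A| + `|B|.
Proof.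
rewrite /wave; apply: le_trans (ler_normD _ _) _.
rewrite !normrM; apply: lerD; rewrite ler_piMr// ler_norml.
  by rewrite cos_geN1 cos_le1.
by rewrite sin_geN1 sin_le1.
Qed.

(** Repeated integration by parts in each coordinate. *)
Lemma coef_decay G : smooth_periodic G -> exists2 M, 0 <= M &
  forall (k : 'rV[int]_n) A B, `|A| + `|B| <= 1 ->
  `|cube_integral (fun v => G v * wave (freq k) A B v)| <= M * (weight (int_vec R k))^-1.
Proof.
move=> sG.
pose H := foldr one_minus_dii G (enum 'I_n).
have [sH HE] : smooth_periodic H /\ forall (k : 'rV[int]_n) A B,
   cube_integral (fun v => H v * wave (freq k) A B v) =
   \prod_(i <- enum 'I_n) (1 + freq k 0 i ^+ 2) *
     cube_integral (fun v => G v * wave (freq k) A B v).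
  rewrite /H; elim: (enum 'I_n) => [|i s [sH IH]] /=.
    by split=> // k A B; rewrite big_nil mul1r.
  split=> [|k A B]; first exact: smooth_periodic_one_minus_dii.
  by rewrite coef_one_minus_dii// IH big_cons mulrA.
have pH := smooth_periodic_cperiodic sH.
have [M M0 hM] := periodic_bounded pH.
exists M; first exact: ltW.
move=> k A B hAB.
rewrite ler_pdivlMr ?weight_gt0//.
have h : `|cube_integral (fun v => H v * wave (freq k) A B v)| <= M.
  apply: cube_integral_norm_le; first by apply: cperiodicM => //; exact: cperiodic_wave.
  move=> v; rewrite normrM -[leRHS]mulr1; apply: ler_pM => //.
  exact: le_trans (wave_le _ _ _ _) hAB.
apply: le_trans h; rewrite HE normrM mulrC ler_wpM2r//.
rewrite ger0_norm; last by apply: prodr_ge0 => i _; rewrite addr_ge0// sqr_ge0.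
rewrite big_enum /= /weight; apply: ler_prod => i _.
rewrite addr_ge0 ?sqr_ge0//= lerD2l freq_coord mxE exprMn ler_peMl ?sqr_ge0//.
(* [2 * pi >= 1] lets the weight be computed at the integer vector itself. *)
have : 2 <= pi := pi_ge2 R.
by move=> h; rewrite exprn_ege1//; lra.
Qed.

Section Series.
Variable G : 'rV[R]_n -> R.
Hypothesis sG : smooth_periodic G.

Let pG := smooth_periodic_cperiodic sG.
Local Notation a := (cos_coef G).
Local Notation b := (sin_coef G).

(** The majorant is a multiple of the inverse weights. *)
Lemma coef_majorant : exists (beta : 'rV[int]_n -> R) (M : R),
  [/\ abs_sum_le beta M, forall k, 0 <= beta k & forall k, `|a k| + `|b k| <= beta k].
Proof.
have [M M0 hM] := coef_decay sG.
exists (fun k => (2 * M) * (weight (int_vec R k))^-1), (`|2 * M| * 6 ^+ n).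
split=> [|k|k].
- exact: (abs_sum_leZ (2 * M) (@abs_sum_le_weight R n)).
- by rewrite !mulr_ge0// invr_ge0 ltW// weight_gt0.
- rewrite -mulrA [2 * _]mulr_natl mulr2n; apply: lerD.
    by apply: hM; rewrite normr1 normr0 addr0.
  by apply: hM; rewrite normr1 normr0 add0r.
Qed.

Definition fourier_term (k : 'rV[int]_n) : 'rV[R]_n -> R := wave (freq k) (a k) (b k).

Lemma coef_even k : a (- k) = a k.
Proof.
by rewrite /cos_coef; congr cube_integral; apply/funext => v;
   rewrite /wave freqN dotNl cosN sinN !mul0r.
Qed.

Lemma coef_odd k : b (- k) = - b k.
Proof.
rewrite /sin_coef -mulN1r -cube_integralZ; last by apply: cperiodicM => //; exact: cperiodic_wave.
by congr cube_integral; apply/funext => v;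
   rewrite /wave freqN dotNl cosN sinN !mul0r !add0r !mul1r mulrN mulN1r.
Qed.

(** Both [l] and [-l] must occur, since their waves span the same space; each contributes one
    half. *)
Lemma coef_fourier_sum (K : seq 'rV[int]_n) (l : 'rV[int]_n) A B :
  uniq K -> l \in K -> - l \in K ->
  cube_integral (fun v => (\sum_(k <- K) fourier_term k v) * wave (freq l) A B v) =
  A * a l + B * b l.
Proof.
move=> uK lK nlK.
under eq_fun do rewrite mulr_suml.
rewrite cube_integral_sum; last by move=> k; apply: cperiodicM; exact: cperiodic_wave.
have E k : cube_integral (fun v => fourier_term k v * wave (freq l) A B v) =
   (if k == - l then (a k * A - b k * B) / 2 else 0) +
   (if k == l then (a k * A + b k * B) / 2 else 0).
  under eq_fun do rewrite /fourier_term waveM -freqN -!freqD.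
  rewrite cube_integralD; [|exact: cperiodic_wave..].
  rewrite !cube_integral_wave addr_eq0 subr_eq0.
  by case: eqP => _; case: eqP => _; rewrite ?mul1r ?mul0r.
rewrite (eq_bigr _ (fun k _ => E k)) big_split /= -!big_mkcond /=.
rewrite -big_filter filter_pred1_uniq// big_seq1 -big_filter filter_pred1_uniq// big_seq1.
by rewrite coef_even coef_odd; field.
Qed.

(** The sum [S] of the series is continuous, and its coefficients are those of [G] because
    the convergence is uniform. *)
Theorem fourier_series v : has_sum (fun k => fourier_term k v) (G v).
Proof.
have [beta [M [hbeta beta0 hcoef]]] := coef_majorant.
have term_le k w : `|fourier_term k w| <= `|beta k|.
  exact: le_trans (wave_le _ _ _ _) (le_trans (hcoef k) (ler_norm _)).
have hS w : abs_sum_le (fun k => fourier_term k w) M.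
  exact: abs_sum_le_trans (fun k => term_le k w) hbeta.
pose S w := usum (fun k => fourier_term k w).
have SP w : has_sum (fun k => fourier_term k w) (S w) := usumP (hS w).
pose SK K w := \sum_(k <- K) fourier_term k w.
have pSK K : cperiodic (SK K) by apply: cperiodic_sum => k; exact: cperiodic_wave.
have S_tail e : 0 < e -> exists2 K : seq 'rV[int]_n, uniq K &
    forall K', uniq K' -> {subset K <= K'} -> forall w, `|S w - SK K' w| <= e.
  move=> e0; have [K uK hK] := abs_sum_tail hbeta e0; exists K => // K' uK' sK w.
  apply: (has_sum_tail uK (SP w)) => // B uB dB.
  by apply: le_trans (hK B uB dB); apply: ler_sum => k _.
have pS : cperiodic S.
  split=> [w|w l].
    apply/cont_epsP => e e0; have [K uK hK] := S_tail (e / 4) ltac:(lra).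
    have [d d0 hd] := (cont_epsP w (SK K)).1 ((pSK K).1 w) (e / 4) ltac:(lra).
    exists d => // z /hd; have := hK K uK (fun _ h => h) w; have := hK K uK (fun _ h => h) z.
    rewrite !ler_norml !ltr_norml => /andP[? ?] /andP[? ?] /andP[? ?].
    apply/andP; split; lra.
  by rewrite /S; congr usum; apply/funext => k; exact: (cperiodic_wave k _ _).2.
have D0 : forall w, G w - S w = 0.
  apply: fourier_uniqueness; first exact: periodicB.
  move=> l A B; under eq_fun do rewrite mulrBl.
  have pw := cperiodic_wave l A B.
  rewrite cube_integralB; [|exact: cperiodicM..].
  rewrite coef_wave//; apply/eqP; rewrite -normr_le0; apply/ler_addgt0Pr => e e0.
  rewrite add0r; pose c := `|A| + `|B| + 1.
  have c0 : 0 < c by rewrite ltr_wpDl// addr_ge0.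
  have [K uK hK] := S_tail (e / c) (divr_gt0 e0 c0).
  pose K' := undup (l :: - l :: K).
  have uK' : uniq K' by exact: undup_uniq.
  rewrite -(@coef_fourier_sum K' l A B)//.
  - have p1 := cperiodicM (pSK K') pw; have p2 := cperiodicM pS pw.
    rewrite -(cube_integralB p1 p2).
    apply: cube_integral_norm_le; first exact: periodicB p1 p2.
    move=> w; rewrite -mulrBl normrM distrC.
    have sK : {subset K <= K'} by move=> k kK; rewrite mem_undup !in_cons kK !orbT.
    have h1 := hK K' uK' sK w.
    apply: (@le_trans _ _ (e / c * c)); last by rewrite divfK// gt_eqF.
    apply: ler_pM => //.
    by apply: le_trans (wave_le _ _ _ _) _; rewrite /c lerDl.
  - by rewrite mem_undup mem_head.
  - by rewrite mem_undup in_cons mem_head orbT.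
by have := D0 v => /eqP; rewrite subr_eq0 => /eqP ->; exact: SP.
Qed.

(** This is the imaginary part of the complex Fourier series of a real function: its terms are
    odd in the frequency. *)
Theorem fourier_series_conj v : has_sum (fun k => wave (freq k) (- b k) (a k) v) 0.
Proof.
have [beta [M [hbeta beta0 hcoef]]] := coef_majorant.
have h : abs_sum_le (fun k => wave (freq k) (- b k) (a k) v) M.
  apply: abs_sum_le_trans hbeta => k; apply: le_trans (wave_le _ _ _ _) _.
  by rewrite normrN addrC; exact: le_trans (hcoef k) (ler_norm _).
have [s hs] := abs_sum_has_sum h.
have neg_bij : bijective (fun k : 'rV[int]_n => - k) by exists -%R => k; rewrite opprK.
have hs2 := has_sumN (has_sum_inj neg_bij hs).
have {}hs2 : has_sum (fun k => wave (freq k) (- b k) (a k) v) (- s).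
  apply: has_sum_eq hs2 => k.
  by rewrite /wave coef_even coef_odd freqN dotNl cosN sinN; ring.
have := has_sum_unique hs hs2 => ss.
suff -> : 0 = s by [].
lra.
Qed.

(** Both tails are dominated by the tail of the majorant, whatever the point. *)
Theorem fourier_series_uniform e : 0 < e -> exists K : seq 'rV[int]_n,
  forall K', uniq K' -> {subset K <= K'} -> forall v,
    `|\sum_(k <- K') fourier_term k v - G v| <= e /\
    `|\sum_(k <- K') wave (freq k) (- b k) (a k) v| <= e.
Proof.
move=> e0; have [beta [M [hbeta beta0 hcoef]]] := coef_majorant.
have [K uK hK] := abs_sum_tail hbeta e0; exists K => K' uK' sK v; split.
  rewrite distrC; apply: (has_sum_tail uK (fourier_series v)) => // B uB dB.
  apply: le_trans (hK B uB dB); apply: ler_sum => k _.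
  exact: le_trans (wave_le _ _ _ _) (le_trans (hcoef k) (ler_norm _)).
rewrite -normrN -sub0r; apply: (has_sum_tail uK (fourier_series_conj v)) => // B uB dB.
apply: le_trans (hK B uB dB); apply: ler_sum => k _.
apply: le_trans (wave_le _ _ _ _) _; rewrite normrN addrC.
exact: le_trans (hcoef k) (ler_norm _).
Qed.

End Series.
End FourierSeries.

(** * Closed subgroups of the torus *)

Section TorusGroup.
Variables (R : realType) (n : nat).
Implicit Types (v w : 'rV[R]_n) (a b z : torus R n).

Lemma to_torusD v w : to_torus (v + w) = to_torus v + to_torus w.
Proof. exact: (@ring_quotient.Quotient.pi_add _ (int_lattice R n)). Qed.

Lemma to_torusN v : to_torus (- v) = - to_torus v.
Proof. exact: (@ring_quotient.Quotient.pi_opp _ (int_lattice R n)). Qed.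

Lemma to_torus0 : to_torus 0 = 0 :> torus R n.
Proof. by rewrite -[0 in LHS](subrr 0) to_torusD to_torusN subrr. Qed.

Lemma to_torusMn v k : to_torus (v *+ k) = to_torus v *+ k.
Proof.
elim: k => [|k IH]; first by rewrite !mulr0n to_torus0.
by rewrite !mulrS to_torusD IH.
Qed.

Lemma to_torus_repr z : to_torus (repr z) = z.
Proof. exact: reprK. Qed.

Lemma to_torus_eq v w : to_torus v = to_torus w <-> exists k, v = w + int_vec R k.
Proof.
have -> : to_torus v = to_torus w <-> v - w \in int_lattice R n.
  rewrite (@ring_quotient.Quotient.idealrBE _ (int_lattice R n)).
  by split=> [h|/eqP//]; apply/eqP.
have -> : (v - w \in int_lattice R n) = (v - w \is a mxOver (@Num.int_num_subdef R)) by [].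
split=> [/mxOverP h|[k E]].
  exists (\row_i Num.floor ((v - w) 0 i)).
  apply/rowP => i; have := h 0 i => /floorK; rewrite !mxE => ->.
  by rewrite addrC subrK.
apply/mxOverP => i j; rewrite E addrAC subrr add0r mxE; exact: intr_int.
Qed.

Lemma to_torus_int v (k : 'rV[int]_n) : to_torus (v + int_vec R k) = to_torus v.
Proof. by apply/to_torus_eq; exists k. Qed.

Lemma repr_to_torus v : exists k : 'rV[int]_n, repr (to_torus v) = v + int_vec R k.
Proof. by apply/to_torus_eq; exact: to_torus_repr. Qed.

Lemma to_torus_continuous : continuous (@to_torus R n).
Proof. exact: pi_continuous. Qed.

(** The covering map is open: the saturation of an open set is the union of its integer
    translates. *)
Lemma to_torus_open (U : set 'rV[R]_n) : open U -> open (@to_torus R n @` U).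
Proof.
move=> oU; rewrite /open /= /quotient_open.
have -> : \pi_(torus R n)%qT @^-1` (@to_torus R n @` U) =
    \bigcup_(k : 'rV[int]_n) ((fun v => v + int_vec R k) @^-1` U).
  apply/seteqP; split=> [v [w Uw /to_torus_eq[k wE]]|v [k _] /= Uv].
    by exists k => //=; rewrite -wE.
  by exists (v + int_vec R k) => //; exact: to_torus_int.
apply: bigcup_open => k _; apply: open_comp => // v _.
apply/cont_epsP => e e0; exists e => // w.
by rewrite opprD addrACA subrr addr0.
Qed.

Lemma torus_continuousP (X : topologicalType) (h : torus R n -> X) :
  continuous (h \o @to_torus R n) -> continuous h.
Proof. by move=> ch; apply/(@quotient_continuous _ _ X h). Qed.

Lemma continuous_addl_torus a : continuous (fun z : torus R n => a + z).
Proof.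
apply: torus_continuousP => v.
have -> : (fun z => a + z) \o @to_torus R n = @to_torus R n \o (fun w => repr a + w).
  by apply/funext => w /=; rewrite to_torusD to_torus_repr.
apply: continuous_comp; last exact: to_torus_continuous.
apply/cont_epsP => e e0; exists e => // w.
by rewrite opprD addrACA subrr add0r.
Qed.

Lemma continuous_opp_torus : continuous (fun z : torus R n => - z).
Proof.
apply: torus_continuousP => v.
have -> : (fun z => - z) \o @to_torus R n = @to_torus R n \o (fun w => - w).
  by apply/funext => w /=; rewrite to_torusN.
apply: continuous_comp; last exact: to_torus_continuous.
apply/cont_epsP => e e0; exists e => // w.
by rewrite -opprD normrN.
Qed.

Definition subgroup (A : set (torus R n)) :=
  [/\ A 0, forall a b, A a -> A b -> A (a + b) & forall a, A a -> A (- a)].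

Lemma subgroupMn A a k : subgroup A -> A a -> A (a *+ k).
Proof.
move=> [A0 AD _] Aa; elim: k => [|k IH]; first by rewrite mulr0n.
by rewrite mulrS; exact: AD.
Qed.

Lemma subgroupMz A a (k : int) : subgroup A -> A a -> A (a *~ k).
Proof.
move=> sA Aa; have [_ _ AN] := sA; case: k => k; first exact: subgroupMn.
by rewrite NegzE mulrNz; apply: AN; exact: (@subgroupMn A a k.+1).
Qed.

Lemma nbhs_addl_torus a z (B : set (torus R n)) :
  nbhs (a + z) B -> nbhs z [set w | B (a + w)].
Proof. by move=> hB; exact: (@continuous_addl_torus a z B hB). Qed.

Lemma closure_subgroup A : subgroup A -> subgroup (closure A).
Proof.
move=> [A0 AD AN]; split.
- exact: subset_closure.
- have h1 a b : A a -> closure A b -> closure A (a + b).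
    move=> Aa cb B /nbhs_addl_torus/cb[w [Aw Bw]]; exists (a + w); split => //.
    exact: AD.
  move=> a b ca cb; have : closure (closure A) (b + a).
    by move=> B /nbhs_addl_torus/ca[w [Aw Bw]]; exists (b + w); split => //; rewrite addrC; exact: h1.
  by rewrite addrC -((closure_id (closure A)).1 (@closed_closure _ A)).
- move=> a ca B hB; have [w [Aw Bw]] := ca _ (continuous_opp_torus hB).
  by exists (- w); split => //; exact: AN.
Qed.

Lemma orbit_subgroup (g : torus R n) : subgroup (range (fun k : int => g *~ k)).
Proof.
split; first by exists 0.
  by move=> _ _ [k _ <-] [l _ <-]; exists (k + l) => //; rewrite mulrzDr.
by move=> _ [k _ <-]; exists (- k) => //; rewrite mulrNz.
Qed.

(** Translates and opposites of the component through 0 are connected and meet it. *)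
Lemma component_subgroup A : subgroup A -> subgroup (connected_component A 0).
Proof.
move=> [A0 AD AN].
have C0 : connected_component A 0 0 by exact: connected_component_refl.
have CA : connected_component A 0 `<=` A by exact: connected_component_sub.
have Ccon : connected (connected_component A 0) by exact: component_connected.
have imcon (h : torus R n -> torus R n) : continuous h ->
    connected (h @` connected_component A 0).
  by move=> ch; apply: connected_continuous_connected => //; exact: continuous_subspaceT.
split => //.
- move=> a b Ca Cb.
  have hsub : (fun z => a + z) @` connected_component A 0 `<=` A.
    by move=> _ [z /CA Az <-]; apply: AD => //; exact: CA.
  apply: (@connected_component_max _ A
    (connected_component A 0 `|` (fun z => a + z) @` connected_component A 0)).
  + by left.
  + by move=> z [/CA//|/hsub].
  + apply: connectedU => //; last by apply: imcon; exact: continuous_addl_torus.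
    by exists a; split => //; exists 0 => //; rewrite addr0.
  + by right; exists b.
- move=> a Ca.
  apply: (@connected_component_max _ A ((fun z => - z) @` connected_component A 0)).
  + by exists 0 => //; rewrite oppr0.
  + by move=> _ [z /CA Az <-]; exact: AN.
  + by apply: imcon; exact: continuous_opp_torus.
  + by exists a.
Qed.

Lemma coset_eq A a b : subgroup A -> A (a - b) ->
  [set a + z | z in A] = [set b + z | z in A].
Proof.
move=> [A0 AD AN] Aab; apply/seteqP; split=> _ [z Az <-].
  by exists (a - b + z); [exact: AD|rewrite addrA addrCA subrr addr0].
exists (- (a - b) + z); first by apply: AD => //; exact: AN.
by rewrite opprB addrA addrCA subrr addr0.
Qed.

Lemma coset_mem A a b : subgroup A -> [set a + z | z in A] = [set b + z | z in A] -> A (a - b).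
Proof.
move=> [A0 AD AN] E; have : [set b + z | z in A] a by rewrite -E; exists 0 => //; rewrite addr0.
by move=> [z Az <-]; rewrite addrAC subrr add0r.
Qed.

(** A closed subgroup of finite index is open: its complement is a finite union of
    closed cosets. *)
Lemma finite_index_open (G K : set (torus R n)) : subgroup K -> closed K ->
  finite_set (cosets G K) -> K `<=` G ->
  exists O : set (torus R n), [/\ open O, K `<=` O & O `&` G `<=` K].
Proof.
move=> sK cK fin KG; have [K0 KD KN] := sK.
pose D := cosets G K `&` [set X | X <> K].
pose C := \bigcup_(X in D) X.
have KE : [set 0 + z | z in K] = K.
  apply/seteqP; split=> [_ [z Kz <-]|z Kz]; first by rewrite add0r.
  by exists z => //; rewrite add0r.
exists (~` C); split.
- rewrite openC; apply: closed_bigcup; first exact: finite_setIl.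
  move=> X [[g Gg <-] _].
  have -> : [set g + k | k in K] = (fun z => - g + z) @^-1` K.
    apply/seteqP; split=> [_ [z Kz <-] /=|z /= Kz]; first by rewrite addKr.
    by exists (- g + z) => //; rewrite addNKr.
  by apply: closed_comp => // z _; exact: continuous_addl_torus.
- move=> z Kz [X [[g Gg <-] XK] [k Kk E]]; apply: XK; rewrite -[RHS]KE.
  apply: coset_eq => //; rewrite subr0.
  have -> : g = z - k by rewrite -E addrK.
  by apply: KD => //; exact: KN.
- move=> z [nC Gz]; apply: contrapT => nK; apply: nC.
  exists [set z + k | k in K]; last by exists 0 => //; rewrite addr0.
  split; first by exists z.
  move=> E; apply: nK; rewrite -[z]subr0; apply: coset_mem => //.
  by rewrite KE.
Qed.

(** If the cyclic group generated by [g] is dense in [G] and [K] is a closed subgroup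
    with [m] cosets in [G], these are the cosets of [0, g, ..., (m-1) g]; the multiples of [g]
    in [K] are those of [m g], and they are dense in [K] because [K] is open in [G]. *)
Lemma cyclic_quotient (g : torus R n) (K : set (torus R n)) m
    (G := closure (range (fun k : int => g *~ k))) :
  subgroup K -> closed K -> K `<=` G -> (cosets G K #= `I_m)%card ->
  K (g *+ m) /\
  forall z B, K z -> nbhs z B -> exists k : int, B ((g *+ m) *~ k).
Proof.
move=> sK cK KG cm; have [K0 KD KN] := sK.
have fin : finite_set (cosets G K) by apply/finite_setP; exists m.
have [W [oW KW WG]] := finite_index_open sK cK fin KG.
have sG : subgroup G by apply: closure_subgroup; exact: orbit_subgroup.
have [G0 GD GN] := sG.
have Gg k : G (g *~ k) by apply: subset_closure; exists k.
have near_orbit z : G z -> exists k : int, K (g *~ k - z).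
  move=> Gz; have : nbhs z [set w | W (- z + w)].
    apply: nbhs_addl_torus; rewrite addNr; apply: open_nbhs_nbhs; split => //.
    exact: KW.
  move=> /Gz[_ [[k _ <-] /= Ok]]; exists k; rewrite addrC; apply: WG; split => //.
  by apply: GD => //; exact: GN.
pose cs (j : nat) := [set g *+ j + z | z in K].
(* Infinitely many multiples of [g] cannot lie in pairwise different cosets. *)
have [q0 [q0_gt0 Kq0]] : exists q, (0 < q)%N /\ K (g *+ q).
  apply: contrapT => hq.
  have inj : {in cs @^-1` cosets G K &, injective cs}.
    have wl i j : cs i = cs j -> (i <= j)%N -> i = j.
      move=> E ij; apply/eqP; rewrite eqn_leq ij /= leqNgt; apply/negP => lij.
      apply: hq; exists (j - i)%N; rewrite subn_gt0 lij; split => //.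
      by rewrite mulrnBr//; apply: coset_mem.
    move=> i j _ _ E; case: (leqP i j) => [|/ltnW] ij; first exact: wl.
    by apply/esym; exact: wl.
  have := finite_preimage inj fin.
  rewrite (_ : cs @^-1` cosets G K = setT); first exact: infinite_nat.
  apply/seteqP; split => // j _ /=; exists (g *+ j) => //.
  exact: (Gg j).
have exq : exists q, (0 < q)%N && `[<K (g *+ q)>].
  by exists q0; rewrite q0_gt0; exact/asboolP.
pose q := ex_minn exq.
have [q_gt0 Kq qmin] : [/\ (0 < q)%N, K (g *+ q) &
    forall j, (0 < j)%N -> K (g *+ j) -> (q <= j)%N].
  rewrite /q; case: ex_minnP => p /andP[p0 /asboolP Kp] pmin; split => // j j0 Kj.
  by apply: pmin; rewrite j0; exact/asboolP.
have mod_q (k : int) : exists2 j : nat, (j < q)%N & K (g *~ k - g *+ j) /\ (j = 0%N -> (q %| k)%Z).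
  have qn0 : (q : int) != 0 by rewrite eqz_nat -lt0n.
  have r0 := modz_ge0 k qn0.
  exists `|(k %% q)%Z|%N.
    by rewrite -ltz_nat gez0_abs// ltz_pmod.
  split; last first.
    by move=> h; apply/dvdz_mod0P/eqP; rewrite -absz_eq0 h.
  have -> : g *~ k - g *+ `|(k %% q)%Z|%N = (g *+ q) *~ (k %/ q)%Z.
    rewrite [g *+ `|_|%N]pmulrn gez0_abs// {1}(divz_eq k q) mulrzDr addrK.
    by rewrite [g *+ q]pmulrn -mulrzA mulrC.
  exact: subgroupMz.
have inj : {in `I_q &, injective cs}.
  have wl i j : (j < q)%N -> cs i = cs j -> (i <= j)%N -> i = j.
    move=> jq E ij; apply/eqP; rewrite eqn_leq ij /= leqNgt; apply/negP => lij.
    have : (q <= j - i)%N.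
      apply: qmin; first by rewrite subn_gt0.
      by rewrite mulrnBr//; apply: coset_mem.
    by rewrite leqNgt (leq_ltn_trans (leq_subr i j)).
  move=> i j; rewrite !inE /= => iq jq E.
  case: (leqP i j) => [|/ltnW] ij; first exact: wl.
  by apply/esym; apply: wl.
have csE : [set cs j | j in `I_q] = cosets G K.
  apply/seteqP; split=> [_ [j _ <-]|_ [z Gz <-]].
    by exists (g *+ j) => //; exact: (Gg j).
  have [k Kk] := near_orbit z Gz; have [j jq [Kj _]] := mod_q k.
  exists j => //; apply: coset_eq => //.
  have -> : g *+ j - z = - (g *~ k - g *+ j) + (g *~ k - z).
    by rewrite opprB addrA subrK.
  by apply: KD => //; exact: KN.
have qm : q = m.
  apply/card_eq_II; apply: card_eq_trans cm; rewrite -csE card_eq_sym.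
  exact: inj_card_eq.
rewrite -qm; split => // z B Kz hB.
have : nbhs z (B `&` W).
  by apply: filterI => //; apply: open_nbhs_nbhs; split => //; exact: KW.
move=> /(KG z Kz)[_ [[k _ <-] [Bk Ok]]].
have Kk : K (g *~ k) by apply: WG.
have [j jq [Kj jk]] := mod_q k.
have j0 : j = 0%N.
  apply/eqP; rewrite -leqn0 leqNgt; apply/negP => j_gt0.
  have : K (g *+ j).
    have -> : g *+ j = - (g *~ k - g *+ j) + g *~ k by rewrite opprB subrK.
    by apply: KD => //; exact: KN.
  by move=> /(qmin j j_gt0); rewrite leqNgt jq.
have /dvdzP[l kE] := jk j0.
by exists l; rewrite pmulrn -mulrzA mulrC -kE.
Qed.

End TorusGroup.

(** * Smooth isomorphisms between subgroups of tori *)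

Section LieIso.
Variables (R : realType) (n r : nat) (A : set (torus R n)).
Variables (Phi : torus R n -> torus R r) (Psi : torus R r -> torus R n).
Hypotheses (sA : subgroup A) (iso : lie_group_iso A Phi Psi).

Lemma iso_phi0 : Phi 0 = 0.
Proof.
have [A0 _ _] := sA; have [PhiD _ _ _ _] := iso.
by apply: (@addrI _ (Phi 0)); rewrite -PhiD// !addr0.
Qed.

Lemma iso_phiN a : A a -> Phi (- a) = - Phi a.
Proof.
have [A0 AD AN] := sA; have [PhiD _ _ _ _] := iso => Aa.
apply: (@addrI _ (Phi a)); rewrite -PhiD//; last exact: AN.
by rewrite !subrr iso_phi0.
Qed.

Lemma iso_phiMn a k : A a -> Phi (a *+ k) = Phi a *+ k.
Proof.
have [PhiD _ _ _ _] := iso => Aa.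
elim: k => [|k IH]; first by rewrite !mulr0n iso_phi0.
by rewrite !mulrS PhiD ?IH//; exact: subgroupMn.
Qed.

Lemma iso_phiMz a (k : int) : A a -> Phi (a *~ k) = Phi a *~ k.
Proof.
move=> Aa; case: k => k; first exact: iso_phiMn.
rewrite NegzE !mulrNz iso_phiN; first by congr (- _); exact: (@iso_phiMn a k.+1).
exact: (@subgroupMn _ _ _ _ k.+1).
Qed.

Lemma iso_psiD x y : Psi (x + y) = Psi x + Psi y.
Proof.
have [A0 AD AN] := sA; have [PhiD PsiK PhiK _ _] := iso.
have [Ax Ex] := PhiK x; have [Ay Ey] := PhiK y.
by rewrite -{1}Ex -{1}Ey -PhiD// PsiK//; exact: AD.
Qed.

(** The local smooth lift of [Phi] pulls a neighbourhood of a point of the target back to a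
    neighbourhood in [A], where density is known. *)
Lemma iso_dense g : A g ->
  (forall z B, A z -> nbhs z B -> exists k : int, B (g *~ k)) ->
  dense (range (fun k : int => Phi g *~ k)).
Proof.
move=> Ag gdense W [x Wx] oW; have [PhiD PsiK PhiK sPhi _] := iso.
have [Ax Ex] := PhiK x.
have [] := sPhi (repr (Psi x)); first by rewrite to_torus_repr.
move=> U [h [oU Ux sh hE]].
have hx : W (to_torus (h (repr (Psi x)))).
  by rewrite -hE ?to_torus_repr// Ex.
have ch : {for repr (Psi x), continuous h}.
  by apply: cont_coord => j; have [] := sh j [::] _ Ux.
have : nbhs (repr (Psi x)) (U `&` (fun w => W (to_torus (h w)))).
  apply: filterI; first exact: open_nbhs_nbhs.
  apply: (ch (fun v => W (to_torus v))).
  apply: (to_torus_continuous (open_nbhs_nbhs _)).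
  by split.
rewrite nbhsE => -[V [oV Vx] VU].
have : nbhs (Psi x) (@to_torus R n @` V).
  apply: open_nbhs_nbhs; split; first exact: to_torus_open.
  by exists (repr (Psi x)) => //; exact: to_torus_repr.
move=> /(gdense _ _ Ax)[k [w Vw wE]].
have [Uw Ww] := VU w Vw.
have Agk : A (g *~ k) by exact: subgroupMz.
exists (Phi g *~ k); split; last by exists k.
by rewrite -iso_phiMz// -wE hE// wE.
Qed.

(** Near 0 the homomorphism [Psi] lifts to a map [G] that is additive, because it is
    additive modulo the lattice and small. Along a coordinate axis, additivity under
    halving makes [G] equal to its derivative at 0; as [Psi] is additive, its values on
    small multiples of the basis vectors determine it. *)
Lemma linear_lift : exists L : 'M[R]_(r, n), forall v, Psi (to_torus v) = to_torus (v *m L).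
Proof.
have [PhiD PsiK PhiK _ sPsi] := iso.
have Psi0 : Psi 0 = 0.
  by apply: (@addrI _ (Psi 0)); rewrite -iso_psiD !addr0.
have PsiMn x k : Psi (x *+ k) = Psi x *+ k.
  elim: k => [|k IH]; first by rewrite !mulr0n.
  by rewrite !mulrS iso_psiD IH.
have [] := sPsi 0 Logic.I => U [h [oU U0 sh hE]].
pose G v := h v - h 0.
have GE v : U v -> Psi (to_torus v) = to_torus (G v).
  move=> Uv; rewrite hE// /G to_torusD to_torusN -(hE 0)// to_torus0 Psi0.
  by rewrite oppr0 addr0.
have [eps eps0 hU] : exists2 e, 0 < e & forall v, `|v| < e -> U v /\ `|G v| < 4^-1.
  have ch : {for 0, continuous h} by apply: cont_coord => j; have [] := sh j [::] _ U0.
  have [d d0 hd] := (cont_epsP _ h).1 ch 4^-1 ltac:(lra).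
  have : nbhs (0 : 'rV[R]_r) U by exact: open_nbhs_nbhs.
  move=> /nbhs_ballP[e /= e0 he].
  exists (Num.min e d); first by rewrite lt_min e0.
  move=> v; rewrite lt_min => /andP[ve vd]; split.
    by apply: he; rewrite mx_norm_ball /ball_ /= sub0r normrN.
  by apply: hd; rewrite subr0.
(* The bound [1 / 4] makes three terms add up to less than 1, so that the integer vector by
   which [G (v + w)] could differ from [G v + G w] is 0. *)
have small_int (k : 'rV[int]_n) : `|int_vec R k| < 1 -> int_vec R k = 0.
  move=> /norm_ltP hk; apply/rowP => i; have := hk ltr01 i; rewrite !mxE.
  rewrite -intr_norm -[1]/(1%:~R) ltr_int => h1.
  suff -> : k 0 i = 0 by rewrite mulr0z.
  by apply/eqP; rewrite -normr_le0 -ltzD1.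
have GD v w : `|v| < eps -> `|w| < eps -> `|v + w| < eps -> G (v + w) = G v + G w.
  move=> /hU[Uv Gv] /hU[Uw Gw] /hU[Uvw Gvw].
  have : to_torus (G (v + w)) = to_torus (G v + G w).
    by rewrite -(GE _ Uvw) (to_torusD v w) iso_psiD (GE _ Uv) (GE _ Uw) -to_torusD.
  move=> /to_torus_eq[k kE].
  have k1 : `|int_vec R k| < 1.
    have -> : int_vec R k = G (v + w) - (G v + G w) by rewrite kE addrC addKr.
    apply: le_lt_trans (ler_normB _ _) _; have := ler_normD (G v) (G w).
    move: Gv Gw Gvw; set a := `|G v|; set b := `|G w|; set c := `|G (v + w)|; lra.
  by rewrite kE small_int// addr0.
pose e_ i : 'rV[R]_r := delta_mx 0 i.
have e_1 i (t : R) : `|t *: e_ i| <= `|t|.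
  apply/norm_leP => // j; rewrite !mxE normrM ler_piMr//.
  by case: (_ && _); rewrite ?normr1 ?normr0.
pose L : 'M[R]_(r, n) := \matrix_(i, j) 'D_(e_ i) (fun w => h w 0 j) 0.
have axis i (t : R) : `|t| < eps -> G (t *: e_ i) = t *: row i L.
  move=> ht; apply/rowP => j; rewrite [RHS]mxE [row _ _ _ _]mxE [L _ _]mxE.
  set l := 'D_(e_ i) (fun w => h w 0 j) 0.
  have dl : is_derive 0 (e_ i) (fun w => h w 0 j) l.
    by have [_ dj] := sh j [::] _ U0; exact: derivableP (dj i).
  pose s k := t / 2 ^+ k.
  have s_lt k : `|s k| < eps.
    rewrite normrM normfV; apply: le_lt_trans ht; rewrite ler_piMr// invf_le1 ?normr_gt0.
      by rewrite ger0_norm ?exprn_ge0// exprn_ege1// ler1n.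
    by rewrite expf_neq0.
  have halve k : G (t *: e_ i) = 2 ^+ k *: G (s k *: e_ i).
    elim: k => [|k ->]; first by rewrite /s expr0 divr1 scale1r.
    have sE : s k *: e_ i = s k.+1 *: e_ i + s k.+1 *: e_ i.
      rewrite -scalerDl /s exprS invfM; congr (_ *: _); lra.
    rewrite sE GD -?sE; try by apply: le_lt_trans (e_1 i _) (s_lt _).
    by rewrite -mulr2n -[G _ *+ 2]scaler_nat scalerA exprS mulrC.
  apply/eqP; rewrite -subr_eq0 -normr_le0; apply/ler_addgt0Pr => e e0; rewrite add0r.
  have e1 : 0 < e / (`|t| + 1) by rewrite divr_gt0// ltr_wpDl.
  have [d d0 hd] := (is_derive_epsP _ _ _ _).1 dl _ e1.
  have [k sk] : exists k, `|s k| < d.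
    exists (Num.truncn (`|t| / d)).+1; set k := _.+1.
    have h1 : `|t| / d < k%:R := truncnS_gt _.
    have h2 : k%:R <= 2 ^+ k :> R by rewrite -natrX ler_nat ltnW// ltn_expl.
    rewrite normrM normfV [X in _ / X]ger0_norm ?exprn_ge0// ltr_pdivrMr ?exprn_gt0//.
    by rewrite mulrC -ltr_pdivrMr//; exact: lt_le_trans h2.
  have := hd _ sk; rewrite add0r; set D := h _ 0 j - h 0 0 j => hD.
  have p0 : 0 < 2 ^+ k :> R by rewrite exprn_gt0.
  have tE : t = 2 ^+ k * s k by rewrite /s mulrC divfK// gt_eqF.
  have -> : G (t *: e_ i) 0 j = 2 ^+ k * D by rewrite (halve k) /G !mxE.
  rewrite {1}tE -mulrA -mulrBr normrM (ger0_norm (ltW p0)).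
  apply: (@le_trans _ _ (e / (`|t| + 1) * `|t|)).
    rewrite {2}tE normrM (ger0_norm (ltW p0)) mulrCA.
    by rewrite ler_wpM2l// ltW.
  by rewrite mulrAC ler_pdivrMr ?ltr_wpDl// ler_wpM2l ?ltW// ltrDl.
exists L => v; rewrite mulmx_sum_row [v in LHS]row_sum_delta.
elim: (index_enum _) => [|i s IH]; first by rewrite !big_nil !to_torus0.
rewrite !big_cons !to_torusD iso_psiD IH; congr (_ + _).
set t := v 0 i; pose N := (Num.truncn (`|t| / eps)).+1.
have N0 : 0 < N%:R :> R by rewrite ltr0n.
have tN : `|t / N%:R| < eps.
  rewrite normrM normfV (ger0_norm (ltW N0)) ltr_pdivrMr// mulrC -ltr_pdivrMr//.
  exact: truncnS_gt.
have tE : t = (t / N%:R) *+ N by rewrite -mulr_natr divfK// gt_eqF.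
have [Ut _] := hU _ (le_lt_trans (e_1 i (t / N%:R)) tN).
by rewrite tE -!scalerMnl to_torusMn PsiMn GE// axis// -to_torusMn.
Qed.

End LieIso.

(** * Complex numbers and complex sums *)

Section ComplexSums.
Variable R : realType.
Local Notation C := R[i].

Lemma cmodM (x y : C) : cmod (x * y) = cmod x * cmod y.
Proof. exact: Normc.normcM. Qed.

Lemma cmod_ge0 (x : C) : 0 <= cmod x.
Proof. by case: x => a b; exact: sqrtr_ge0. Qed.

Lemma cmodE (a b : R) : cmod (a +i* b) = Num.sqrt (a ^+ 2 + b ^+ 2).
Proof. by []. Qed.

Lemma cmod_le (a b : R) : cmod (a +i* b) <= `|a| + `|b|.
Proof.
rewrite cmodE -(@ler_pXn2r _ 2) ?nnegrE ?sqrtr_ge0 ?addr_ge0//.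
rewrite sqr_sqrtr ?addr_ge0 ?sqr_ge0// sqrrD -!normrX !(ger0_norm (sqr_ge0 _)).
by rewrite addrAC lerDl mulrn_wge0// mulr_ge0.
Qed.

Lemma Re_le_cmod (z : C) : `|complex.Re z| <= cmod z.
Proof. by case: z => a b; rewrite cmodE -sqrtr_sqr ler_wsqrtr// lerDl sqr_ge0. Qed.

Lemma Im_le_cmod (z : C) : `|complex.Im z| <= cmod z.
Proof. by case: z => a b; rewrite cmodE -sqrtr_sqr ler_wsqrtr// lerDr sqr_ge0. Qed.

Lemma cmod_e2pi (s : R) : cmod (e2pi s) = 1.
Proof. by rewrite /e2pi cmodE cos2Dsin2 sqrtr1. Qed.

Lemma e2piD (s t : R) : e2pi (s + t) = e2pi s * e2pi t.
Proof.
rewrite /e2pi mulrDr cosD sinD; apply/eqP; rewrite eq_complex /=.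
by apply/andP; split; apply/eqP => //; rewrite addrC.
Qed.

Lemma e2pi_int (m : int) : e2pi (m%:~R : R) = 1.
Proof. by rewrite /e2pi cos_int sin_int. Qed.

Lemma e2pi0 : e2pi (0 : R) = 1.
Proof. by rewrite /e2pi mulr0 cos0 sin0. Qed.

Definition has_csum (I : eqType) (f : I -> C) (s : C) :=
  has_sum (fun i => complex.Re (f i)) (complex.Re s) /\
  has_sum (fun i => complex.Im (f i)) (complex.Im s).

Lemma has_csum_eq (I : eqType) (f g : I -> C) s : f =1 g -> has_csum f s -> has_csum g s.
Proof. by move=> /funext ->. Qed.

Lemma has_csum_unique (I : eqType) (f : I -> C) s t :
  has_csum f s -> has_csum f t -> s = t.
Proof.
move=> [h1 h2] [h3 h4]; move: (has_sum_unique h1 h3) (has_sum_unique h2 h4).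
by case: s {h1 h2}; case: t {h3 h4} => a b c d /= -> ->.
Qed.

Lemma has_csumD (I : eqType) (f g : I -> C) s t :
  has_csum f s -> has_csum g t -> has_csum (fun i => f i + g i) (s + t).
Proof.
move=> [h1 h2] [h3 h4]; split.
  by rewrite raddfD; apply: has_sum_eq (has_sumD h1 h3) => i; rewrite raddfD.
by rewrite raddfD; apply: has_sum_eq (has_sumD h2 h4) => i; rewrite raddfD.
Qed.

Lemma has_csumZ (I : eqType) (f : I -> C) s a :
  has_csum f s -> has_csum (fun i => a * f i) (a * s).
Proof.
move=> [h1 h2]; case: a => a b; case: s h1 h2 => c d /= h1 h2; split => /=.
  apply: has_sum_eq (has_sumB (has_sumZ a h1) (has_sumZ b h2)) => i.
  by case: (f i).
apply: has_sum_eq (has_sumD (has_sumZ a h2) (has_sumZ b h1)) => i.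
by case: (f i).
Qed.

Lemma has_csum_sum (I J : eqType) (r : seq J) (f : J -> I -> C) (s : J -> C) :
  (forall j, has_csum (f j) (s j)) ->
  has_csum (fun i => \sum_(j <- r) f j i) (\sum_(j <- r) s j).
Proof.
move=> h; elim: r => [|j r IH].
  rewrite big_nil; split; apply: has_sum_eq (@has_sum0 R I) => i; by rewrite big_nil.
by rewrite big_cons; apply: has_csum_eq (has_csumD (h j) IH) => i; rewrite big_cons.
Qed.

Lemma has_csum_inj (I J : eqType) (phi : J -> I) (f : I -> C) s :
  bijective phi -> has_csum f s -> has_csum (fun j => f (phi j)) s.
Proof. by move=> b [h1 h2]; split; [exact: (has_sum_inj b h1)|exact: (has_sum_inj b h2)]. Qed.

Lemma has_csum_sumE (I : choiceType) (f : I -> C) (s : C) :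
  has_csum f s -> summability.sum (f : I -> C^o) = s.
Proof.
move=> [h1 h2]; rewrite /summability.sum.
have FF := @totally_filter I.
apply: cvg_lim; first exact: norm_hausdorff.
apply/cvgrPdist_lt => e e0.
have [e1 ee1 e10] : exists2 e1 : R, e = e1%:C & 0 < e1.
  by case: e e0 => a b; rewrite ltcE /= => /andP[/eqP -> a0]; exists a.
have [A hA] := h1 (e1 / 2) ltac:(lra).
have [B hB] := h2 (e1 / 2) ltac:(lra).
exists ([fset i in A] `|` [fset i in B])%fset => //= K /= sK.
have sAK : {subset A <= K}.
  by move=> i iA; apply: (fsubsetP sK); rewrite in_fsetU in_fset_ iA.
have sBK : {subset B <= K}.
  by move=> i iB; apply: (fsubsetP sK); rewrite in_fsetU [X in _ || X]in_fset_ iB orbT.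
have {}hA := hA (enum_fset K) (fset_uniq K) sAK.
have {}hB := hB (enum_fset K) (fset_uniq K) sBK.
have -> : partial_sum (f : I -> C^o) K = \sum_(i <- enum_fset K) f i.
  by rewrite /partial_sum -(big_seq_fsetE _ _ xpredT f).
rewrite ee1 distrC.
set S := \sum_(i <- _) f i.
have E1 : complex.Re (S - s) = \sum_(i <- enum_fset K) complex.Re (f i) - complex.Re s.
  by rewrite raddfB raddf_sum.
have E2 : complex.Im (S - s) = \sum_(i <- enum_fset K) complex.Im (f i) - complex.Im s.
  by rewrite raddfB raddf_sum.
rewrite -E1 in hA; rewrite -E2 in hB.
have -> : `|S - s| = (cmod (S - s))%:C by [].
rewrite ltcR; case: (S - s) hA hB => a b /= hA hB.
by apply: le_lt_trans (cmod_le a b) _; lra.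
Qed.

End ComplexSums.

(** * Rapidly decreasing functions *)

Section RapidDecay.
Variable (R : realType).

Definition rapid d (h : 'rV[R]_d -> R) :=
  forall a : 'I_d -> nat, exists C : R, forall v, `|monomial v a| * `|h v| <= C.

Lemma rapid_sqr d i (h : 'rV[R]_d -> R) : rapid h ->
  rapid (fun v => (1 + v 0 i ^+ 2) * h v).
Proof.
move=> hh a; have [C1 h1] := hh a.
have [C2 h2] := hh (fun j => if j == i then (a j + 2)%N else a j).
exists (C1 + C2) => v.
have E : monomial v (fun j => if j == i then (a j + 2)%N else a j) = v 0 i ^+ 2 * monomial v a.
  rewrite /monomial (bigD1 i)//= eqxx [in RHS](bigD1 i)//= mulrA exprD (mulrC (_ ^+ 2)).
  by congr (_ * _); apply: eq_bigr => j /negbTE ->.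
have := lerD (h1 v) (h2 v); apply: le_trans.
rewrite E (normrM (v 0 i ^+ 2)) (ger0_norm (sqr_ge0 _)) (normrM (1 + v 0 i ^+ 2)).
rewrite (ger0_norm (_ : 0 <= 1 + v 0 i ^+ 2)); last by rewrite addr_ge0// sqr_ge0.
by rewrite le_eqVlt; apply/orP; left; apply/eqP; ring.
Qed.

Lemma rapid_weight d p (h : 'rV[R]_d -> R) : rapid h ->
  exists C, forall v, weight v ^+ p * `|h v| <= C.
Proof.
move=> hh.
have key (s : seq 'I_d) (h' : 'rV[R]_d -> R) : rapid h' ->
    rapid (fun v => \prod_(i <- s) (1 + v 0 i ^+ 2) * h' v).
  elim: s h' => [|i s IH] h' rh'.
    by under eq_fun do rewrite big_nil mul1r.
  under eq_fun do rewrite big_cons -mulrA.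
  by apply: rapid_sqr; exact: IH.
have {key} key : rapid (fun v => weight v ^+ p * h v).
  elim: p => [|p IH]; first by under eq_fun do rewrite expr0 mul1r.
  by under eq_fun do rewrite exprS -mulrA; exact: key.
have [C hC] := key (fun=> 0%N); exists C => v; have := hC v.
rewrite /monomial big1 => [|i _]; last by rewrite expr0.
by rewrite normr1 mul1r normrM ger0_norm// exprn_ge0// ltW// weight_gt0.
Qed.

(** Decay of a function at [v + k] is thus decay in [k], uniformly for [v] in a ball. *)
Lemma weight_shift d (T : R) (v w : 'rV[R]_d) : `|v| <= T ->
  weight w <= (2 + 2 * T ^+ 2) ^+ d * weight (v + w).
Proof.
move=> vT; have T0 : 0 <= T by exact: le_trans vT.
have -> : (2 + 2 * T ^+ 2) ^+ d = \prod_(i < d) (2 + 2 * T ^+ 2).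
  by rewrite prodr_const card_ord.
rewrite /weight -big_split /=; apply: ler_prod => i _.
rewrite addr_ge0 ?sqr_ge0//= mxE.
have hv : v 0 i ^+ 2 <= T ^+ 2.
  rewrite -real_normK ?num_real//; apply: lerXn2r; rewrite ?nnegrE//.
  exact: le_trans (coord_le_norm _ _) vT.
set x := v 0 i in hv *; set y := w 0 i.
have h1 : y ^+ 2 <= 2 * (x + y) ^+ 2 + 2 * x ^+ 2.
  rewrite -subr_ge0; have -> : 2 * (x + y) ^+ 2 + 2 * x ^+ 2 - y ^+ 2 = (2 * x + y) ^+ 2 by ring.
  exact: sqr_ge0.
have h2 : 0 <= T ^+ 2 * (x + y) ^+ 2 by rewrite mulr_ge0// sqr_ge0.
rewrite mulrDl mulrDr mulr1 mulrDr mulr1 -mulrA.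
set X := (x + y) ^+ 2 in h1 h2 *; set Y := y ^+ 2 in h1 *; set Z := x ^+ 2 in h1 hv *.
set W := T ^+ 2 in hv h2 *; lra.
Qed.

Definition schwartz_real d (g : 'rV[R]_d -> R) :=
  smooth g /\ forall s, rapid (partials s g).

Lemma schwartz_Re d (f : 'rV[R]_d -> R[i]) : schwartz f ->
  schwartz_real (fun v => complex.Re (f v)).
Proof.
move=> [s1 s2 dec]; split=> // s a; have [C hC] := dec a s; exists C => v.
apply: le_trans (hC v); rewrite ler_wpM2l//; exact: (Re_le_cmod (partialsC s f v)).
Qed.

Lemma schwartz_Im d (f : 'rV[R]_d -> R[i]) : schwartz f ->
  schwartz_real (fun v => complex.Im (f v)).
Proof.
move=> [s1 s2 dec]; split=> // s a; have [C hC] := dec a s; exists C => v.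
apply: le_trans (hC v); rewrite ler_wpM2l//; exact: (Im_le_cmod (partialsC s f v)).
Qed.

End RapidDecay.

(** * The Zak series *)

Section ZakTerms.
Variables (R : realType) (d : nat).
Implicit Types (g : 'rV[R]_d -> R) (k : 'rV[int]_d) (z : 'rV[R]_(d + d)).

(** The terms of the Zak series and of all its derivatives: at [z = (t, xi)], the real part of
    [(A - i B) e^{2 pi i <xi, k>}] times [g (t + k)]. Differentiating in [t] replaces [g] by a
    derivative, differentiating in [xi] multiplies [A] and [B] by [2 pi k_j]. *)
Definition zak_term k A B g : 'rV[R]_(d + d) -> R :=
  fun z => wave (freq R k) A B (rsubmx z) * g (lsubmx z + int_vec R k).

Lemma lsubmx_mul z : lsubmx z = z *m col_mx 1%:M 0.
Proof. by rewrite -[z in RHS]hsubmxK mul_row_col mulmx1 mulmx0 addr0. Qed.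

Lemma rsubmx_mul z : rsubmx z = z *m col_mx 0 1%:M.
Proof. by rewrite -[z in RHS]hsubmxK mul_row_col mulmx1 mulmx0 add0r. Qed.

Lemma smooth_zak_term k A B g : smooth g -> smooth (zak_term k A B g).
Proof.
move=> sg; apply: smoothM.
  have := smooth_affine 0 (col_mx 0 1%:M : 'M[R]_(d + d, d)) (smooth_wave (freq R k) A B).
  by under eq_fun do rewrite add0r -rsubmx_mul.
have := smooth_affine (int_vec R k) (col_mx 1%:M 0 : 'M[R]_(d + d, d)) sg.
by under eq_fun do rewrite -lsubmx_mul addrC.
Qed.

Lemma sub_delta_lshift (j : 'I_d) :
  lsubmx (delta_mx 0 (lshift d j) : 'rV[R]_(d + d)) = delta_mx 0 j /\
  rsubmx (delta_mx 0 (lshift d j) : 'rV[R]_(d + d)) = 0.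
Proof.
split; apply/rowP => i; rewrite !mxE eqxx /=; first by rewrite eq_lshift.
by rewrite eq_rlshift.
Qed.

Lemma sub_delta_rshift (j : 'I_d) :
  lsubmx (delta_mx 0 (rshift d j) : 'rV[R]_(d + d)) = 0 /\
  rsubmx (delta_mx 0 (rshift d j) : 'rV[R]_(d + d)) = delta_mx 0 j.
Proof.
split; apply/rowP => i; rewrite !mxE eqxx /=; first by rewrite eq_lrshift.
by rewrite eq_rshift.
Qed.

Lemma is_derive_block (G : 'rV[R]_d -> R) (P : 'rV[R]_(d + d) -> 'rV[R]_d) z u w l :
  (forall t : R, P (z + t *: u) = P z + t *: w) -> is_derive (P z) w G l ->
  is_derive z u (fun z => G (P z)) l.
Proof.
move=> hP /is_derive_epsP hG; apply/is_derive_epsP => e e0.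
by have [D D0 hD] := hG e e0; exists D => // t tD; rewrite hP; exact: hD.
Qed.

Lemma partial_zak_term_l k A B g j : smooth g ->
  partial (lshift d j) (zak_term k A B g) = zak_term k A B (partial j g).
Proof.
move=> sg; apply/funext => z; apply: partial_eq.
have [dl dr] := sub_delta_lshift j.
have h1 : is_derive z (delta_mx 0 (lshift d j)) (fun z => wave (freq R k) A B (rsubmx z)) 0.
  apply: (is_derive_block (P := @rsubmx _ 1 d d) (w := 0)).
    by move=> t; rewrite linearD linearZ /= dr !scaler0.
  exact: is_derive0.
have h2 : is_derive z (delta_mx 0 (lshift d j)) (fun z => g (lsubmx z + int_vec R k))
    (partial j g (lsubmx z + int_vec R k)).
  apply: (is_derive_block (P := fun z => lsubmx z + int_vec R k) (w := delta_mx 0 j)).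
    by move=> t; rewrite linearD linearZ /= dl addrAC.
  exact: smooth_derive.
have -> : zak_term k A B (partial j g) z =
  wave (freq R k) A B (rsubmx z) *: partial j g (lsubmx z + int_vec R k)
   + g (lsubmx z + int_vec R k) *: 0 by rewrite scaler0 addr0.
exact: (is_deriveM h1 h2).
Qed.

Lemma partial_zak_term_r k A B g j : smooth g ->
  partial (rshift d j) (zak_term k A B g) =
  zak_term k (freq R k 0 j * B) (- (freq R k 0 j * A)) g.
Proof.
move=> sg; apply/funext => z; apply: partial_eq.
have [dl dr] := sub_delta_rshift j.
have h1 : is_derive z (delta_mx 0 (rshift d j)) (fun z => wave (freq R k) A B (rsubmx z))
    (wave (freq R k) (freq R k 0 j * B) (- (freq R k 0 j * A)) (rsubmx z)).
  apply: (is_derive_block (P := @rsubmx _ 1 d d) (w := delta_mx 0 j)).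
    by move=> t; rewrite linearD linearZ /= dr.
  exact: is_derive_wave.
have h2 : is_derive z (delta_mx 0 (rshift d j)) (fun z => g (lsubmx z + int_vec R k)) 0.
  apply: (is_derive_block (P := fun z => lsubmx z + int_vec R k) (w := 0)).
    by move=> t; rewrite linearD linearZ /= dl !scaler0 !addr0.
  exact: is_derive0.
have -> : zak_term k (freq R k 0 j * B) (- (freq R k 0 j * A)) g z =
  wave (freq R k) A B (rsubmx z) *: 0
   + g (lsubmx z + int_vec R k) *:
     wave (freq R k) (freq R k 0 j * B) (- (freq R k 0 j * A)) (rsubmx z).
  by rewrite scaler0 add0r /zak_term mulrC.
exact: (is_deriveM h1 h2).
Qed.

Lemma freq_le_weight k j : `|freq R k 0 j| <= 2 * pi * weight (int_vec R k).
Proof.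
have pi0 := pi_gt0 R.
rewrite freq_coord normrM ger0_norm; last by rewrite mulr_ge0// ltW.
rewrite ler_wpM2l ?mulr_ge0 ?(ltW pi0)//.
rewrite /weight (bigD1 j)//= mxE.
set x : R := (k 0 j)%:~R.
have h1 : `|x| <= 1 + x ^+ 2.
  rewrite -real_normK ?num_real//; set y := `|x|.
  by rewrite -subr_ge0; nra.
apply: le_trans h1 _; rewrite ler_peMr ?addr_ge0 ?sqr_ge0//.
elim/big_ind: _ => // [a b a1 b1|i _]; first by rewrite -[1]mulr1 ler_pM.
by rewrite lerDl sqr_ge0.
Qed.

Lemma partials_zak_term s A B g : smooth g -> exists (p : nat) (s' : seq 'I_d),
  forall k, exists A' B',
    `|A'| + `|B'| <= (2 * pi * weight (int_vec R k)) ^+ p * (`|A| + `|B|) /\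
    partials s (zak_term k A B g) = zak_term k A' B' (partials s' g).
Proof.
move=> sg; elim: s => [|i s [p [s' IH]]].
  by exists 0%N, [::] => k; exists A, B; rewrite expr0 mul1r.
have [j ->|j ->] /= := split_ordP i.
  exists p, (j :: s') => k; have [A' [B' [hAB E]]] := IH k; exists A', B'; split => //.
  by rewrite E partial_zak_term_l//; exact: smooth_partials.
exists p.+1, s' => k; have [A' [B' [hAB E]]] := IH k.
exists (freq R k 0 j * B'), (- (freq R k 0 j * A')); split.
  rewrite normrN !normrM -mulrDr addrC exprS -mulrA.
  by apply: ler_pM => //; exact: freq_le_weight.
by rewrite E partial_zak_term_r//; exact: smooth_partials.
Qed.

(** Of the [p + 1] powers of the weight gained from the rapid decay of [g], the derivatives in
    the frequency variable consume [p], and one remains for summability over the lattice. *)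
Lemma zak_terms_dominated A B g s (T : R) : schwartz_real g ->
  exists M : 'rV[int]_d -> R, (exists S, abs_sum_le M S) /\
   forall k z, `|z| <= T -> `|partials s (zak_term k A B g) z| <= M k.
Proof.
move=> [sg rg]; have [p [s' hs']] := partials_zak_term s A B sg.
have [C hC] := rapid_weight p.+1 (rg s').
have pi0 : 0 < 2 * pi :> R by rewrite mulr_gt0// pi_gt0.
pose c := (2 + 2 * T ^+ 2) ^+ d.
have c0 : 0 <= c by rewrite exprn_ge0// addr_ge0// mulr_ge0// sqr_ge0.
have C0 : 0 <= C.
  by apply: le_trans (hC 0); rewrite mulr_ge0// exprn_ge0// ltW// weight_gt0.
pose K := (2 * pi) ^+ p * (`|A| + `|B|) * (c ^+ p.+1 * C).
exists (fun k => K * (weight (int_vec R k))^-1); split.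
  by exists (`|K| * 6 ^+ d); exact: (abs_sum_leZ K (@abs_sum_le_weight R d)).
move=> k z zT; have [A' [B' [hAB ->]]] := hs' k.
have lz : `|lsubmx z| <= T.
  apply: le_trans zT; apply/norm_leP => // j; rewrite !mxE; exact: coord_le_norm.
set w := weight (int_vec R k) in hAB *; have w0 : 0 < w by exact: weight_gt0.
set h := partials s' g (lsubmx z + int_vec R k).
have hw : w <= c * weight (lsubmx z + int_vec R k) := weight_shift _ lz.
have hh : w ^+ p.+1 * `|h| <= c ^+ p.+1 * C.
  apply: (@le_trans _ _ ((c * weight (lsubmx z + int_vec R k)) ^+ p.+1 * `|h|)).
    rewrite ler_wpM2r//; apply: lerXn2r; rewrite ?nnegrE ?(ltW w0)//.
    exact: le_trans (ltW w0) hw.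
  have -> : (c * weight (lsubmx z + int_vec R k)) ^+ p.+1 * `|h| =
      c ^+ p.+1 * (weight (lsubmx z + int_vec R k) ^+ p.+1 * `|h|).
    by rewrite exprMn mulrA.
  by apply: ler_wpM2l; [exact: exprn_ge0|exact: hC].
rewrite ler_pdivlMr// /zak_term normrM -/h.
apply: (@le_trans _ _ ((2 * pi * w) ^+ p * (`|A| + `|B|) * `|h| * w)).
  rewrite ler_wpM2r ?(ltW w0)// ler_wpM2r//.
  exact: le_trans (wave_le _ _ _ _) hAB.
rewrite exprMn /K.
have -> : (2 * pi) ^+ p * w ^+ p * (`|A| + `|B|) * `|h| * w =
   (2 * pi) ^+ p * (`|A| + `|B|) * (w ^+ p.+1 * `|h|) by rewrite exprS; ring.
by rewrite ler_wpM2l// mulr_ge0 ?addr_ge0// exprn_ge0// ltW.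
Qed.

Lemma zak_series_smooth A B g : schwartz_real g ->
  smooth (fun z => usum (fun k => zak_term k A B g z)).
Proof.
move=> sg; apply: smooth_series => [k|s T].
  by apply: smooth_zak_term; case: sg.
exact: zak_terms_dominated.
Qed.

Lemma zak_series_has_sum A B g z : schwartz_real g ->
  has_sum (fun k => zak_term k A B g z) (usum (fun k => zak_term k A B g z)).
Proof.
move=> sg.
exact: (@series_partialsP _ _ _ (fun k => zak_term k A B g)
  (fun s T => @zak_terms_dominated A B g s T sg) [::] z).
Qed.

End ZakTerms.

(** * The Zak transform and its functional equation *)

Lemma e2piN_int (R : realType) (m : int) : e2pi (- m%:~R : R) = 1.
Proof. by rewrite -mulrNz e2pi_int. Qed.

Section ZakTransform.
Variables (R : realType) (d : nat) (f : 'rV[R]_d -> R[i]).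
Hypothesis f_schwartz : schwartz f.
Implicit Types (t xi : 'rV[R]_d) (k : 'rV[int]_d) (z : 'rV[R]_(d + d)).

Definition zak_at z : R[i] := zak f (lsubmx z) (rsubmx z).

Let fr v := complex.Re (f v).
Let fi v := complex.Im (f v).

Definition zak_re z := usum (fun k => zak_term k 1 0 fr z) + usum (fun k => zak_term k 0 1 fi z).
Definition zak_im z := usum (fun k => zak_term k 1 0 fi z) + usum (fun k => zak_term k 0 (-1) fr z).

Lemma smooth_zak_re : smooth zak_re.
Proof.
by apply: smoothD; apply: zak_series_smooth; [exact: schwartz_Re|exact: schwartz_Im].
Qed.

Lemma smooth_zak_im : smooth zak_im.
Proof.
by apply: smoothD; apply: zak_series_smooth; [exact: schwartz_Im|exact: schwartz_Re].
Qed.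

Let zak_series z :
  has_csum (fun k => e2pi (- dot (rsubmx z) (int_vec R k)) * f (lsubmx z + int_vec R k))
    (zak_re z +i* zak_im z).
Proof.
have E k : dot (freq R k) (rsubmx z) = 2 * pi * dot (rsubmx z) (int_vec R k).
  by rewrite /freq dotZl dotC.
have hR := schwartz_Re f_schwartz; have hI := schwartz_Im f_schwartz.
split=> /=.
  apply: has_sum_eq (has_sumD (zak_series_has_sum 1 0 z hR) (zak_series_has_sum 0 1 z hI)) => k.
  rewrite /zak_term /wave E /e2pi mulrN cosN sinN /fr /fi.
  by case: (f _) => a b /=; ring.
apply: has_sum_eq (has_sumD (zak_series_has_sum 1 0 z hI) (zak_series_has_sum 0 (-1) z hR)) => k.
rewrite /zak_term /wave E /e2pi mulrN cosN sinN /fr /fi.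
by case: (f _) => a b /=; ring.
Qed.

Lemma zak_atE z : zak_at z = zak_re z +i* zak_im z.
Proof. exact: has_csum_sumE (zak_series z). Qed.

Lemma zak_has_csum z :
  has_csum (fun k => e2pi (- dot (rsubmx z) (int_vec R k)) * f (lsubmx z + int_vec R k))
    (zak_at z).
Proof. by rewrite zak_atE. Qed.

Lemma addr_bij k : bijective (fun l : 'rV[int]_d => l + k).
Proof. by exists (fun l => l - k) => l; [rewrite addrK|rewrite subrK]. Qed.

(** Quasi-periodicity: an integer translation in time is absorbed by reindexing. *)
Lemma zak_at_int z (k : 'rV[int]_(d + d)) :
  zak_at (z + int_vec R k) =
  e2pi (dot (rsubmx z) (int_vec R (lsubmx k))) * zak_at z.
Proof.
have h := zak_has_csum (z + int_vec R k).
apply: has_csum_unique h _.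
have h2 := has_csumZ (e2pi (dot (rsubmx z) (int_vec R (lsubmx k))))
  (has_csum_inj (addr_bij (lsubmx k)) (zak_has_csum z)).
apply: has_csum_eq h2 => l /=.
have El : lsubmx (int_vec R k) = int_vec R (lsubmx k) by apply/rowP => i; rewrite !mxE.
have Er : rsubmx (int_vec R k) = int_vec R (rsubmx k) by apply/rowP => i; rewrite !mxE.
rewrite mulrA -e2piD !linearD /= El Er (addrAC (lsubmx z)) -(addrA (lsubmx z)) -int_vecD.
congr (_ * _).
rewrite dotDl dot_int int_vecD dotDr; set m := \sum_i _.
rewrite -[LHS]mulr1 -(e2pi_int R (- m)) -e2piD mulrNz; congr e2pi; ring.
Qed.

Lemma zak_modulus_to_torus z : zak_modulus f (to_torus z) = cmod (zak_at z).
Proof.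
rewrite /zak_modulus; have [k ->] := repr_to_torus z.
by rewrite -/(zak_at _) zak_at_int cmodM cmod_e2pi mul1r.
Qed.

Lemma zak_modulusE z :
  zak_modulus f (to_torus z) = Num.sqrt (zak_re z ^+ 2 + zak_im z ^+ 2).
Proof. by rewrite zak_modulus_to_torus zak_atE. Qed.

Lemma zak_modulus_ge0 (w : torus R (d + d)) : 0 <= zak_modulus f w.
Proof. exact: cmod_ge0. Qed.

Lemma zak_modulus_continuous : continuous (zak_modulus f).
Proof.
apply: torus_continuousP.
have -> : zak_modulus f \o @to_torus R (d + d) =
   (@Num.sqrt R) \o (fun z => zak_re z * zak_re z + zak_im z * zak_im z).
  by apply/funext => z /=; rewrite zak_modulusE !expr2.
move=> z; apply: continuous_comp; last exact: sqrt_continuous.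
have sr := smooth_zak_re; have si := smooth_zak_im.
exact: (smooth_continuous (smoothD (smoothM sr sr) (smoothM si si))).
Qed.

Section Relation.
Variables (K : nat) (x y : 'I_K -> 'rV[int]_d) (c : 'I_K -> R[i]) (alpha beta : 'rV[R]_d).
Hypothesis f_dep : forall t,
  \sum_k c k * modulation (int_vec R (y k)) (translation (int_vec R (x k)) f) t
  = modulation beta (translation alpha f) t.

Let gamma0 : 'rV[R]_(d + d) := row_mx (- alpha) beta.
Let gamma : torus R (d + d) := to_torus gamma0.

Definition trig_at z : R[i] :=
  \sum_k c k * e2pi (- dot (int_vec R (y k)) (lsubmx z)) *
               e2pi (- dot (rsubmx z) (int_vec R (x k))).

Lemma trig_poly_to_torus z : trig_poly c x y (to_torus z) = trig_at z.
Proof.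
rewrite /trig_poly /trig_at; have [k ->] := repr_to_torus z.
apply: eq_bigr => j _.
have El : lsubmx (int_vec R k) = int_vec R (lsubmx k) by apply/rowP => i; rewrite !mxE.
have Er : rsubmx (int_vec R k) = int_vec R (rsubmx k) by apply/rowP => i; rewrite !mxE.
rewrite !linearD /= El Er dotDr dotDl !dot_int !opprD !e2piD.
by rewrite !e2piN_int !mulr1.
Qed.

(** Summing the relation over integer translates: translations by lattice vectors and
    integer modulations become multiplications. *)
Lemma zak_relation z : trig_at z * zak_at z =
  e2pi (- dot beta (lsubmx z)) * zak_at (z + gamma0).
Proof.
pose T (l : 'rV[int]_d) : R[i] :=
  e2pi (- dot (rsubmx z) (int_vec R l)) *
  modulation beta (translation alpha f) (lsubmx z + int_vec R l).
have h1 : has_csum T (e2pi (- dot beta (lsubmx z)) * zak_at (z + gamma0)).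
  apply: has_csum_eq (has_csumZ _ (zak_has_csum (z + gamma0))) => l.
  rewrite /T /modulation /translation /gamma0 !linearD /= row_mxKl row_mxKr.
  rewrite !mulrA -!e2piD; congr (e2pi _ * f _); last by rewrite addrAC.
  by rewrite dotDl dotDr; ring.
have h2 : has_csum T (trig_at z * zak_at z).
  rewrite /trig_at mulr_suml.
  apply: has_csum_eq (has_csum_sum (index_enum 'I_K) (fun j => has_csumZ
    (c j * e2pi (- dot (int_vec R (y j)) (lsubmx z)) * e2pi (- dot (rsubmx z) (int_vec R (x j))))
    (has_csum_inj (addr_bij (- x j)) (zak_has_csum z)))) => l.
  rewrite /T -f_dep mulr_sumr; apply: eq_bigr => j _.
  rewrite /modulation /translation int_vecD int_vecN.
  rewrite (addrA (lsubmx z)).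
  rewrite (dotDr (int_vec R (y j))) dot_int opprD (e2piD (- dot _ (lsubmx z))).
  rewrite e2piN_int mulr1 dotDr dotNr opprD opprK e2piD.
  set E := e2pi (- dot (rsubmx z) (int_vec R (x j))); set b := e2pi (dot _ _).
  have Eb : E * b = 1 by rewrite /E /b -e2piD addNr e2pi0.
  set a := e2pi (- dot (rsubmx z) (int_vec R l)); set F := f _.
  set D := e2pi (- dot (int_vec R (y j)) (lsubmx z)).
  have -> : c j * D * E * (a * b * F) = c j * D * a * F * (E * b) by ring.
  by rewrite Eb; ring.
exact: has_csum_unique h2 h1.
Qed.

Lemma zak_modulus_step w :
  zak_modulus f (w + gamma) = cmod (trig_poly c x y w) * zak_modulus f w.
Proof.
rewrite -(to_torus_repr w) -to_torusD !zak_modulus_to_torus trig_poly_to_torus.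
by rewrite -cmodM zak_relation cmodM cmod_e2pi mul1r.
Qed.

Lemma zak_modulus_step_iter w m :
  zak_modulus f (w + gamma *+ m) = trig_cocycle c x y gamma m w * zak_modulus f w.
Proof.
elim: m => [|m IH]; first by rewrite mulr0n addr0 /trig_cocycle big_ord0 mul1r.
rewrite mulrSr addrA zak_modulus_step IH /trig_cocycle big_ord_recr /=.
by rewrite mulrCA mulrA.
Qed.

End Relation.
End ZakTransform.

(** * Recurrence and the zero set *)

Section Recurrence.
Variables (R : realType) (n : nat).

Lemma pigeonhole (T : finType) (F : nat -> T) : exists i j, (i < j)%N /\ F i = F j.
Proof.
apply: contrapT => h.
have injF : injective (fun i : 'I_(#|T|.+1) => F i).
  move=> i j E; apply: val_inj; case: (ltngtP i j) => // lt; case: h.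
    by exists i, j; split; [exact: lt|exact: E].
  by exists j, i; split; [exact: lt|exact: esym].
by have := leq_card _ injF; rewrite card_ord ltnn.
Qed.

(** Dirichlet's box principle: among the first multiples of [g] two fall in the same
    small cube of the unit box. *)
Lemma torus_recurrence (g : torus R n) (B : set (torus R n)) :
  nbhs 0 B -> exists2 q, (0 < q)%N & B (g *+ q).
Proof.
rewrite -to_torus0 => /to_torus_continuous/nbhs_ballP[e /= e0 he].
pose v := repr g.
have [N N0 Ne] : exists2 N : nat, (0 < N)%N & (N%:R : R)^-1 < e.
  exists (Num.truncn e^-1).+1 => //.
  by rewrite invf_plt ?posrE//; exact: truncnS_gt.
have fr (j : nat) : exists k : 'rV[int]_n, forall i, 0 <= (v *+ j + int_vec R k) 0 i < 1.
  exact: reduce_mod1.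
have [k hk] := choice fr.
pose w j := v *+ j + int_vec R (k j).
have cell j i := truncn_cell N0 (hk j i).
pose F (j : nat) : {ffun 'I_n -> 'I_N} := [ffun i => Ordinal (cell j i).1].
have [i [j [ij Fij]]] := pigeonhole F.
exists (j - i)%N; first by rewrite subn_gt0.
have -> : g *+ (j - i) = to_torus (w j - w i).
  rewrite -(to_torus_repr g) -/v -to_torusMn mulrnBr; last exact: ltnW.
  by rewrite to_torusD to_torusN /w to_torusD to_torusN !to_torus_int.
apply: he; rewrite mx_norm_ball /ball_ /= sub0r normrN; apply/norm_ltP => // l.
apply: lt_trans Ne.
have : nat_of_ord (F i l) = nat_of_ord (F j l) by rewrite Fij.
rewrite !ffunE /= => E.
have [_ /andP[a1 a2]] := cell i l; have [_ /andP[b1 b2]] := cell j l.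
rewrite -/(w i) E in a1 a2; rewrite -/(w j) in b1 b2.
have -> : (w j - w i) 0 l = w j 0 l - w i 0 l by rewrite !mxE.
move: (_^-1) (_%:R / _) a1 a2 b1 b2 => e' q a1 a2 b1 b2.
by rewrite ltr_norml; apply/andP; split; lra.
Qed.

Section Invariance.
Variables (F : torus R n -> R) (g : torus R n).
Hypothesis cF : continuous F.
Hypothesis F_step : forall w, F w = 0 -> F (w + g) = 0.

Let nbhs_F z : F z != 0 -> nbhs z [set w | F w != 0].
Proof.
move=> Fz; have : F w @[w --> z] --> F z by exact: cF.
move=> /cvgrPdist_lt/(_ `|F z|); rewrite normr_gt0 => /(_ Fz); apply: filterS => w /=.
by apply: contraTneq => ->; rewrite subr0 ltxx.
Qed.

(** If [F w] were not 0, neither would be [F] near [w], where the forward orbit returns. *)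
Lemma zero_back w : F (w + g) = 0 -> F w = 0.
Proof.
move=> h; apply/eqP/negP => /negP Fw.
have hn q : F (w + g *+ q.+1) = 0.
  elim: q => [|q IH]; first by rewrite mulr1n.
  by rewrite mulrSr addrA F_step.
have : nbhs (0 : torus R n) [set u | F (w + u) != 0].
  by apply: (@nbhs_addl_torus _ _ w 0 [set u | F u != 0]); rewrite addr0; exact: nbhs_F.
by move=> /(torus_recurrence g)[[//|q] _ /=]; rewrite hn eqxx.
Qed.

Lemma zero_orbit w (k : int) : F w = 0 -> F (w + g *~ k) = 0.
Proof.
have hn q u : F u = 0 -> F (u + g *+ q) = 0.
  by elim: q => [|q IH] h; rewrite ?mulr0n ?addr0// mulrSr addrA F_step ?IH.
move=> Fw; case: k => q; first exact: hn.
rewrite NegzE mulrNz.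
have hb p u : F (u + g *+ p) = 0 -> F u = 0.
  elim: p u => [|p IH] u; first by rewrite mulr0n addr0.
  by rewrite mulrS addrA => /IH/zero_back.
by apply: (hb q.+1); rewrite -[g *+ q.+1]/(g *~ q.+1) subrK.
Qed.

(** The zero set is closed and invariant under the group generated by [g], hence under its
    closure. *)
Lemma nonzero_orbit_closure l h :
  F l != 0 -> closure (range (fun k : int => g *~ k)) h -> F (l + h) != 0.
Proof.
move=> Fl Hh; apply/negP => /eqP F0.
have [_ _ HN] := closure_subgroup (orbit_subgroup g).
have : nbhs (- h) [set u | F (l + h + u) != 0].
  by apply: (@nbhs_addl_torus _ _ (l + h) (- h) [set u | F u != 0]); rewrite addrK; exact: nbhs_F.
by move=> /(HN h Hh)[_ [[k _ <-] /=]]; rewrite zero_orbit ?eqxx.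
Qed.

End Invariance.
End Recurrence.

(** * Fourier series on the torus *)

Section TorusFourier.
Variables (R : realType) (r : nat).
Implicit Types (k : 'rV[int]_r) (v : 'rV[R]_r).

Lemma torus_charE k v : torus_char k (to_torus v) =
  cos (dot (freq R k) v) +i* sin (dot (freq R k) v).
Proof.
rewrite /torus_char; have [l ->] := repr_to_torus v.
by rewrite dotDr dot_int e2piD e2pi_int mulr1 /e2pi /freq dotZl.
Qed.

Lemma torus_charD k (a b : torus R r) : torus_char k (a + b) = torus_char k a * torus_char k b.
Proof.
rewrite -(to_torus_repr a) -(to_torus_repr b) -to_torusD !torus_charE dotDr cosD sinD.
by apply/eqP; rewrite eq_complex /=; apply/andP; split; apply/eqP => //; rewrite addrC.
Qed.

Lemma torus_integralE (g : torus R r -> R) :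
  torus_integral g = cube_integral (g \o @to_torus R r).
Proof. by []. Qed.

Lemma fourier_coef_real (g : torus R r -> R) k : cperiodic (g \o @to_torus R r) ->
  fourier_coef (fun z => (g z)%:C) k =
  cos_coef (g \o @to_torus R r) k +i* - sin_coef (g \o @to_torus R r) k.
Proof.
move=> pg; rewrite /fourier_coef !torus_integralE; congr (_ +i* _).
  congr cube_integral; apply/funext => v.
  rewrite [LHS]/comp torus_charE /wave freqN dotNl cosN sinN.
  by rewrite [LHS]/= /comp; ring.
rewrite -mulN1r -cube_integralZ; last by apply: cperiodicM => //; exact: cperiodic_wave.
congr cube_integral; apply/funext => v.
rewrite [LHS]/comp torus_charE /wave freqN dotNl cosN sinN.
by rewrite [LHS]/= /comp; ring.
Qed.

(** A dense orbit leaves no room for a nontrivial character equal to 1 on it: the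
    character takes the value -1 at half a period. *)
Lemma torus_char_neq1 (omega : torus R r) k :
  dense (range (fun n : int => omega *~ n)) -> k != 0 -> torus_char k omega - 1 != 0.
Proof.
move=> dom k0; rewrite subr_eq0; apply/negP => /eqP h1.
have hn (n : int) : torus_char k (omega *~ n) = 1.
  have c0 : torus_char k (0 : torus R r) = 1.
    by have := torus_charD k 0 omega; rewrite add0r h1 mulr1 => <-.
  have hnat (m : nat) : torus_char k (omega *+ m) = 1.
    by elim: m => [|m IH]; [rewrite mulr0n c0|rewrite mulrS torus_charD h1 IH mul1r].
  case: n => m; first exact: hnat.
  have := torus_charD k (omega *+ m.+1) (omega *~ Negz m).
  by rewrite NegzE mulrNz -pmulrn subrr c0 hnat mul1r.
have [i ki] := rV0Pn _ k0.
pose h (z : torus R r) : R := complex.Re (torus_char k z).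
have ch : continuous h.
  apply: torus_continuousP.
  have -> : h \o @to_torus R r = wave (freq R k) 1 0.
    by apply/funext => v; rewrite [LHS]/comp /h torus_charE /wave mul1r mul0r addr0.
  exact: (cperiodic_wave k 1 0).1.
pose W := h @^-1` [set x | x < 0].
have oW : open W by apply: open_comp; [move=> z _; exact: ch|exact: open_lt].
have kR : (k 0 i)%:~R != 0 :> R by rewrite intr_eq0.
have W0 : W !=set0.
  exists (to_torus ((2 * (k 0 i)%:~R)^-1 *: delta_mx 0 i)).
  suff : h (to_torus ((2 * (k 0 i)%:~R)^-1 *: delta_mx 0 i)) < 0 by [].
  rewrite /h torus_charE [complex.Re _]/= dotZr dot_delta freq_coord.
  have -> : (2 * (k 0 i)%:~R)^-1 * (2 * pi * (k 0 i)%:~R) = pi :> R by field.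
  by rewrite cospi oppr_lt0.
have [z [Wz [n _ E]]] := dom W W0 oW.
have {Wz} : h z < 0 by [].
by rewrite -E /h hn ltNge ler01.
Qed.

(** A change of variable moves the translation from [U] to the character. *)
Lemma coboundary_coef (U : 'rV[R]_r -> R) (o : 'rV[R]_r) k : cperiodic U ->
  (cos_coef (fun v => U (v + o)) k +i* - sin_coef (fun v => U (v + o)) k) =
  torus_char k (to_torus o) * (cos_coef U k +i* - sin_coef U k).
Proof.
move=> pU.
have shift A B : cube_integral (fun v => U (v + o) * wave (freq R k) A B v) =
    cube_integral (fun v => U v * wave (freq R k) A B (v - o)).
  have pw := cperiodic_wave k A B.
  have pG : cperiodic (fun v => U v * wave (freq R k) A B (v - o)).
    by apply: cperiodicM => //; exact: periodic_shift.
  rewrite -(cube_integral_shift o pG).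
  by congr cube_integral; apply/funext => v; rewrite addrK.
have wsh A B v : wave (freq R k) A B (v - o) =
   wave (freq R k) (A * cos (dot (freq R k) o) - B * sin (dot (freq R k) o))
     (A * sin (dot (freq R k) o) + B * cos (dot (freq R k) o)) v.
  by rewrite /wave dotDr dotNr cosD sinD cosN sinN; ring.
rewrite /cos_coef /sin_coef !shift.
under eq_fun do rewrite wsh.
under [X in _ +i* - cube_integral X]eq_fun do rewrite wsh.
rewrite !coef_wave// torus_charE.
by apply/eqP; rewrite eq_complex /=; apply/andP; split; apply/eqP; ring.
Qed.

Lemma partials_wave_coef (G : 'rV[R]_r -> R) (s : seq 'I_r) k : smooth_periodic G ->
  [/\ smooth_periodic (partials s G),
      partials s (fourier_term G k) = fourier_term (partials s G) k &
      partials s (wave (freq R k) (- sin_coef G k) (cos_coef G k)) =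
      wave (freq R k) (- sin_coef (partials s G) k) (cos_coef (partials s G) k)].
Proof.
move=> sG; elim: s => [|i s [sP E1 E2]] //=; split.
- exact: smooth_periodic_partial.
- rewrite -/(partials s _) E1 /fourier_term partial_wave.
  by rewrite cos_coef_partial// sin_coef_partial.
- rewrite -/(partials s _) E2 partial_wave.
  by rewrite cos_coef_partial// sin_coef_partial// opprK mulrN opprK.
Qed.

Lemma partials_sum (J : Type) (K : seq J) (g : J -> 'rV[R]_r -> R) (s : seq 'I_r) :
  (forall j, smooth (g j)) ->
  partials s (fun v => \sum_(j <- K) g j v) = fun v => \sum_(j <- K) partials s (g j) v.
Proof.
move=> sg; elim: s => //= i s IH; rewrite -/(partials s _) IH.
apply/funext => v; apply: partial_eq; apply: is_derive_bigsum => j.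
by apply: smooth_derive; exact: smooth_partials.
Qed.

Lemma partials0 (s : seq 'I_r) : partials s (fun _ : 'rV[R]_r => 0 : R) = fun=> 0.
Proof.
elim: s => //= i s; rewrite -/(partials s _) => ->; apply/funext => w.
by apply: partial_eq; exact: is_derive_cst.
Qed.

Lemma complex_sumE (J : Type) (K : seq J) (A B : J -> R) :
  \sum_(j <- K) (A j +i* B j) = (\sum_(j <- K) A j) +i* (\sum_(j <- K) B j).
Proof. by elim: K => [|j K IH]; rewrite ?big_nil// !big_cons IH. Qed.

Lemma sin_coef0 (G : 'rV[R]_r -> R) : sin_coef G 0 = 0.
Proof.
rewrite /sin_coef -[RHS](cube_integral_cst r 0); congr cube_integral.
by apply/funext => v; rewrite wave0 mulr0.
Qed.

(** The Fourier series of a smooth function converges with all derivatives, since the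
    differentiated series are the Fourier series of the derivatives. *)
Lemma fourier_cvg_Cinfty (g : torus R r -> R) (gh : {k : 'rV[int]_r | k != 0} -> R[i]) :
  let G := g \o @to_torus R r in
  smooth_periodic G ->
  (forall k : {k : 'rV[int]_r | k != 0}, gh k = cos_coef G (val k) +i* - sin_coef G (val k)) ->
  cvg_Cinfty (fun (K : {fset {k : 'rV[int]_r | k != 0}}) z =>
     (cos_coef G 0)%:C + partial_sum (fun k : {k : 'rV[int]_r | k != 0} => gh k * torus_char (val k) z) K)
    totally (fun z => (g z)%:C).
Proof.
move=> G sG ghE s e e0.
have [sP _ _] := partials_wave_coef s 0 sG.
have [K0 hK0] := fourier_series_uniform sP (ltac:(lra) : 0 < e / 4).
pose A := [fset k in pmap insub K0 : seq {k : 'rV[int]_r | k != 0}]%fset.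
exists A => // K AK v.
(* The constant term is the term of frequency 0. *)
pose L := 0 :: map val (enum_fset K).
have uL : uniq L.
  rewrite /= (map_inj_uniq val_inj) fset_uniq andbT.
  by apply/mapP => -[k _ k0]; have := valP k; rewrite /= -k0 eqxx.
have sL : {subset K0 <= L}.
  move=> k kK0; rewrite in_cons; have [//|k0] := eqVneq k 0.
  apply/mapP; exists (Sub k k0); last by rewrite SubK.
  apply: (fsubsetP AK); rewrite in_fset_ mem_pmap; apply/mapP; exists k => //.
  by rewrite insubT.
have [h1 h2] := hK0 L uL sL v.
have termE (k : {k : 'rV[int]_r | k != 0}) w : gh k * torus_char (val k) (to_torus w) =
    fourier_term G (val k) w +i*
    wave (freq R (val k)) (- sin_coef G (val k)) (cos_coef G (val k)) w.
  rewrite ghE torus_charE /fourier_term /wave.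
  by apply/eqP; rewrite eq_complex /=; apply/andP; split; apply/eqP; ring.
have psE w : (cos_coef G 0)%:C +
    partial_sum (fun k : {k : 'rV[int]_r | k != 0} => gh k * torus_char (val k) (to_torus w)) K =
    (\sum_(k <- L) fourier_term G k w) +i*
    (\sum_(k <- L) wave (freq R k) (- sin_coef G k) (cos_coef G k) w).
  rewrite /partial_sum -(big_seq_fsetE _ _ xpredT
    (fun k : {k : 'rV[int]_r | k != 0} => gh k * torus_char (val k) (to_torus w))) /=.
  rewrite (eq_bigr _ (fun j _ => termE j w)) /L !big_cons !big_map.
  rewrite !wave0 sin_coef0 oppr0 add0r.
  by rewrite complex_sumE /fourier_term wave0; apply/eqP; rewrite eq_complex /= add0r !eqxx.
have reE : partials s (fun w => complex.Re ((cos_coef G 0)%:C +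
    partial_sum (fun k : {k : 'rV[int]_r | k != 0} => gh k * torus_char (val k) (to_torus w)) K)) =
    fun w => \sum_(k <- L) fourier_term (partials s G) k w.
  under eq_fun do rewrite psE /=.
  rewrite partials_sum; last by move=> k; exact: smooth_wave.
  apply/funext => w; apply: eq_bigr => k _.
  by have [_ -> _] := partials_wave_coef s k sG.
have imE : partials s (fun w => complex.Im ((cos_coef G 0)%:C +
    partial_sum (fun k : {k : 'rV[int]_r | k != 0} => gh k * torus_char (val k) (to_torus w)) K)) =
    fun w => \sum_(k <- L) wave (freq R k) (- sin_coef (partials s G) k)
       (cos_coef (partials s G) k) w.
  under eq_fun do rewrite psE /=.
  rewrite partials_sum; last by move=> k; exact: smooth_wave.
  apply/funext => w; apply: eq_bigr => k _.
  by have [_ _ ->] := partials_wave_coef s k sG.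
have im0 := partials0 s.
have -> : partialsC s ((fun z => (cos_coef G 0)%:C +
      partial_sum (fun k : {k : 'rV[int]_r | k != 0} => gh k * torus_char (val k) z) K) \o
      @to_torus R r) v =
    (\sum_(k <- L) fourier_term (partials s G) k v) +i*
    (\sum_(k <- L) wave (freq R k) (- sin_coef (partials s G) k)
       (cos_coef (partials s G) k) v).
  by rewrite /partialsC reE imE.
have -> : partialsC s ((fun z => (g z)%:C) \o @to_torus R r) v = partials s G v +i* 0.
  by rewrite /partialsC im0.
set a := \sum_(k <- L) _; set b := \sum_(k <- L) _.
rewrite (_ : _ - _ = (a - partials s G v) +i* b); last first.
  by apply/eqP; rewrite eq_complex /= oppr0 addr0 !eqxx.
apply: le_lt_trans (cmod_le _ _) _.
by move: h1 h2; rewrite -/a -/b; lra.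
Qed.

End TorusFourier.

(** * The cocycle and the theorem *)

Lemma ln_sqrt_half (R : realType) (s : R) : 0 < s -> ln (Num.sqrt s) = 2^-1 * ln s.
Proof.
move=> s0; have t0 : 0 < Num.sqrt s by rewrite sqrtr_gt0.
by rewrite -{2}(sqr_sqrtr (ltW s0)) lnXn//; lra.
Qed.

Section TrigAnalytic.
Variables (R : realType) (d r K : nat) (x y : 'I_K -> 'rV[int]_d) (c : 'I_K -> R[i]).
Implicit Types (z : 'rV[R]_(d + d)) (v : 'rV[R]_r).

Definition pair_freq k : 'rV[R]_(d + d) := row_mx (int_vec R (y k)) (int_vec R (x k)).

Lemma trig_at_sum z : trig_at x y c z = \sum_k c k * e2pi (- dot (pair_freq k) z).
Proof.
apply: eq_bigr => k _; rewrite -mulrA -e2piD; congr (_ * e2pi _).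
rewrite (dotC (rsubmx z)) -opprD /pair_freq; congr (- _).
rewrite /dot big_split_ord /=; congr (_ + _); apply: eq_bigr => i _.
  by rewrite row_mxEl !mxE.
by rewrite row_mxEr !mxE.
Qed.

(** The squared modulus of an exponential sum is a real trigonometric sum whose
    frequencies are the differences of the given ones. *)
Lemma ln_trig_analytic (z0 : 'rV[R]_(d + d)) (L : 'M[R]_(r, d + d)) :
  (forall v, 0 < cmod (trig_at x y c (z0 + v *m L))) ->
  forall a, analytic_at0 (fun h => ln (cmod (trig_at x y c (z0 + (a + h) *m L)))).
Proof.
move=> T0 a.
pose th k : 'rV[R]_r := (2 * pi) *: (pair_freq k *m L^T).
have thE k v : 2 * pi * dot (pair_freq k) (v *m L) = dot (th k) v.
  rewrite dotZl; congr (_ * _); rewrite /dot.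
  transitivity (\sum_i \sum_j pair_freq k 0 i * (v 0 j * L j i)).
    by apply: eq_bigr => i _; rewrite [(v *m L) 0 i]mxE mulr_sumr.
  rewrite exchange_big; apply: eq_bigr => j _; rewrite [(_ *m _) 0 j]mxE mulr_suml.
  by apply: eq_bigr => i _; rewrite [_^T i j]mxE; ring.
pose C k := c k * e2pi (- dot (pair_freq k) z0).
pose p k := complex.Re (C k); pose q k := complex.Im (C k).
pose U k v := p k * cos (dot (th k) v) + q k * sin (dot (th k) v).
pose W k v := q k * cos (dot (th k) v) - p k * sin (dot (th k) v).
have TE v : trig_at x y c (z0 + v *m L) = (\sum_k U k v) +i* (\sum_k W k v).
  rewrite trig_at_sum -complex_sumE; apply: eq_bigr => k _.
  rewrite dotDr opprD e2piD mulrA -/(C k) /e2pi mulrN thE cosN sinN /U /W /p /q.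
  by case: (C k) => e1 e2; apply/eqP; rewrite eq_complex /=; apply/andP; split; apply/eqP; ring.
pose A (j : 'I_K * 'I_K) := p j.1 * p j.2 + q j.1 * q j.2.
pose B (j : 'I_K * 'I_K) := q j.1 * p j.2 - p j.1 * q j.2.
pose th2 (j : 'I_K * 'I_K) := th j.1 - th j.2.
pose P v := \sum_j (A j * cos (dot (th2 j) v) + B j * sin (dot (th2 j) v)).
have PE v : (\sum_k U k v) ^+ 2 + (\sum_k W k v) ^+ 2 = P v.
  rewrite !expr2 !mulr_suml -big_split /P -(pair_bigA _ (fun k l =>
    A (k, l) * cos (dot (th2 (k, l)) v) + B (k, l) * sin (dot (th2 (k, l)) v))) /=.
  apply: eq_bigr => k _; rewrite !mulr_sumr -big_split; apply: eq_bigr => l _.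
  by rewrite /A /B /th2 /U /W /= dotDl dotNl cosD sinD cosN sinN; ring.
have P0 v : 0 < P v.
  by have := T0 v; rewrite TE cmodE PE sqrtr_gt0.
have -> : (fun h => ln (cmod (trig_at x y c (z0 + (a + h) *m L)))) =
    fun h => 2^-1 * ln (P (a + h)).
  by apply/funext => h; rewrite TE cmodE PE ln_sqrt_half.
by apply: analytic_at0Z; exact: ln_trig_sum_analytic.
Qed.

End TrigAnalytic.

Lemma ln_prod (R : realType) (I : Type) (s : seq I) (F : I -> R) :
  (forall i, 0 < F i) -> ln (\prod_(i <- s) F i) = \sum_(i <- s) ln (F i).
Proof.
move=> F0; elim: s => [|i s IH]; first by rewrite !big_nil ln1.
by rewrite !big_cons lnM ?IH// posrE//; exact: prodr_gt0.
Qed.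

Theorem proposition5p1 (R : realType) (d N : nat)
  (d_ge1 : (1 <= d)%N) (N_ge2 : (2 <= N)%N)
  (x y : 'I_N.-1 -> 'rV[int]_d) (alpha beta : 'rV[R]_d)
  (alpha_beta_nonint : ~ exists a b : 'rV[int]_d,
     alpha = int_vec R a /\ beta = int_vec R b)
  (f : 'rV[R]_d -> R[i]) (f_neq0 : exists t, f t != 0) (f_schwartz : schwartz f)
  (c : 'I_N.-1 -> R[i])
  (f_dep : forall t,
     \sum_k c k * modulation (int_vec R (y k)) (translation (int_vec R (x k)) f) t
     = modulation beta (translation alpha f) t) :
  let gamma : torus R (d + d) := to_torus (row_mx (- alpha) beta) in
  let H : set (torus R (d + d)) := closure (range (fun n : int => gamma *~ n)) in
  infinite_set H -> H <> setT ->
  let H0 : set (torus R (d + d)) := connected_component H 0 in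
  forall (m r : nat)
    (Phi : torus R (d + d) -> torus R r) (Psi : torus R r -> torus R (d + d)),
  (cosets H H0 #= `I_m)%card -> has_lie_dim H0 r -> lie_group_iso H0 Phi Psi ->
  let omega : torus R r := Phi (gamma *+ m) in
  dense (range (fun n : int => omega *~ n)) /\
  forall lambda : torus R (d + d), zak_modulus f lambda != 0 ->
  let u : torus R r -> R := fun z => ln (zak_modulus f (lambda + Psi z)) in
  let b : torus R r -> R :=
    fun z => ln (trig_cocycle c x y gamma m (lambda + Psi z)) in
  let u_hat := fourier_coef (fun z => (u z)%:C) in
  let b_hat := fourier_coef (fun z => (b z)%:C) in
  (forall z, 0 < zak_modulus f (lambda + Psi z) /\
             0 < trig_cocycle c x y gamma m (lambda + Psi z)) /\
  [/\ torus_smooth u /\ torus_analytic b,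
      forall z, u (z + omega) - u z = b z,
      b_hat 0 = (torus_integral b)%:C /\ torus_integral b = 0,
      forall k : 'rV[int]_r, k != 0 ->
        torus_char k omega - 1 != 0 /\
        u_hat k = b_hat k / (torus_char k omega - 1) &
      exists c_lambda : R,
        cvg_Cinfty
          (fun (K : {fset {k : 'rV[int]_r | k != 0}}) z =>
             c_lambda%:C +
             partial_sum
               (fun k : {k : 'rV[int]_r | k != 0} =>
                  b_hat (val k) / (torus_char (val k) omega - 1)
                  * torus_char (val k) z) K)
          totally (fun z => (u z)%:C)].
Proof.
move=> gamma H _ _ H0 m r Phi Psi cardH _ iso omega.
have sH : subgroup H := closure_subgroup (orbit_subgroup gamma).
have sH0 : subgroup H0 := component_subgroup sH.
have H0H : H0 `<=` H by exact: connected_component_sub.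
have cH0 : closed H0 by apply: component_closed; exact: closed_closure.
have [H0g H0d] := cyclic_quotient sH0 cH0 H0H cardH.
have dense_omega : dense (range (fun n : int => omega *~ n)).
  exact: (iso_dense sH0 iso H0g H0d).
split=> // lambda Flambda u b u_hat b_hat.
have HPsi z : H (Psi z) by have [_ _ PhiK _ _] := iso; exact: H0H (PhiK z).1.
have F_step := zak_modulus_step f_schwartz f_dep; rewrite -/gamma in F_step.
have HD h j : H h -> H (h + gamma *+ j).
  have [_ AD _] := sH => Hh; apply: AD => //.
  by apply: subset_closure; exists (j : int).
have F_gt0 h : H h -> 0 < zak_modulus f (lambda + h).
  move=> Hh; rewrite lt0r zak_modulus_ge0 andbT.
  apply: (nonzero_orbit_closure (zak_modulus_continuous f_schwartz) _ Flambda Hh) => w Fw.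
  by rewrite F_step Fw mulr0.
(* If a factor of [Q_m] vanished, so would [F] one step later, within [lambda + H]. *)
have p_gt0 h j : H h -> 0 < cmod (trig_poly c x y (lambda + h + gamma *+ j)).
  move=> Hh; rewrite lt0r cmod_ge0 andbT; apply/negP => /eqP p0.
  have := F_gt0 _ (HD h j.+1 Hh).
  by rewrite mulrSr !addrA F_step p0 mul0r ltxx.
have Q_gt0 z : 0 < trig_cocycle c x y gamma m (lambda + Psi z).
  by apply: prodr_gt0 => j _; exact: p_gt0.
have [L LE] := linear_lift sH0 iso.
pose l := repr lambda; pose g0 : 'rV[R]_(d + d) := row_mx (- alpha) beta.
have liftE v : lambda + Psi (to_torus v) = to_torus (l + v *m L).
  by rewrite LE to_torusD to_torus_repr.
pose U := u \o @to_torus R r; pose B := b \o @to_torus R r.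
pose E z := zak_re f z ^+ 2 + zak_im f z ^+ 2.
have sE : smooth E.
  have -> : E = fun z => zak_re f z * zak_re f z + zak_im f z * zak_im f z by [].
  have sr := smooth_zak_re f_schwartz; have si := smooth_zak_im f_schwartz.
  exact: (smoothD (smoothM sr sr) (smoothM si si)).
have E_gt0 v : 0 < E (l + v *m L).
  have := F_gt0 _ (HPsi (to_torus v)); rewrite liftE zak_modulusE//.
  by rewrite sqrtr_gt0.
have sU : smooth_periodic U.
  split=> [|v k]; last by rewrite /U /comp to_torus_int.
  have -> : U = fun v => 2^-1 * ln (E (l + v *m L)).
    apply/funext => v; rewrite /U /comp /u liftE zak_modulusE//.
    by rewrite ln_sqrt_half//; exact: E_gt0.
  apply: smoothM; [exact: smooth_cst|apply: smooth_ln => //].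
  exact: (smooth_affine l L sE).
have anB : torus_analytic b.
  apply: real_analytic_at0 => a.
  have trigE (j : nat) v : trig_poly c x y (lambda + Psi (to_torus v) + gamma *+ j) =
      trig_at x y c (l + g0 *+ j + v *m L).
    by rewrite liftE -to_torusMn -to_torusD trig_poly_to_torus addrAC.
  have -> : (fun h => (b \o @to_torus R r) (a + h)) = fun h =>
      \sum_(j < m) ln (cmod (trig_at x y c (l + g0 *+ j + (a + h) *m L))).
    apply/funext => h; rewrite /comp /b /trig_cocycle ln_prod => [|j]; last exact: p_gt0.
    by apply: eq_bigr => j _; rewrite trigE.
  apply: analytic_at0_sum => j; apply: ln_trig_analytic => v.
  by rewrite -trigE; exact: p_gt0.
have cob z : u (z + omega) - u z = b z.
  have PsiO : Psi omega = gamma *+ m by have [_ PsiK _ _ _] := iso; exact: PsiK.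
  rewrite /u (iso_psiD sH0 iso) PsiO addrA (zak_modulus_step_iter f_schwartz f_dep).
  by rewrite lnM ?posrE ?F_gt0// addrK.
pose o := repr omega.
have BE : B = fun v => U (v + o) - U v.
  by apply/funext => v; rewrite /B /U /comp -cob to_torusD to_torus_repr.
have pU : cperiodic U := smooth_periodic_cperiodic sU.
have pUo : cperiodic (fun v => U (v + o)) by exact: periodic_shift.
have pB : cperiodic B by rewrite BE; exact: periodicB.
have int0 : torus_integral b = 0.
  by rewrite torus_integralE -/B BE cube_integralB// cube_integral_shift// subrr.
have uhE k : u_hat k = cos_coef U k +i* - sin_coef U k by exact: fourier_coef_real.
have bhE k : b_hat k = cos_coef B k +i* - sin_coef B k by exact: fourier_coef_real.
have buE k : b_hat k = (torus_char k omega - 1) * u_hat k.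
  rewrite mulrBl mul1r uhE bhE -[omega in RHS]to_torus_repr -coboundary_coef//.
  have pw A C := cperiodic_wave k (A : R) C.
  have -> : cos_coef B k = cos_coef (fun v => U (v + o)) k - cos_coef U k.
    rewrite /cos_coef BE -cube_integralB; try exact: cperiodicM.
    by congr cube_integral; apply/funext => v; rewrite mulrBl.
  have -> : sin_coef B k = sin_coef (fun v => U (v + o)) k - sin_coef U k.
    rewrite /sin_coef BE -cube_integralB; try exact: cperiodicM.
    by congr cube_integral; apply/funext => v; rewrite mulrBl.
  by apply/eqP; rewrite eq_complex /= opprB opprK eqxx addrC eqxx.
have char1 k : k != 0 -> torus_char k omega - 1 != 0 by exact: torus_char_neq1.
have divE k : k != 0 -> u_hat k = b_hat k / (torus_char k omega - 1).
  by move=> k0; rewrite buE mulrC mulKf// char1.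
split=> [z|]; first by split; [exact: F_gt0|exact: Q_gt0].
split=> //.
- by split=> //; exact: sU.1.
- split=> //; rewrite bhE sin_coef0 oppr0.
  congr (_ +i* _); rewrite torus_integralE; congr cube_integral; apply/funext => v.
  by rewrite wave0 mulr1.
- by move=> k k0; split; [exact: char1|exact: divE].
- exists (cos_coef U 0); apply: fourier_cvg_Cinfty => //.
  by move=> k; rewrite -divE ?uhE//; exact: (valP k).
Qed.
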